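(* Let $\{X_t: t\ge 0\}$ be a purely non-Gaussian $d$-dimensional Lévy process with $X_0=0$ and Lévy measure $\Pi$. Let $h\in\mathcal{H}_1$ and let $b(t)=\sqrt{t\log\log(1/t)}/h(1/t)$ for all sufficiently small $t>0$ (say for $0<t\le t_0$, where $t_0\in(0,e^{-1})$ is such that $b$ is well defined and positive on $(0,t_0]$). Assume that $$\int_0^{t_0}\overline{\Pi}(b(t))\,dt<\infty$$ and that for some $\lambda\ge 0$, $$\limsup_{t\downarrow 0} V(b(t))\,h^2(1/t)\le \lambda^2/2.$$ Then with probability one, $$\limsup_{t\downarrow 0} h(1/t)\frac{|X_t|}{\sqrt{t\log\log(1/t)}}\le\lambda.$$
   Context: A $d$-dimensional Lévy process with $X_0=0$ has characteristic triplet $(\gamma,\Sigma,\Pi)$ with $\gamma\in\mathbb{R}^d$, $\Sigma$ a symmetric non-negative definite $d\times d$ matrix and $\Pi$ a Lévy measure on $\mathbb{R}^d$ (i.e. $\Pi(\{0\})=0$ and $\int(1\wedge|y|^2)\Pi(dy)<\infty$); it is called purely non-Gaussian if $\Sigma=0$. Here $|\cdot|$ is the Euclidean norm and $\langle\cdot,\cdot\rangle$ the Euclidean inner product. Notation: $\overline{\Pi}(x)=\Pi\{y:|y|>x\}$ for $x>0$, and $V(t)=\sup_{|z|\le1}\int_{|y|\le t}\langle y,z\rangle^2\,\Pi(dy)$ for $t\ge0$. $\mathcal{H}_1$ denotes the class of continuous, non-decreasing functions $h:[0,\infty)\to[0,\infty)$ that are slowly varying at infinity. *)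

(* Defs.v *)
From HB Require Import structures.
From mathcomp Require Import all_boot all_order all_algebra.
From mathcomp Require Import all_classical all_reals all_analysis.
Set Implicit Arguments. Unset Strict Implicit. Unset Printing Implicit Defensive.
Import Order.TTheory GRing.Theory Num.Theory.
Import numFieldNormedType.Exports.
Local Open Scope classical_set_scope.
Local Open Scope ring_scope.

(* R^d is represented by d.-tuple R, equipped (by MathComp-Analysis) with the
   product sigma-algebra generated by the coordinates, i.e. the Borel sets. *)
Section vectors.
Variables (R : realType) (d : nat).

Definition vcoord (x : d.-tuple R) (i : 'I_d) : R := tnth x i.
Definition vdot (x y : d.-tuple R) : R := \sum_(i < d) vcoord x i * vcoord y i.
Definition vnorm (x : d.-tuple R) : R := Num.sqrt (\sum_(i < d) vcoord x i ^+ 2).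
Definition vzero : d.-tuple R := [tuple (0 : R) | i < d].
Definition vsub (x y : d.-tuple R) : d.-tuple R :=
  [tuple vcoord x i - vcoord y i | i < d].
Definition qform (S : 'M[R]_d) (x : d.-tuple R) : R :=
  \sum_(i < d) \sum_(j < d) vcoord x i * S i j * vcoord x j.
End vectors.

Section levy.
Variables (R : realType) (d : nat).
Local Notation V := (d.-tuple R).

Definition is_levy_measure (Pi : {measure set V -> \bar R}) : Prop :=
  Pi [set vzero R d] = 0%E /\
  (\int[Pi]_y (Num.min 1 (vnorm y ^+ 2))%:E < +oo)%E.

(* Real and imaginary parts of the Lévy–Khintchine exponent
   Psi(theta) = i<gamma,theta> - <theta,Sigma theta>/2
              + int (e^{i<theta,y>} - 1 - i<theta,y> 1_{|y|<=1}) Pi(dy). *)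
Definition LK_re (Sigma : 'M[R]_d) (Pi : {measure set V -> \bar R}) (theta : V) : R :=
  - qform Sigma theta / 2 + Rintegral Pi setT (fun y => cos (vdot theta y) - 1).
Definition LK_im (gamma : V) (Pi : {measure set V -> \bar R}) (theta : V) : R :=
  vdot gamma theta +
  Rintegral Pi setT (fun y => sin (vdot theta y)
                              - vdot theta y * (if vnorm y <= 1 then 1 else 0)).

Definition is_levy_triplet (gamma : V) (Sigma : 'M[R]_d)
    (Pi : {measure set V -> \bar R}) : Prop :=
  Sigma^T = Sigma /\ (forall x : V, 0 <= qform Sigma x) /\ is_levy_measure Pi.

Definition levy_process (d0 : measure_display) (T : measurableType d0)
    (P : probability T R) (X : R -> T -> V)
    (gamma : V) (Sigma : 'M[R]_d) (Pi : {measure set V -> \bar R}) : Prop :=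
  is_levy_triplet gamma Sigma Pi /\
  (forall t, 0 <= t -> measurable_fun setT (X t)) /\
  {ae P, forall w, X 0 w = vzero R d} /\
  (forall (n : nat) (s : 'I_n.+1 -> R), 0 <= s ord0 ->
     (forall i : 'I_n, s (widen_ord (leqnSn n) i) < s (lift ord0 i)) ->
     forall B : 'I_n -> set V, (forall i, measurable (B i)) ->
     P (\bigcap_(i in [set: 'I_n])
          [set w | B i (vsub (X (s (lift ord0 i)) w) (X (s (widen_ord (leqnSn n) i)) w))])
     = (\prod_(i < n)
          P [set w | B i (vsub (X (s (lift ord0 i)) w) (X (s (widen_ord (leqnSn n) i)) w))])%E) /\
  (forall s t, 0 <= s -> s <= t -> forall B : set V, measurable B ->
     P [set w | B (vsub (X t w) (X s w))] = P [set w | B (X (t - s) w)]) /\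
  {ae P, forall w, forall t, 0 <= t -> forall i : 'I_d,
      (vcoord (X s w) i @[s --> t^'+] --> vcoord (X t w) i) /\
      (0 < t -> cvg (vcoord (X s w) i @[s --> t^'-]))} /\
  (* characteristic function E exp(i<theta,X_t>) = exp(t Psi(theta)) *)
  (forall t, 0 <= t -> forall theta : V,
     (\int[P]_w (cos (vdot theta (X t w)))%:E
        = (expR (t * LK_re Sigma Pi theta) * cos (t * LK_im gamma Pi theta))%:E)%E /\
     (\int[P]_w (sin (vdot theta (X t w)))%:E
        = (expR (t * LK_re Sigma Pi theta) * sin (t * LK_im gamma Pi theta))%:E)%E).

Definition Pibar (Pi : {measure set V -> \bar R}) (x : R) : \bar R :=
  Pi [set y | x < vnorm y].

Definition Vfun (Pi : {measure set V -> \bar R}) (t : R) : \bar R :=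
  ereal_sup [set (\int[Pi]_(y in [set y | (vnorm y <= t)%R]) ((vdot y z) ^+ 2)%:E)%E
            | z in [set z : V | (vnorm z <= 1)%R]].
End levy.

Definition slowly_varying (R : realType) (h : R -> R) : Prop :=
  forall c : R, 0 < c -> h (c * x) / h x @[x --> +oo] --> (1 : R).

Definition in_H1 (R : realType) (h : R -> R) : Prop :=
  {within `[0, +oo[, continuous h} /\
  (forall x y, 0 <= x -> x <= y -> h x <= h y) /\
  (forall x, 0 <= x -> 0 <= h x) /\
  slowly_varying h.

Definition bfun (R : realType) (h : R -> R) (t : R) : R :=
  Num.sqrt (t * ln (ln t^-1)) / h t^-1.

(* Main.v *)
(* A Chernoff bound for one coordinate [<z, X_t>] with the jumps above [b(t)]
   discarded needs exponential moments of a truncated process. Instead of the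
   Levy-Ito decomposition, X_t is cut into n independent increments, each of them
   truncated at a small multiple of b(t); the exponential of a truncated variable
   is dominated by a combination of trigonometric functions, whose means are
   given by the characteristic exponent, and n goes to infinity. This gives a
   Fuk-Nagaev inequality P(<z, X_t> > x b(t)) <= C q(t) + (Gaussian bound), where
   the variance is controlled by V and q(t) = t int min(1, (|y| / b(t))^4) Pi(dy).
   Along a geometric sequence t_k, both q(t_k) (by the integral hypothesis) and
   the Gaussian bound (by the hypothesis on V) are summable, and the drift that is
   left by the truncation is o(b(t_k)). Ottaviani's inequality and Borel-Cantelli
   then bound sup_{s <= t_k} <z, X_s>, and finitely many directions z suffice to
   bound |X_t|. *)
Require Import Defs.
From HB Require Import structures.
From mathcomp Require Import all_boot all_order all_algebra.
From mathcomp Require Import all_classical all_reals all_analysis.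
From mathcomp Require Import measurable_realfun.
From mathcomp Require Import ring lra.
Import Order.TTheory GRing.Theory Num.Theory.
Import numFieldNormedType.Exports.
Local Open Scope classical_set_scope.
Local Open Scope ring_scope.
Set Implicit Arguments. Unset Strict Implicit. Unset Printing Implicit Defensive.

(** * Elementary inequalities *)

Section real_inequalities.
Context {R : realType}.
Implicit Types (f df : R -> R) (s v x p th e C : R).

(** The constant [lambda] is sharp, so the exponential inequality may lose only a factor [1 + e] in
    its Gaussian term; every other error has to be of the order of [q], which is summed separately.
    The fourth power in [q] serves two purposes. Along the scale [t] shrinks by [w ^ 2] per step and
    [b] by about [w], so [t / b ^ 4] grows geometrically; this is how a condition on the jumps above
    [b(t)] also controls the smaller ones. And [(1 - cos x) ^ 2], of order [x ^ 4] near 0, is a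
    combination of 1, [cos x] and [cos (2 x)], so its mean can be read off the characteristic
    function. All expansions are of first order in the duration [s] of an increment; their errors
    [O(s ^ 2)] may have any constant, since [n] of them with [s = t / n] add up to [O(1 / n)]. For a
    target level [lambda + g], the surplus [g] is shared between the variance, the drift, the shift
    in Ottaviani's inequality, a gain that makes a power of [ln (1 / t)] summable, and the passage
    from the scale to all [t]. *)

Lemma ge0_of_derive f df x : (forall y, is_derive y (1 : R) f (df y)) ->
  f 0 = 0 -> 0 <= x -> (forall y, 0 <= y <= x -> 0 <= df y) -> 0 <= f x.
Proof.
move=> fdf f0 x0 df0.
have [->|xneq0] := eqVneq x 0; first by rewrite f0.
have x1 : 0 < x by rewrite lt_neqAle eq_sym xneq0.
have cf : {within `[0, x], continuous f}.
  apply: continuous_subspaceT => y.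
  by apply: differentiable_continuous; apply/derivable1_diffP; case: (fdf y).
have [c /itvP cx] := MVT x1 (fun y _ => fdf y) cf.
rewrite f0 !subr0 => ->; rewrite mulr_ge0// df0//.
by rewrite !cx.
Qed.

Lemma sin_le_id x : 0 <= x -> sin x <= x.
Proof.
move=> x0; rewrite -subr_ge0.
apply: (@ge0_of_derive (fun y => y - sin y) (fun y => 1 - cos y)) => //.
by rewrite sin0 subr0.
Qed.

Lemma cos_ge_quadratic x : 1 - x ^+ 2 / 2 <= cos x.
Proof.
have H (z : R) : 0 <= z -> 1 - z ^+ 2 / 2 <= cos z.
  move=> z0; rewrite -subr_ge0.
  apply: (@ge0_of_derive (fun y => cos y - (1 - y ^+ 2 / 2))
    (fun y => y - sin y)) => //.
  - move=> y; apply: is_derive_eq.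
    rewrite /GRing.scale/=; lra.
  - by rewrite cos0; lra.
  - by move=> y /andP[y0 _]; rewrite subr_ge0 sin_le_id.
have [x0|x0] := leP 0 x; first exact: H.
by rewrite -cosN -sqrrN; apply: H; rewrite oppr_ge0 ltW.
Qed.

Lemma sin_ge_cubic x : 0 <= x -> x - x ^+ 3 / 6 <= sin x.
Proof.
move=> x0; rewrite -subr_ge0.
apply: (@ge0_of_derive (fun y => sin y - (y - y ^+ 3 / 6))
  (fun y => cos y - (1 - y ^+ 2 / 2))) => //.
- move=> y; apply: is_derive_eq.
  rewrite /GRing.scale/=; lra.
- by rewrite sin0; lra.
- by move=> y _; rewrite subr_ge0 cos_ge_quadratic.
Qed.

Lemma cos_le_quartic x : cos x <= 1 - x ^+ 2 / 2 + x ^+ 4 / 24.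
Proof.
have H (z : R) : 0 <= z -> cos z <= 1 - z ^+ 2 / 2 + z ^+ 4 / 24.
  move=> z0; rewrite -subr_ge0.
  apply: (@ge0_of_derive (fun y => 1 - y ^+ 2 / 2 + y ^+ 4 / 24 - cos y)
    (fun y => sin y - (y - y ^+ 3 / 6))) => //.
  - move=> y; apply: is_derive_eq.
    rewrite /GRing.scale/=; lra.
  - by rewrite cos0; lra.
  - by move=> y /andP[y0 _]; rewrite subr_ge0 sin_ge_cubic.
have [x0|x0] := leP 0 x; first exact: H.
have -> : x ^+ 4 = (- x) ^+ 4 by ring.
by rewrite -cosN -(sqrrN x); apply: H; rewrite oppr_ge0 ltW.
Qed.

Lemma sin_sub_id_le x : `|sin x - x| <= `|x| ^+ 3 / 6.
Proof.
have H (z : R) : 0 <= z -> `|sin z - z| <= z ^+ 3 / 6.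
  move=> z0; rewrite ler_norml; apply/andP; split.
    by have := sin_ge_cubic z0; lra.
  rewrite (@le_trans _ _ 0) ?divr_ge0 ?exprn_ge0//.
  by rewrite subr_le0 sin_le_id.
have [x0|x0] := leP 0 x; first by rewrite (ger0_norm x0) H.
rewrite (ltr0_norm x0); have := H (- x).
rewrite sinN (_ : - sin x - - x = - (sin x - x)); last by ring.
by rewrite normrN; apply; rewrite oppr_ge0 ltW.
Qed.

Lemma expR_le_quadratic_le0 x : x <= 0 -> expR x <= 1 + x + x ^+ 2 / 2.
Proof.
move=> x0.
suff H (z : R) : 0 <= z -> 0 <= 1 - z + z ^+ 2 / 2 - expR (- z).
  by have := H (- x); rewrite opprK sqrrN subr_ge0; apply; rewrite oppr_ge0.
move=> z0.
apply: (@ge0_of_derive (fun y => 1 - y + y ^+ 2 / 2 - expR (- y))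
    (fun y => - 1 + y + expR (- y))) => //.
- by move=> y; apply: is_derive_eq; rewrite /GRing.scale/=; lra.
- by rewrite oppr0 expR0; lra.
- by move=> y _; have := expR_ge1Dx (- y); lra.
Qed.

(** For positive [x] the polynomial [1 + x + x ^ 2 / 2 + x ^ 3 / 2] dominates: its product with
    [expR (- x)] has derivative [expR (- x) * x ^ 2 * (1 - x / 2)]. One factor [x] of the cubic term
    is then bounded by [d]. *)
Lemma expR_le_quadratic d x : 0 <= d <= 1 -> x <= d ->
  expR x <= 1 + x + (1 + d) * (x ^+ 2 / 2).
Proof.
move=> /andP[d0 d1] xd.
have [x0|x0] := leP x 0.
  apply: le_trans (expR_le_quadratic_le0 x0) _.
  by rewrite lerD2l ler_peMl ?divr_ge0 ?sqr_ge0//; lra.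
suff : 0 <= (1 + x + x ^+ 2 / 2 + x ^+ 3 / 2) * expR (- x) - 1.
  rewrite subr_ge0 expRN ler_pdivlMr ?expR_gt0// mul1r => /le_trans; apply.
  have : x ^+ 2 * x <= x ^+ 2 * d by rewrite ler_wpM2l// sqr_ge0.
  by rewrite -exprSr; lra.
apply: (@ge0_of_derive
  (fun y => (1 + y + y ^+ 2 / 2 + y ^+ 3 / 2) * expR (- y) - 1)
  (fun y => expR (- y) * (y ^+ 2 * (1 - y / 2)))) => //; last 2 first.
- exact: ltW.
- move=> y /andP[y0 yx]; rewrite mulr_ge0 ?expR_ge0// mulr_ge0 ?sqr_ge0//; lra.
- by move=> y; apply: is_derive_eq; rewrite /GRing.scale/=; lra.
- by rewrite oppr0 expR0; lra.
Qed.

Lemma sqr_le_expR th : 0 <= th -> th ^+ 2 <= 4 * expR th.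
Proof.
move=> th0; have h : th / 2 <= expR (th / 2).
  by apply: le_trans (expR_ge1Dx _); lra.
have -> : expR th = expR (th / 2) ^+ 2 by rewrite -expRM_natr; congr expR; lra.
have : (th / 2) ^+ 2 <= expR (th / 2) ^+ 2.
  by rewrite ler_sqr ?nnegrE ?expR_ge0//; lra.
lra.
Qed.

Lemma expr4_le_expR th : 0 <= th -> th ^+ 4 <= 8 ^+ 4 * expR (th / 2).
Proof.
move=> th0; have h : th / 8 <= expR (th / 8).
  by apply: le_trans (expR_ge1Dx _); lra.
have -> : expR (th / 2) = expR (th / 8) ^+ 4.
  by rewrite -expRM_natr; congr expR; lra.
have -> : th ^+ 4 = 8 ^+ 4 * (th / 8) ^+ 4 by field.
by rewrite ler_pM2l ?exprn_gt0// lerXn2r ?nnegrE ?expR_ge0//; lra.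
Qed.

(** For [v >= 1 / 2] the factor [16 * v ^ 4] is at least 1. For smaller [v] half of the exponent is
    to spare: [expR (th / 2)] dominates [th ^ 4] up to [8 ^ 4], and [(th * v) ^ 4 >= (e / 2) ^ 4]
    then pays for the factor [v ^ 4]. *)
Lemma expR_le_quartic e th v : 0 < e -> 0 <= v <= 1 -> e / 2 < th * v ->
  expR (th * v) <= (16 + (16 / e) ^+ 4) * (expR th * v ^+ 4).
Proof.
move=> e0 /andP[v0 v1] ev.
have th0 : 0 < th.
  rewrite ltNge; apply/negP => th0.
  have : th * v <= 0 by rewrite mulr_le0_ge0.
  have : 0 < e / 2 by rewrite divr_gt0.
  lra.
have E0 : 0 <= expR th * v ^+ 4 by rewrite mulr_ge0 ?expR_ge0 ?exprn_ge0.
have e4 : 0 <= (16 / e) ^+ 4 by rewrite exprn_ge0// divr_ge0// ltW.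
have [v2|v2] := leP (1 / 2) v.
  apply: (@le_trans _ _ (16 * (expR th * v ^+ 4))); last first.
    by rewrite ler_wpM2r// lerDl.
  have h : 1 <= 16 * v ^+ 4.
    have : (1 / 2) ^+ 4 <= v ^+ 4 by rewrite lerXn2r ?nnegrE//; lra.
    lra.
  apply: (@le_trans _ _ (expR th)).
    by rewrite ler_expR ler_piMr// ltW.
  by rewrite mulrCA ler_peMr ?expR_ge0.
apply: (@le_trans _ _ ((16 / e) ^+ 4 * (expR th * v ^+ 4))); last first.
  by rewrite ler_wpM2r// lerDr.
have h1 : expR (th * v) <= expR (th / 2).
  by rewrite ler_expR ler_wpM2l ?(ltW th0)//; lra.
apply: (le_trans h1).
have -> : expR th = expR (th / 2) * expR (th / 2).
  by rewrite -expRD; congr expR; lra.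
rewrite mulrCA -mulrA ler_peMr ?expR_ge0//.
have h2 := expr4_le_expR (ltW th0).
have h3 : (e / 2) ^+ 4 <= (th * v) ^+ 4.
  by rewrite lerXn2r ?nnegrE ?(ltW ev)// ?divr_ge0 ?(ltW e0)// ltW// (lt_trans _ ev)// divr_gt0.
have h4 : (th * v) ^+ 4 <= 8 ^+ 4 * expR (th / 2) * v ^+ 4.
  by rewrite exprMn ler_wpM2r// exprn_ge0.
have h5 : (16 / e) ^+ 4 * (e / 2) ^+ 4 = 8 ^+ 4 by field; rewrite gt_eqF.
have h6 : 8 ^+ 4 <= (16 / e) ^+ 4 * (8 ^+ 4 * expR (th / 2) * v ^+ 4).
  by rewrite -{1}h5 ler_wpM2l// (le_trans h3).
rewrite -(@ler_pM2l _ (8 ^+ 4)) ?exprn_gt0// mulr1 (le_trans h6)//.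
by rewrite le_eqVlt; apply/orP; left; apply/eqP; ring.
Qed.

(* The exponential of a truncated variable is dominated by trigonometric
   functions, whose means are explicit for a Levy process. *)
Lemma expR_trunc_le e : 0 < e <= 1 -> exists2 C, 0 < C & forall th v, 0 <= th ->
  expR (th * (if `|v| <= 1 then v else 0)) <=
  1 + th * sin v + (1 + e) * (th ^+ 2 * (1 - cos v)) +
  C * (expR th * Num.min 1 (v ^+ 4)).
Proof.
move=> /andP[e0 e1]; exists (16 + (16 / e) ^+ 4 + (e^-1 + 1)).
  by rewrite !addr_gt0// ?invr_gt0// exprn_gt0// divr_gt0.
move=> th v th0.
have Ege1 : 1 <= expR th by rewrite -expR0 ler_expR.
have Q0 : 0 <= (16 / e) ^+ 4 by rewrite exprn_ge0// divr_ge0// ltW.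
have ei0 : 0 <= e^-1 by rewrite invr_ge0 ltW.
have cos0 : 0 <= (1 + e) * (th ^+ 2 * (1 - cos v)).
  by rewrite mulr_ge0 ?mulr_ge0 ?sqr_ge0 ?subr_ge0 ?cos_le1//; lra.
case: ifPn => [v1|]; last first.
  (* The truncated variable is 0 and the left side is 1; only [th * sin v], possibly as low as
     [- th], has to be absorbed by the last term. *)
  rewrite -ltNge => v1; rewrite mulr0 expR0 min_l; last first.
    rewrite -[leRHS]ger0_norm ?exprn_even_ge0// normrX.
    by rewrite exprn_ege1// ltW.
  have h1 : - th <= th * sin v by rewrite -mulrN1 ler_wpM2l// sin_geN1.
  have h2 : th <= expR th by apply: le_trans (expR_ge1Dx _); lra.
  have : expR th <= (16 + (16 / e) ^+ 4 + (e^-1 + 1)) * (expR th * 1).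
    by rewrite mulr1 ler_peMl ?expR_ge0//; lra.
  lra.
have v4 : 0 <= v ^+ 4 by rewrite exprn_even_ge0.
have v41 : v ^+ 4 <= 1.
  by rewrite -[leLHS]ger0_norm// normrX exprn_ile1.
rewrite min_r// mulrDl.
have Ev4 : v ^+ 4 <= expR th * v ^+ 4 by rewrite ler_peMl.
have [p1|p1] := leP (th * v) (e / 2); last first.
  have v0 : 0 <= v.
    rewrite leNgt; apply/negP => v0.
    have : th * v <= 0 by rewrite mulr_ge0_le0// ltW.
    have : 0 < e / 2 by rewrite divr_gt0.
  lra.
  have v01 : 0 <= v <= 1 by rewrite v0 -(ger0_norm v0).
  have := expR_le_quartic e0 v01 p1.
  have s0 : 0 <= th * sin v.
    rewrite mulr_ge0//; apply: le_trans (sin_ge_cubic v0).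
    have : v * v ^+ 2 <= v * 1.
      by rewrite ler_wpM2l// expr_le1//; case/andP: v01.
    by rewrite -exprS mulr1; lra.
  have : 0 <= (e^-1 + 1) * (expR th * v ^+ 4).
    by rewrite mulr_ge0 ?mulr_ge0 ?expR_ge0//; lra.
  lra.
have d01 : 0 <= e / 2 <= 1 by apply/andP; split; lra.
have hq := expR_le_quadratic d01 p1.
have hs : th * v - th * sin v <= `|th * v| * v ^+ 2 / 6.
  rewrite -mulrBr normrM (ger0_norm th0) -!mulrA ler_wpM2l//.
  have := sin_sub_id_le v; rewrite ler_norml => /andP[+ _].
  rewrite exprS real_normK ?num_real//; lra.
(* The cubic error of replacing [v] by [sin v] is split: one part fits in the slack between
   [1 + e / 2] and [1 + e] of the quadratic term, the other is quartic. *)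
have amgm : `|th * v| * v ^+ 2 <= e * (th * v) ^+ 2 / 4 + e^-1 * v ^+ 4.
  rewrite -subr_ge0.
  have -> : e * (th * v) ^+ 2 / 4 + e^-1 * v ^+ 4 - `|th * v| * v ^+ 2 =
    e^-1 * (e * `|th * v| / 2 - v ^+ 2) ^+ 2.
    rewrite -[(th * v) ^+ 2]real_normK ?num_real//.
    by field; rewrite gt_eqF.
  by rewrite mulr_ge0// sqr_ge0.
have hc : th ^+ 2 * (v ^+ 2 / 2 - v ^+ 4 / 24) <= th ^+ 2 * (1 - cos v).
  by rewrite ler_wpM2l ?sqr_ge0//; have := cos_le_quartic v; lra.
have hc' := ler_wpM2l (_ : 0 <= 1 + e) hc.
have {}hc' := hc' (ltac:(lra)).
have ht : th ^+ 2 * v ^+ 4 <= 4 * (expR th * v ^+ 4).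
  by rewrite mulrA ler_wpM2r// sqr_le_expR.
have het : e * (th ^+ 2 * v ^+ 4) <= 1 * (th ^+ 2 * v ^+ 4).
  by rewrite ler_wpM2r// mulr_ge0// sqr_ge0.
have hee : e^-1 * v ^+ 4 <= e^-1 * (expR th * v ^+ 4) by rewrite ler_wpM2l.
have hQ : 0 <= (16 / e) ^+ 4 * (expR th * v ^+ 4).
  by rewrite mulr_ge0// mulr_ge0 ?expR_ge0.
have hE : 0 <= expR th * v ^+ 4 by rewrite mulr_ge0 ?expR_ge0.
have hsq : 0 <= e * (th * v) ^+ 2 by rewrite mulr_ge0 ?sqr_ge0// ltW.
have hev : 0 <= e^-1 * v ^+ 4 by rewrite mulr_ge0.
move: hq hc' hsq amgm het ht hQ hs hev hee Ev4 hE.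
rewrite exprMn.
move: (expR th) ((16 / e) ^+ 4) (`|th * v|) (expR (th * v)) (e^-1) (1 - cos v) (sin v).
clear; intros; lra.
Qed.
End real_inequalities.

(** * Fourth-power truncation as an average of cosines *)

Section trigonometric_averages.
Context {R : realType}.
Implicit Types (f F : R -> R) (v w : R).
Notation mu := (@lebesgue_measure R).

Lemma integral_is_derive01 f F : (forall x, is_derive x (1 : R) F (f x)) ->
  continuous f ->
  (\int[mu]_(x in `[0%R, 1%R]) (f x)%:E = (F 1 - F 0)%:E)%E.
Proof.
move=> dF cf; have cF : continuous F.
  by move=> x; apply: differentiable_continuous; apply/derivable1_diffP; case: (dF x).
rewrite (@continuous_FTC2 _ f F)//.
- exact: continuous_subspaceT.
- split => [x _||]; first by case: (dF x).
  + by apply: cvg_at_right_filter; exact: cF.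
  + by apply: cvg_at_left_filter; exact: cF.
- by move=> x _; rewrite derive1E; case: (dF x).
Qed.

Lemma integral_sqr_1Bcos v : v != 0 ->
  (\int[mu]_(w in `[0%R, 1%R]) ((1 - cos (w * v)) ^+ 2)%:E =
   (3 / 2 - 2 * (sin v / v) + sin (2 * v) / (4 * v))%:E)%E.
Proof.
move=> v0.
pose F (w : R) := 3 / 2 * w - 2 / v * sin (w * v) + (4 * v)^-1 * sin (w * (2 * v)).
rewrite (@integral_is_derive01 (fun w => (1 - cos (w * v)) ^+ 2) F _ _).
- congr EFin; rewrite /F !mul0r !mul1r sin0; by field.
- move=> x; apply: is_derive_eq; rewrite /GRing.scale/= /cst.
  have -> : cos (x * (2 * v)) = 2 * cos (x * v) ^+ 2 - 1.
    have -> : x * (2 * v) = (x * v) *+ 2 by rewrite -mulr_natl; ring.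
    by rewrite cos_mulr2n -mulr_natl.
  by field; rewrite ?v0.
- move=> x; apply: differentiable_continuous; apply/derivable1_diffP.
  by apply: ex_derive; apply: is_derive_eq.
Qed.

Lemma measurable_sqr_1Bcos v :
  measurable_fun `[0%R : R, 1%R] (fun w : R => ((1 - cos (w * v)) ^+ 2 : R)%:E).
Proof.
apply/measurable_EFinP; apply: measurable_funTS.
apply: continuous_measurable_fun => x.
apply: differentiable_continuous; apply/derivable1_diffP.
by apply: ex_derive; apply: is_derive_eq.
Qed.

(** Averaging over the frequency [w] removes the zeros of [1 - cos]. For [|v| < 2] one has
    [1 - cos x >= x ^ 2 / 3] at [x = w * v], and [w ^ 4 / 9] integrates to [1 / 45]; for [|v| >= 2]
    the explicit average is at least [3 / 2 - 1 - 1 / 8]. *)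
Lemma min1_quartic_le_integral v :
  ((Num.min 1 (v ^+ 4))%:E <=
   45%:E * \int[mu]_(w in `[0%R, 1%R]) ((1 - cos (w * v)) ^+ 2)%:E)%E.
Proof.
have [v2|v2] := leP 2 `|v|.
  have v0 : v != 0 by rewrite -normr_gt0 (lt_le_trans _ v2).
  rewrite integral_sqr_1Bcos// -EFinM lee_fin (@le_trans _ _ 1) ?ge_min ?lexx//.
  have nv0 : 0 < `|v| by rewrite normr_gt0.
  have b1 : `|sin v / v| <= 1 / 2.
    rewrite normrM normfV ler_pdivrMr//.
    by apply: le_trans (sin_max _) _; lra.
  have b2 : `|sin (2 * v) / (4 * v)| <= 1 / 8.
    rewrite normrM normfV (normrM 4) normr_nat ler_pdivrMr ?mulr_gt0//.
    by apply: le_trans (sin_max _) _; lra.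
  move: b1 b2; rewrite !ler_norml => /andP[? ?] /andP[? ?]; lra.
apply: (@le_trans _ _ (45%:E * \int[mu]_(w in `[0%R, 1%R]) (w ^+ 4 * (v ^+ 4 / 9))%:E)%E).
  rewrite (@integral_is_derive01 (fun w => w ^+ 4 * (v ^+ 4 / 9)) (fun w => w ^+ 5 / 5 * (v ^+ 4 / 9)) _ _).
  - rewrite -EFinM lee_fin (@le_trans _ _ (v ^+ 4)) ?ge_min ?lexx ?orbT//; lra.
  - by move=> x; apply: is_derive_eq; rewrite /GRing.scale/=; lra.
  - move=> x; apply: differentiable_continuous; apply/derivable1_diffP.
    by apply: ex_derive; apply: is_derive_eq.
have mcos := measurable_sqr_1Bcos v.
rewrite lee_pmul2l//; apply: ge0_le_integral => //.
- by move=> w _; rewrite lee_fin mulr_ge0 ?divr_ge0 ?exprn_even_ge0.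
- apply/measurable_EFinP; apply: measurable_funTS.
  apply: continuous_measurable_fun => x.
  apply: differentiable_continuous; apply/derivable1_diffP.
  by apply: ex_derive; apply: is_derive_eq.
move=> w; rewrite /= in_itv/= => /andP[w0 w1]; rewrite lee_fin.
have wv : (w * v) ^+ 2 <= 4.
  have : `|w * v| ^+ 2 <= 2 ^+ 2.
    rewrite ler_sqr ?nnegrE//.
    rewrite normrM (ger0_norm w0) -(mul1r 2) ler_pM//; exact: ltW.
  by rewrite real_normK ?num_real//; lra.
have h : (w * v) ^+ 2 / 3 <= 1 - cos (w * v).
  have := cos_le_quartic (w * v).
  have : (w * v) ^+ 2 * (w * v) ^+ 2 <= (w * v) ^+ 2 * 4.
    by rewrite ler_wpM2l ?sqr_ge0.
  lra.
have : ((w * v) ^+ 2 / 3) ^+ 2 <= (1 - cos (w * v)) ^+ 2.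
  by rewrite ler_sqr ?nnegrE ?divr_ge0 ?sqr_ge0// subr_ge0 cos_le1.
by rewrite !exprMn; lra.
Qed.
End trigonometric_averages.

Section scalar_estimates.
Context {R : realType}.
Implicit Types (s a b K x : R).

Lemma sin_sub_id_le_sqr x : `|sin x - x| <= x ^+ 2.
Proof.
rewrite -[x ^+ 2]real_normK ?num_real//.
have [x6|x6] := leP `|x| 6.
  apply: le_trans (sin_sub_id_le x) _.
  have : `|x| ^+ 2 * `|x| <= `|x| ^+ 2 * 6 by rewrite ler_wpM2l// exprn_ge0.
  by rewrite -exprSr; lra.
apply: le_trans (ler_normB _ _) _.
have := sin_max x.
have : 6 * `|x| <= `|x| * `|x| by rewrite ler_wpM2r// ltW.
rewrite expr2; lra.
Qed.

Lemma abs_sin_le x : `|sin x| <= `|x|.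
Proof.
have H (z : R) : 0 <= z -> `|sin z| <= z.
  move=> z0; have [z1|z1] := leP z 1; last exact: le_trans (sin_max _) (ltW z1).
  rewrite ler_norml sin_le_id// andbT.
  have := sin_ge_cubic z0.
  have : z * z ^+ 2 <= z * 1 by rewrite ler_wpM2l// expr_le1.
  by rewrite -exprS; lra.
have [x0|x0] := leP 0 x; first by rewrite (ger0_norm x0) H.
by have := H (- x); rewrite sinN normrN (ltr0_norm x0); apply; rewrite oppr_ge0 ltW.
Qed.

(** This and the next two bounds are first-order expansions in [s] of the real and imaginary parts
    of [exp (s (a + i b))], with errors of order [s ^ 2]. *)
Lemma expR_cos_ge s a b : 0 <= s -> a <= 0 ->
  1 + s * a - s ^+ 2 * b ^+ 2 / 2 <= expR (s * a) * cos (s * b).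
Proof.
move=> s0 a0; have sa0 : s * a <= 0 by rewrite mulr_ge0_le0.
have h1 := expR_ge1Dx (s * a).
have h2 := cos_ge_quadratic (s * b); rewrite exprMn in h2.
have h3 : expR (s * a) * (1 - cos (s * b)) <= 1 * (1 - cos (s * b)).
  by rewrite ler_wpM2r ?subr_ge0 ?cos_le1// expR_le1.
lra.
Qed.

Lemma expR_cos_le s a b : 0 <= s -> a <= 0 ->
  expR (s * a) * cos (s * b) <= 1 + s * a + s ^+ 2 * a ^+ 2 / 2.
Proof.
move=> s0 a0; have sa0 : s * a <= 0 by rewrite mulr_ge0_le0.
have := expR_le_quadratic_le0 sa0; rewrite exprMn; apply: le_trans.
by rewrite ler_piMr ?expR_ge0 ?cos_le1.
Qed.

Lemma expR_sin_le s a b : 0 <= s -> a <= 0 ->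
  expR (s * a) * sin (s * b) <= s * b + s ^+ 2 * (b ^+ 2 + `|a| * `|b|).
Proof.
move=> s0 a0; have sa0 : s * a <= 0 by rewrite mulr_ge0_le0.
have h1 := expR_ge1Dx (s * a).
have h2 := sin_sub_id_le_sqr (s * b); rewrite exprMn ler_norml in h2.
have h3 : (expR (s * a) - 1) * sin (s * b) <= (- (s * a)) * `|s * b|.
  apply: le_trans (ler_norm _) _; rewrite normrM ler_pM// ?abs_sin_le//.
  rewrite ler0_norm ?subr_le0 ?expR_le1//; lra.
have h4 : (- (s * a)) * `|s * b| = s ^+ 2 * (`|a| * `|b|).
  by rewrite normrM (ger0_norm s0) (ler0_norm a0); ring.
case/andP: h2; lra.
Qed.
End scalar_estimates.

Section bounded_expectation.
Context {R : realType} {d0 : measure_display} {T : measurableType d0}.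
Variable P : probability T R.
Implicit Types (f g Z : T -> R).

Lemma bounded_integrable f M : measurable_fun setT f ->
  (forall w, `|f w| <= M) -> P.-integrable setT (EFin \o f).
Proof.
move=> mf fM; apply: measurable_bounded_integrable => //.
  by apply: (le_lt_trans (probability_le1 P measurableT)); rewrite ltry.
by exists M; split; rewrite ?num_real// => x Mx y _ /=; rewrite (le_trans (fM _))// ltW.
Qed.

Lemma Rintegral_cst_prob (r : R) : \int[P]_w r = r.
Proof.
rewrite Rintegral_cst//; change (r * fine (P setT) = r).
by rewrite probability_setT mulr1.
Qed.
End bounded_expectation.

(** * Moments of one increment of duration [s] *)

Section small_increment.
Context {R : realType} {d0 : measure_display} {T : measurableType d0}.
Variables (P : probability T R) (Z : T -> R) (s : R) (A B : R -> R).
Hypothesis (mZ : measurable_fun setT Z) (s0 : 0 <= s).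
Hypothesis A0 : forall u, A u <= 0.
Hypothesis Ecos : forall u,
  (\int[P]_w (cos (u * Z w))%:E = (expR (s * A u) * cos (s * B u))%:E)%E.
Hypothesis Esin : forall u,
  (\int[P]_w (sin (u * Z w))%:E = (expR (s * A u) * sin (s * B u))%:E)%E.
Variables (a K q : R).
Hypothesis a0 : 0 < a.
Hypothesis AK : forall u, 0 <= u <= 2 / a -> `|A u| <= K.
Hypothesis BK : forall u, 0 <= u <= 2 / a -> `|B u| <= K.
(* [A (2 u) / 2 - 2 * A u] is the integral of [(1 - cos (u y)) ^+ 2] for the
   jump measure. *)
Hypothesis Aq : forall u, 0 <= u <= 1 / a -> A (2 * u) / 2 - 2 * A u <= 4 * q.

Let mcos u : measurable_fun setT (fun w => cos (u * Z w)).
Proof.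
apply: measurableT_comp.
  by apply: continuous_measurable_fun; exact: continuous_cos.
by apply: measurable_funM => //; exact: measurable_cst.
Qed.

Let msin u : measurable_fun setT (fun w => sin (u * Z w)).
Proof.
apply: measurableT_comp.
  by apply: continuous_measurable_fun; exact: continuous_sin.
by apply: measurable_funM => //; exact: measurable_cst.
Qed.

Let icos u : P.-integrable setT (EFin \o (fun w => cos (u * Z w))).
Proof. by apply: (@bounded_integrable _ _ _ _ _ 1) => // w; exact: cos_max. Qed.

Let isin u : P.-integrable setT (EFin \o (fun w => sin (u * Z w))).
Proof. by apply: (@bounded_integrable _ _ _ _ _ 1) => // w; exact: sin_max. Qed.

Let REcos u : \int[P]_w cos (u * Z w) = expR (s * A u) * cos (s * B u).
Proof. by rewrite /Rintegral Ecos. Qed.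

Let i1 (r : R) : P.-integrable setT (EFin \o (fun=> r)).
Proof. by apply: (@bounded_integrable _ _ _ _ _ `|r|). Qed.

(** Since [(1 - cos x) ^ 2 = 3 / 2 - 2 cos x + cos (2 x) / 2], the constant terms of the expansion
    cancel, and the coefficient of [s] is the quantity bounded in [Aq]. *)
Lemma mean_sqr_1Bcos_le u : 0 <= u <= 1 / a ->
  (\int[P]_w ((1 - cos (u * Z w)) ^+ 2)%:E <= (4 * s * q + s ^+ 2 * K ^+ 2 * 2)%:E)%E.
Proof.
move=> /andP[u0 u1].
have u01 : 0 <= u <= 2 / a.
  rewrite u0 (le_trans u1)// ler_wpM2r ?invr_ge0 ?(ltW a0)//; lra.
have u02 : 0 <= 2 * u <= 2 / a.
  by rewrite mulr_ge0//= ler_pM2l// -div1r.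
have -> : (fun w => ((1 - cos (u * Z w)) ^+ 2)%:E) =
    (fun w => (3 / 2 - 2 * cos (u * Z w) + 1 / 2 * cos ((2 * u) * Z w))%:E).
  apply/funext => w; congr EFin.
  have -> : 2 * u * Z w = (u * Z w) *+ 2 by rewrite -mulr_natl; ring.
  by rewrite cos_mulr2n -mulr_natl; lra.
have ic1 : P.-integrable setT (EFin \o (fun w => 2 * cos (u * Z w))).
  apply: (@bounded_integrable _ _ _ _ _ 2) => [|w].
    by apply: measurable_funM => //; exact: measurable_cst.
  by rewrite normrM ger0_norm// ler_piMr// cos_max.
have ic2 : P.-integrable setT (EFin \o (fun w => 1 / 2 * cos ((2 * u) * Z w))).
  apply: (@bounded_integrable _ _ _ _ _ 2) => [|w].
    by apply: measurable_funM => //; exact: measurable_cst.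
  by rewrite normrM ger0_norm//; have := cos_max (2 * u * Z w); lra.
have ic3 : P.-integrable setT (EFin \o (fun w => 3 / 2 - 2 * cos (u * Z w))).
  by apply: eq_integrable (integrableB measurableT (i1 (3 / 2)) ic1).
have ic4 : P.-integrable setT (EFin \o
    (fun w => 3 / 2 - 2 * cos (u * Z w) + 1 / 2 * cos ((2 * u) * Z w))).
  by apply: eq_integrable (integrableD measurableT ic3 ic2).
rewrite -(fineK (integrable_fin_num _ ic4))// lee_fin.
rewrite -[leLHS]/(\int[P]_w (3 / 2 - 2 * cos (u * Z w) + 1 / 2 * cos ((2 * u) * Z w))).
rewrite RintegralD// RintegralB// !RintegralZl// !REcos Rintegral_cst_prob.
have h1 := expR_cos_ge (B u) s0 (A0 u).
have h2 := expR_cos_le (B (2 * u)) s0 (A0 (2 * u)).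
have h3 := Aq (u := u); rewrite u0 u1 in h3; have {}h3 := h3 isT.
have h4 : s * (A (2 * u) / 2 - 2 * A u) <= s * (4 * q) by rewrite ler_wpM2l.
have K0 : 0 <= K by exact: le_trans (AK u02).
have hA : s ^+ 2 * A (2 * u) ^+ 2 <= s ^+ 2 * K ^+ 2.
  rewrite ler_wpM2l ?sqr_ge0// -[leLHS]real_normK ?num_real//.
  by rewrite lerXn2r ?nnegrE// AK.
have hB : s ^+ 2 * B u ^+ 2 <= s ^+ 2 * K ^+ 2.
  rewrite ler_wpM2l ?sqr_ge0// -[leLHS]real_normK ?num_real//.
  by rewrite lerXn2r ?nnegrE// BK.
have hK : 0 <= s ^+ 2 * K ^+ 2 by rewrite mulr_ge0 ?sqr_ge0.
lra.
Qed.

(** Tonelli exchanges the mean with the average over frequencies; both coefficients are 45 times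
    those of the preceding bound, the frequencies being rescaled by [1 / a]. *)
Lemma mean_min1_quartic_le :
  (\int[P]_w (Num.min 1 ((Z w / a) ^+ 4))%:E <=
   (180 * s * q + 90 * s ^+ 2 * K ^+ 2)%:E)%E.
Proof.
pose mu := (@lebesgue_measure R).
pose D : set R := `[0%R, 1%R]%classic.
pose f (x : T * R) : \bar R := ((1 - cos (x.2 * (Z x.1 / a))) ^+ 2 * \1_D x.2)%:E.
have mZa : measurable_fun setT (fun w => Z w / a).
  by apply: measurable_funM => //; exact: measurable_cst.
have mf : measurable_fun setT f.
  apply/measurable_EFinP; apply: measurable_funM.
    apply: measurable_funX; apply: measurable_funB; first exact: measurable_cst.
    apply: measurableT_comp.
      by apply: continuous_measurable_fun; exact: continuous_cos.
    apply: measurable_funM; first exact: measurable_snd.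
    by apply: (measurableT_comp mZa); exact: measurable_fst.
  apply: (@measurableT_comp _ _ _ _ _ _ (\1_D : R -> R)); last exact: measurable_snd.
  by apply: measurable_indic; exact: measurable_itv.
have f0 x : (0 <= f x)%E by rewrite lee_fin mulr_ge0 ?sqr_ge0.
have fint w : (\int[mu]_(v in D) ((1 - cos (v * (Z w / a))) ^+ 2)%:E =
    \int[mu]_v f (w, v))%E.
  rewrite integral_mkcond; apply: eq_integral => v _.
  rewrite /f /= patchE indicE; case: ifPn => _; first by rewrite mulr1.
  by rewrite mulr0.
apply: (@le_trans _ _ (\int[P]_w (45%:E * \int[mu]_v f (w, v)))%E).
  apply: ge0_le_integral => //.
  - by move=> w _; rewrite lee_fin le_min ler01/= exprn_even_ge0.
  - apply/measurable_EFinP; apply: measurable_minr; first exact: measurable_cst.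
    exact: measurable_funX.
  - apply: measurable_funeM.
    exact: (@measurable_fun_fubini_tonelli_F _ _ _ _ _ mu f).
  - by move=> w _; rewrite -fint; exact: min1_quartic_le_integral.
rewrite ge0_integralZl//; last 2 first.
- exact: (@measurable_fun_fubini_tonelli_F _ _ _ _ _ mu f).
- by move=> w _; exact: integral_ge0.
rewrite (fubini_tonelli (m1 := P) (m2 := mu) f)//.
have -> : 180 * s * q + 90 * s ^+ 2 * K ^+ 2 = 45 * (4 * s * q + s ^+ 2 * K ^+ 2 * 2).
  by ring.
rewrite EFinM lee_pmul2l//.
apply: (@le_trans _ _ (\int[mu]_(v in D) (4 * s * q + s ^+ 2 * K ^+ 2 * 2)%:E)%E).
  rewrite [leRHS]integral_mkcond.
  apply: ge0_le_integral => //.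
  - by move=> v _; exact: integral_ge0.
  - exact: (@measurable_fun_fubini_tonelli_G _ _ _ _ _ P f).
  - apply/(measurable_restrictT _ _).1; first exact: measurable_itv.
    exact: measurable_cst.
  - move=> v _; rewrite patchE; case: ifPn => [|vD].
      rewrite inE /D/= in_itv/= => /andP[v0 v1].
      have va : 0 <= v / a <= 1 / a.
        by rewrite divr_ge0 ?(ltW a0)//= ler_wpM2r// invr_ge0 ltW.
      apply: le_trans (mean_sqr_1Bcos_le va).
      rewrite le_eqVlt; apply/orP; left; apply/eqP; apply: eq_integral => w _.
      have D1 : \1_D v = 1 :> R.
        by rewrite indicE mem_set// /D /= in_itv/= v0.
      rewrite /f/= D1 mulr1; congr (((1 - cos _) ^+ 2)%:E); ring.
    rewrite integral0_eq// => w _.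
    by rewrite /f/= indicE (negbTE vD) mulr0.
rewrite integral_cst; last exact: measurable_itv.
have muD : mu D = 1%E.
  by rewrite /D /mu lebesgue_measure_itv/= lte_fin ltr01 oppr0 adde0.
change ((4 * s * q + s ^+ 2 * K ^+ 2 * 2)%:E * mu D <=
  (4 * s * q + s ^+ 2 * K ^+ 2 * 2)%:E)%E.
by rewrite muD mule1.
Qed.

(** The coefficient of [s] is what survives when the bounds of [n] increments are multiplied; the
    part in [s ^ 2] vanishes in the limit, so the crude constant [K] is good enough there. *)
Lemma mean_expR_trunc_le e C th : 0 <= e -> 0 <= C -> 0 <= th ->
  (forall v, expR (th * (if `|v| <= 1 then v else 0)) <=
    1 + th * sin v + (1 + e) * (th ^+ 2 * (1 - cos v)) +
    C * (expR th * Num.min 1 (v ^+ 4))) ->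
  (\int[P]_w (expR (th * (if `|Z w / a| <= 1 then Z w / a else 0)))%:E <=
   (1 + s * (th * B (1 / a) - (1 + e) * th ^+ 2 * A (1 / a) +
             180 * C * expR th * q) +
    s ^+ 2 * (2 * th * K ^+ 2 + (1 + e) * th ^+ 2 * K ^+ 2 +
              90 * C * expR th * K ^+ 2))%:E)%E.
Proof.
move=> e0 C0 th0 Hdom.
have a1 : 0 <= 1 / a <= 2 / a.
  by rewrite divr_ge0 ?(ltW a0)//= ler_wpM2r ?invr_ge0 ?(ltW a0)//; lra.
pose g w := th * sin (1 / a * Z w) + (1 + e) * th ^+ 2 * (1 - cos (1 / a * Z w)).
have mg : measurable_fun setT g.
  apply: measurable_funD.
    by apply: measurable_funM => //; exact: measurable_cst.
  apply: measurable_funM; first exact: measurable_cst.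
  by apply: measurable_funB => //; exact: measurable_cst.
have mZa : measurable_fun setT (fun w => Z w / a).
  by apply: measurable_funM => //; exact: measurable_cst.
pose m w := Num.min 1 ((Z w / a) ^+ 4).
have mm : measurable_fun setT m.
  apply: measurable_minr; first exact: measurable_cst.
  apply: measurable_funX; apply: measurable_funM => //; exact: measurable_cst.
have m01 w : 0 <= m w <= 1.
  by rewrite le_min ler01/= exprn_even_ge0//= ge_min lexx.
have is1 : P.-integrable setT (EFin \o (fun w => th * sin (1 / a * Z w))).
  apply: (@bounded_integrable _ _ _ _ _ th) => [|w].
    by apply: measurable_funM => //; exact: measurable_cst.
  by rewrite normrM ger0_norm// ler_piMr// sin_max.
have ic0 : P.-integrable setT (EFin \o (fun w => 1 - cos (1 / a * Z w))).
  by apply: eq_integrable (integrableB measurableT (i1 1) (icos (1 / a))).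
have ic1 : P.-integrable setT
    (EFin \o (fun w => (1 + e) * th ^+ 2 * (1 - cos (1 / a * Z w)))).
  apply: (@bounded_integrable _ _ _ _ _ ((1 + e) * th ^+ 2 * 2)) => [|w].
    apply: measurable_funM; first exact: measurable_cst.
    by apply: measurable_funB => //; exact: measurable_cst.
  have c0 : 0 <= (1 + e) * th ^+ 2 by rewrite mulr_ge0 ?sqr_ge0//; lra.
  rewrite normrM ger0_norm// ler_wpM2l//.
  have := cos_max (1 / a * Z w); rewrite ler_norml => /andP[? ?].
  rewrite ger0_norm; lra.
have im : P.-integrable setT (EFin \o (fun w => (C * expR th) * m w)).
  apply: (@bounded_integrable _ _ _ _ _ (C * expR th)) => [|w].
    by apply: measurable_funM => //; exact: measurable_cst.
  have c0 : 0 <= C * expR th by rewrite mulr_ge0 ?expR_ge0.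
  case/andP: (m01 w) => m0 m1.
  by rewrite ger0_norm ?mulr_ge0// ler_piMr.
have im0 : P.-integrable setT (EFin \o m).
  apply: (@bounded_integrable _ _ _ _ _ 1) => // w.
  by case/andP: (m01 w) => m0 m1; rewrite ger0_norm.
have ig : P.-integrable setT (EFin \o g).
  by apply: eq_integrable (integrableD measurableT is1 ic1).
have ig1 : P.-integrable setT (EFin \o (fun w => 1 + g w)).
  by apply: eq_integrable (integrableD measurableT (i1 1) ig).
have itot : P.-integrable setT (EFin \o (fun w => 1 + g w + (C * expR th) * m w)).
  by apply: eq_integrable (integrableD measurableT ig1 im).
apply: (@le_trans _ _ (\int[P]_w (1 + g w + (C * expR th) * m w)%:E)%E).
  apply: ge0_le_integral => //.
  - apply/measurable_EFinP; apply: measurableT_comp => //.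
    apply: measurable_funM; first exact: measurable_cst.
    apply: measurable_fun_ifT.
    + apply: measurable_fun_ler; last exact: measurable_cst.
      exact: measurableT_comp.
    + exact: mZa.
    + exact: measurable_cst.
  - by have /integrableP[] := itot.
  - move=> w _; rewrite lee_fin; apply: le_trans (Hdom (Z w / a)) _.
    rewrite /g /m le_eqVlt; apply/orP; left; apply/eqP.
    by rewrite (_ : 1 / a * Z w = Z w / a); ring.
rewrite -(fineK (integrable_fin_num _ itot))// lee_fin.
rewrite -[leLHS]/(\int[P]_w (1 + g w + (C * expR th) * m w)).
rewrite RintegralD// RintegralD// Rintegral_cst_prob RintegralZl//.
rewrite RintegralD// RintegralZl// RintegralZl//.
rewrite RintegralB// Rintegral_cst_prob REcos.
rewrite {1}/Rintegral Esin/=.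
have hm : \int[P]_w m w <= 180 * s * q + 90 * s ^+ 2 * K ^+ 2.
  have := mean_min1_quartic_le; rewrite -lee_fin /Rintegral fineK//.
  exact: (integrable_fin_num _ im0).
have hC : 0 <= C * expR th by rewrite mulr_ge0 ?expR_ge0.
have {}hm := ler_wpM2l hC hm.
have K0 : 0 <= K by exact: le_trans (AK a1).
have hs := expR_sin_le (B (1 / a)) s0 (A0 (1 / a)).
have hc := expR_cos_ge (B (1 / a)) s0 (A0 (1 / a)).
have hB2 : B (1 / a) ^+ 2 <= K ^+ 2.
  by rewrite -[leLHS]real_normK ?num_real// lerXn2r ?nnegrE// BK.
have hAB : `|A (1 / a)| * `|B (1 / a)| <= K ^+ 2.
  by rewrite expr2 ler_pM// ?AK ?BK.
have hs2 : th * (expR (s * A (1 / a)) * sin (s * B (1 / a))) <=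
    th * (s * B (1 / a) + s ^+ 2 * (2 * K ^+ 2)).
  rewrite ler_wpM2l//; apply: le_trans hs _.
  by rewrite lerD2l ler_wpM2l ?sqr_ge0//; lra.
have he : 0 <= (1 + e) * th ^+ 2 by rewrite mulr_ge0 ?sqr_ge0//; lra.
have hc2 : (1 + e) * th ^+ 2 * (1 - expR (s * A (1 / a)) * cos (s * B (1 / a))) <=
    (1 + e) * th ^+ 2 * (- (s * A (1 / a)) + s ^+ 2 * K ^+ 2).
  rewrite ler_wpM2l//.
  have : s ^+ 2 * B (1 / a) ^+ 2 <= s ^+ 2 * K ^+ 2 by rewrite ler_wpM2l ?sqr_ge0.
  have : 0 <= s ^+ 2 * K ^+ 2 by rewrite mulr_ge0 ?sqr_ge0.
  lra.
move: hm hs2 hc2.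
move: (\int[P]_w m w) (expR (s * A (1 / a))) (cos _) (sin _) (expR th) => x1 x2 x3 x4 x5.
move: (A _) (B _) => x6 x7.
by move=> *; lra.
Qed.

End small_increment.

(** * Independent increments *)

Section independence.
Context {R : realType} {d0 : measure_display} {T : measurableType d0}.
Variable P : probability T R.
Local Open Scope ereal_scope.

Lemma measurable_tuple_of n (D : 'I_n -> T -> R) :
  (forall i, measurable_fun setT (D i)) ->
  measurable_fun setT (fun w => [tuple D i w | i < n]).
Proof.
move=> mD; apply/measurable_fun_tnthP => i.
by rewrite (_ : _ \o _ = D i)//; apply/funext => w /=; rewrite tnth_mktuple.
Qed.

Let rects n : set (set (n.-tuple R)) :=
  [set C | exists2 B : 'I_n -> set R, (forall i, measurable (B i)) &
           C = [set x | forall i, B i (tnth x i)]].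

Let measurable_rects n :
  @measurable _ (n.-tuple R) = <<s @rects n >>.
Proof.
apply/seteqP; split.
- apply: smallest_sub; first exact: smallest_sigma_algebra.
  case: n => [|n]; first by rewrite big_ord0.
  rewrite -bigcup_mkord_ord => C [i /= ilt [A mA <-]].
  apply: sub_sigma_algebra; exists (fun j => if j == inord i then A else setT).
    by move=> j; case: ifP.
  apply/seteqP; split => [x [_ Ax] j|x]/=.
    by case: ifPn => // /eqP ->.
  by move=> /(_ (inord i)); rewrite eqxx; split.
- apply: smallest_sub; first exact: sigma_algebra_measurable.
  move=> C [B mB ->].
  rewrite (_ : mkset _ = \bigcap_(i in [set: 'I_n]) ((fun x => tnth x i) @^-1` B i)).
    apply: fin_bigcap_measurable => // i _.
    by rewrite -[X in measurable X]setTI; exact: measurable_tnth.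
  by apply/seteqP; split => x /= H; [move=> i _; exact: H|move=> i; exact: H].
Qed.

(** Dynkin's pi-lambda argument in [C], with [E] fixed: the boxes are stable under intersection and
    generate the product sigma-algebra. *)
Lemma indep_tuple n (D : 'I_n -> T -> R) (E : set T) :
  (forall i, measurable_fun setT (D i)) -> measurable E ->
  (forall B : 'I_n -> set R, (forall i, measurable (B i)) ->
    P ([set w | forall i, B i (D i w)] `&` E) =
    P [set w | forall i, B i (D i w)] * P E) ->
  forall C : set (n.-tuple R), measurable C ->
    P ([set w | C [tuple D i w | i < n]] `&` E) =
    P [set w | C [tuple D i w | i < n]] * P E.
Proof.
move=> mD mE H.
have mU := measurable_tuple_of mD.
have mUC C : measurable C -> measurable [set w | C [tuple D i w | i < n]].
  by move=> mC; rewrite -[X in measurable X]setTI; exact: mU.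
pose Q C := P ([set w | C [tuple D i w | i < n]] `&` E) =
    P [set w | C [tuple D i w | i < n]] * P E.
have PE : P E \is a fin_num by exact: fin_num_measure.
suff HQ : forall C, <<s @rects n >> C -> Q C by move=> C; rewrite measurable_rects; exact: HQ.
apply: (@dynkin_induction _ _ (@rects n) Q).
- exact: measurable_rects.
- move=> _ _ [B1 mB1 ->] [B2 mB2 ->]; exists (fun i => B1 i `&` B2 i).
    by move=> i; exact: measurableI.
  apply/seteqP; split => [x [H1 H2] i|x H1]; first by split; [exact: H1|exact: H2].
  by split => i; case: (H1 i).
- rewrite /Q (_ : [set w | _] = setT); last by apply/seteqP; split.
  by rewrite setTI probability_setT mul1e.
- move=> _ [B mB ->]; rewrite /Q.
  rewrite (_ : [set w | _] = [set w | forall i, B i (D i w)]) ?H//.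
  by apply/seteqP; split => w /= Hw i; have := Hw i; rewrite tnth_mktuple.
- move=> C mC; rewrite /Q => QC.
  have -> : [set w | (~` C) [tuple D i w | i < n]] =
     ~` [set w | C [tuple D i w | i < n]] by [].
  have mV := mUC _ mC.
  transitivity (P E - P ([set w | C [tuple D i w | i < n]] `&` E)).
    rewrite setIC -setDE measureD//; last by rewrite -ge0_fin_numE.
    by rewrite (setIC E).
  rewrite QC probability_setC//.
  by rewrite muleBl// ?mul1e// fin_num_adde_defr// fin_num_measure.
- move=> F mF tF QF; rewrite /Q.
  have -> : [set w | (\bigcup_k F k) [tuple D i w | i < n]] =
     \bigcup_k [set w | F k [tuple D i w | i < n]].
    by apply/seteqP; split.
  have tG : trivIset setT (fun k => [set w | F k [tuple D i w | i < n]]).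
    move=> i j _ _ [w [/= wi wj]]; apply: tF => //.
    by exists [tuple D i w | i < n]; split.
  rewrite setI_bigcupl !measure_bigcup//; last 3 first.
  + by move=> k _; exact: mUC.
  + by move=> k _; apply: measurableI => //; exact: mUC.
  + move=> i j _ _ [w [/= [wi _] [wj _]]]; apply: tG => //.
    by exists w; split.
  rewrite muleC -(fineK PE) -nneseriesZl//; apply: eq_eseriesr => k _.
  by rewrite fineK// muleC; exact: QF.
Qed.

(** The joint law of [U] and [V] agrees with the product of the marginal laws on rectangles, hence
    everywhere; Tonelli does the rest. *)
Lemma indep_integral d1 d2 (S1 : measurableType d1) (S2 : measurableType d2)
  (U : T -> S1) (V : T -> S2) (f : S1 -> \bar R) (g : S2 -> \bar R) :
  measurable_fun setT U -> measurable_fun setT V ->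
  (forall C B, measurable C -> measurable B ->
    P ((U @^-1` C) `&` (V @^-1` B)) = P (U @^-1` C) * P (V @^-1` B)) ->
  measurable_fun setT f -> measurable_fun setT g ->
  (forall x, 0 <= f x) -> (forall x, 0 <= g x) ->
  \int[P]_w (f (U w) * g (V w)) = \int[P]_w f (U w) * \int[P]_w g (V w).
Proof.
move=> mU mV UV mf mg f0 g0.
pose mU' := isMeasurableFun.Build _ _ _ _ _ mU.
pose U' : {mfun T >-> S1} := HB.pack U mU'.
pose mV' := isMeasurableFun.Build _ _ _ _ _ mV.
pose V' : {mfun T >-> S2} := HB.pack V mV'.
have mUV : measurable_fun setT (fun w => (U w, V w)) by exact: measurable_fun_pair.
pose mUV' := isMeasurableFun.Build _ _ _ _ _ mUV.
pose UV' : {mfun T >-> (S1 * S2)%type} := HB.pack (fun w => (U w, V w)) mUV'.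
pose m1 := distribution P U'.
pose m2 := distribution P V'.
pose m12 := distribution P UV'.
pose F (x : (S1 * S2)%type) := f x.1 * g x.2.
have mF : measurable_fun setT F.
  apply: emeasurable_funM.
    by apply: measurableT_comp => //; exact: measurable_fst.
  by apply: measurableT_comp => //; exact: measurable_snd.
have F0 x : 0 <= F x by rewrite mule_ge0.
transitivity (\int[m12]_x F x).
  by rewrite (@ge0_integral_pushforward _ _ _ _ _ (fun w => (U w, V w)) mUV)//.
transitivity (\int[m1 \x m2]_x F x).
  apply: eq_measure_integral => A mA _; apply/esym.
  apply: product_measure_unique => //.
rewrite fubini_tonelli1//.
transitivity (\int[m1]_x (f x * \int[m2]_y g y)).
  by apply: eq_integral => x _; rewrite /fubini_F /F/= ge0_integralZl.
rewrite ge0_integralZr//; last exact: integral_ge0.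
congr (_ * _).
  by rewrite (@ge0_integral_pushforward _ _ _ _ _ U mU).
by rewrite (@ge0_integral_pushforward _ _ _ _ _ V mV).
Qed.

(* Taking some of the [B i] to be [setT] gives the product rule for every
   subfamily. *)
Definition indep_seq (D : nat -> T -> R) (n : nat) : Prop :=
  forall B : nat -> set R, (forall i, measurable (B i)) ->
  P [set w | forall i, (i < n)%N -> B i (D i w)] =
  \prod_(i < n) P (D i @^-1` B i).

Lemma indep_seqW D n : indep_seq D n.+1 -> indep_seq D n.
Proof.
move=> H B mB.
have := H (fun i => if (i < n)%N then B i else setT) _.
rewrite big_ord_recr/= ltnn preimage_setT probability_setT mule1.
rewrite (eq_bigr (fun i : 'I_n => P (D i @^-1` B i))); last first.
  by move=> i _; rewrite ltn_ord.
move=> <-; last by move=> i; case: ifP.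
congr (P _); apply/seteqP; split => w /= Hw i.
  by move=> _; case: ifPn => // /Hw.
by move=> lt_in; have := Hw i; rewrite lt_in; apply; exact: leqW.
Qed.

Lemma indep_seq_tuple D n : indep_seq D n.+1 ->
  (forall i, measurable_fun setT (D i)) ->
  forall (C : set (n.-tuple R)) (B : set R), measurable C -> measurable B ->
    P ([set w | C [tuple D i w | i < n]] `&` (D n @^-1` B)) =
    P [set w | C [tuple D i w | i < n]] * P (D n @^-1` B).
Proof.
move=> H mD C B mC mB; apply: (indep_tuple (D := fun i : 'I_n => D i)) => //.
  by rewrite -[X in measurable X]setTI; exact: mD.
move=> A mA.
(* [indep_seq] is indexed by [nat], so the family over ['I_n] is padded with [setT]; index [n] is
   then given to [B]. *)
pose A' i := if insub i is Some j then A j else setT.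
have mA' i : measurable (A' i) by rewrite /A'; case: insubP.
have A'E (i : 'I_n) : A' i = A i by rewrite /A' valK.
have := H (fun i => if (i < n)%N then A' i else B) _.
have mA'' i : measurable (if (i < n)%N then A' i else B) by case: ifP.
move=> /(_ mA''); rewrite big_ord_recr/= ltnn.
rewrite (eq_bigr (fun i : 'I_n => P (D i @^-1` A' i))); last first.
  by move=> i _; rewrite ltn_ord.
rewrite -(indep_seqW H mA').
have -> : [set w | forall i, (i < n)%N -> A' i (D i w)] =
    [set w | forall i : 'I_n, A i (D i w)].
  apply/seteqP; split => w /= Hw i; first by rewrite -A'E; exact: Hw.
  by move=> lt_in; rewrite -[i]/(val (Ordinal lt_in)) A'E; exact: Hw.
move=> <-; congr (P _); apply/seteqP; split => w /=.
  move=> [Hw Bw] i; rewrite ltnS leq_eqVlt => /predU1P[->|lt_in].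
    by rewrite ltnn.
  by rewrite lt_in -[i]/(val (Ordinal lt_in)) A'E; exact: Hw.
move=> Hw; split => [i|].
  by have := Hw i; rewrite ltn_ord A'E; apply; exact: leqW.
by have := Hw n; rewrite ltnn; apply.
Qed.

Lemma indep_seq_integral_prod (D : nat -> T -> R) (f : nat -> R -> R) n :
  (forall i, measurable_fun setT (D i)) ->
  indep_seq D n ->
  (forall i, measurable_fun setT (f i)) -> (forall i x, (0 <= f i x)%R) ->
  \int[P]_w (\prod_(i < n) f i (D i w))%:E = \prod_(i < n) \int[P]_w (f i (D i w))%:E.
Proof.
move=> mD + mf f0; elim: n => [_|n IH Hn].
  under eq_integral do rewrite big_ord0.
  by rewrite big_ord0 integral_cst// mul1e; exact: probability_setT.
under eq_integral do rewrite big_ord_recr/= EFinM.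
rewrite big_ord_recr/= -IH; last exact: indep_seqW.
pose U w := [tuple D i w | i < n].
pose F (x : n.-tuple R) := (\prod_(i < n) f i (tnth x i))%:E.
have FU w : (\prod_(i < n) f i (D i w))%:E = F (U w).
  by congr EFin; apply: eq_bigr => i _; rewrite tnth_mktuple.
under eq_integral do rewrite FU.
under [in RHS]eq_integral do rewrite FU.
apply: (@indep_integral _ _ _ _ U (D n) F (EFin \o f n)) => //.
- exact: measurable_tuple_of.
- by move=> C B mC mB; exact: indep_seq_tuple.
- apply/measurable_EFinP; apply: measurable_prod => i _ /=.
  by apply: measurableT_comp => //; exact: measurable_tnth.
- by apply/measurable_EFinP.
- by move=> x; rewrite lee_fin prodr_ge0.
- by move=> x; rewrite lee_fin.
Qed.

End independence.

(** * Exponential tail bound for a real-valued process *)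

Section real_levy.
Context {R : realType} {d0 : measure_display} {T : measurableType d0}.
Variable P : probability T R.

Lemma eq_law_integral (X1 X2 : T -> R) (f : R -> \bar R) :
  measurable_fun setT X1 -> measurable_fun setT X2 ->
  (forall B, measurable B -> P (X1 @^-1` B) = P (X2 @^-1` B)) ->
  measurable_fun setT f -> (forall x, (0 <= f x)%E) ->
  (\int[P]_w f (X1 w) = \int[P]_w f (X2 w))%E.
Proof.
move=> mX1 mX2 X12 mf f0.
pose m1' := isMeasurableFun.Build _ _ _ _ _ mX1.
pose U1 : {mfun T >-> R} := HB.pack X1 m1'.
pose m2' := isMeasurableFun.Build _ _ _ _ _ mX2.
pose U2 : {mfun T >-> R} := HB.pack X2 m2'.
transitivity (\int[distribution P U1]_x f x)%E.
  by rewrite (@ge0_integral_pushforward _ _ _ _ _ X1 mX1).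
transitivity (\int[distribution P U2]_x f x)%E.
  apply: eq_measure_integral => A mA _; exact: X12.
by rewrite (@ge0_integral_pushforward _ _ _ _ _ X2 mX2).
Qed.

Lemma markov_prob (W : T -> R) (c : R) : measurable_fun setT W ->
  (forall w, 0 <= W w) -> 0 < c ->
  (P [set w | c <= W w]%R <= c^-1%:E * \int[P]_w (W w)%:E)%E.
Proof.
move=> mW W0 c0.
set E := [set w | c <= W w]%R.
have mE : measurable E.
  have := measurable_fun_ler (@measurable_cst _ _ T R setT c) mW.
  by move=> /(_ measurableT [set true] I); rewrite setTI.
have ci0 : (0 <= c^-1%:E)%E by rewrite lee_fin invr_ge0 ltW.
rewrite -ge0_integralZl//; last 2 first.
- exact/measurable_EFinP.
- by move=> w _; rewrite lee_fin.
rewrite -(setIT E) -integral_indic//.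
apply: ge0_le_integral => //.
- by apply/measurable_EFinP; apply: measurable_indic.
- by apply: measurable_funeM; exact/measurable_EFinP.
- move=> w _; rewrite -EFinM lee_fin indicE.
  have [wE|wE] := boolP (w \in E).
    by rewrite ler_pdivlMl// mulr1; move: wE; rewrite inE.
  by rewrite mulr_ge0// invr_ge0 ltW.
Qed.

(* [A + i B] is the characteristic exponent. *)
Record real_levy (Y : R -> T -> R) (A B : R -> R) : Prop := RealLevy {
  rl_meas : forall t, 0 <= t -> measurable_fun setT (Y t);
  rl_zero : {ae P, forall w, Y 0 w = 0};
  rl_indep : forall n (tau : nat -> R), 0 <= tau 0%N ->
    (forall i, (i < n)%N -> tau i < tau i.+1) ->
    indep_seq P (fun i w => Y (tau i.+1) w - Y (tau i) w) n;
  rl_stat : forall s t, 0 <= s -> s <= t -> forall C, measurable C ->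
    P [set w | C (Y t w - Y s w)] = P [set w | C (Y (t - s) w)];
  rl_right : {ae P, forall w, forall t, 0 <= t ->
    Y s w @[s --> t^'+] --> Y t w};
  rl_re_le0 : forall u, A u <= 0;
  rl_cos : forall t, 0 <= t -> forall u,
    (\int[P]_w (cos (u * Y t w))%:E = (expR (t * A u) * cos (t * B u))%:E)%E;
  rl_sin : forall t, 0 <= t -> forall u,
    (\int[P]_w (sin (u * Y t w))%:E = (expR (t * A u) * sin (t * B u))%:E)%E }.

Section tail.
Variables (Y : R -> T -> R) (A B : R -> R).
Hypothesis LY : real_levy Y A B.
Variables (a K q e C th : R).
Hypothesis a0 : 0 < a.
Hypothesis AK : forall u, 0 <= u <= 2 / a -> `|A u| <= K.
Hypothesis BK : forall u, 0 <= u <= 2 / a -> `|B u| <= K.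
Hypothesis Aq : forall u, 0 <= u <= 1 / a -> A (2 * u) / 2 - 2 * A u <= 4 * q.
Hypotheses (e0 : 0 <= e) (C0 : 0 <= C) (th0 : 0 <= th).
Hypothesis Hdom : forall v, expR (th * (if `|v| <= 1 then v else 0)) <=
    1 + th * sin v + (1 + e) * (th ^+ 2 * (1 - cos v)) +
    C * (expR th * Num.min 1 (v ^+ 4)).

Let phi (x : R) : R := expR (th * (if `|x / a| <= 1 then x / a else 0)).
Let L := th * B (1 / a) - (1 + e) * th ^+ 2 * A (1 / a) + 180 * C * expR th * q.
Let M := 2 * th * K ^+ 2 + (1 + e) * th ^+ 2 * K ^+ 2 + 90 * C * expR th * K ^+ 2.

Let mphi : measurable_fun setT phi.
Proof.
apply: measurableT_comp => //.
apply: measurable_funM; first exact: measurable_cst.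
have ma : measurable_fun setT (fun x : R => x / a).
  by apply: measurable_funM => //; exact: measurable_cst.
apply: measurable_fun_ifT.
+ apply: measurable_fun_ler; last exact: measurable_cst.
  exact: measurableT_comp.
+ exact: ma.
+ exact: measurable_cst.
Qed.

Let mean_phi s : 0 <= s ->
  (\int[P]_w (phi (Y s w))%:E <= (expR (s * L + s ^+ 2 * M))%:E)%E.
Proof.
move=> s0.
have h := mean_expR_trunc_le (rl_meas LY s0) s0 (rl_re_le0 LY) (rl_cos LY s0)
  (rl_sin LY s0) a0 AK BK Aq e0 C0 th0 Hdom.
apply: (le_trans h); rewrite lee_fin -/L -/M.
by apply: le_trans (expR_ge1Dx _); rewrite addrA.
Qed.

Let large_jump s : 0 <= s ->
  (P [set w | a < `|Y s w|]%R <= (180 * s * q + 90 * s ^+ 2 * K ^+ 2)%:E)%E.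
Proof.
move=> s0; have mYs := rl_meas LY s0.
have h := mean_min1_quartic_le mYs s0 (rl_re_le0 LY) (rl_cos LY s0) a0 AK BK Aq.
apply: le_trans h.
set E := [set w | a < `|Y s w|]%R.
have mE : measurable E.
  have mN : measurable_fun setT (fun w => `|Y s w|) by exact: measurableT_comp.
  have := measurable_fun_ltr (@measurable_cst _ _ T R setT a) mN.
  by move=> /(_ measurableT [set true] I); rewrite setTI.
rewrite -(setIT E) -integral_indic//.
apply: ge0_le_integral => //.
- by apply/measurable_EFinP; apply: measurable_indic.
- apply/measurable_EFinP; apply: measurable_minr; first exact: measurable_cst.
  apply: measurable_funX; apply: measurable_funM => //; exact: measurable_cst.
- move=> w _; rewrite lee_fin indicE.
  have m0 : 0 <= (Y s w / a) ^+ 4 by rewrite exprn_even_ge0.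
  have [wE|wE] := boolP (w \in E); last by rewrite le_min ler01.
  rewrite le_min lexx/= -[leRHS]ger0_norm// normrX exprn_ege1//.
  rewrite normrM normfV (gtr0_norm a0) ler_pdivlMr// mul1r ltW//.
  by move: wE; rewrite inE.
Qed.

(** Outside the null set where [Y 0] is not 0, either one of the [n] increments exceeds [a], which a
    union bound covers, or no increment is truncated and the product [W] equals
    [expR (th / a * Y t)], to which Markov's inequality and independence apply. The [n] errors of
    order [(t / n) ^ 2] leave the terms in [n^-1]. *)
Let tail_bound_step t x n : 0 < t -> (0 < n)%N ->
  (P [set w | x < Y t w]%R <=
   (180 * t * q + 90 * t ^+ 2 * K ^+ 2 * n%:R^-1 +
    expR (- (th * x / a) + t * L + t ^+ 2 * M * n%:R^-1))%:E)%E.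
Proof.
move=> t0 n0.
have nR : 0 < n%:R :> R by rewrite ltr0n.
pose s := t / n%:R; have s0 : 0 < s by rewrite divr_gt0.
pose tau (i : nat) : R := i%:R * s.
have tau0 i : 0 <= tau i by rewrite mulr_ge0// ltW.
pose D i w := Y (tau i.+1) w - Y (tau i) w.
have mD i : measurable_fun setT (D i).
  by apply: measurable_funB; exact: (rl_meas LY).
have iD : indep_seq P D n.
  apply: (rl_indep LY) => // i _.
  by rewrite /tau ltr_pM2r// ltr_nat.
have tauS i : tau i.+1 - tau i = s by rewrite /tau -mulrBl -natrB// subSnn mul1r.
have lawD i S : measurable S -> P (D i @^-1` S) = P (Y s @^-1` S).
  move=> mS; rewrite -(tauS i); apply: (rl_stat LY) => //.
  by rewrite -subr_ge0 tauS ltW.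
have taun : tau n = t by rewrite /tau /s mulrCA divff ?mulr1// gt_eqF.
have sumD w : \sum_(i < n) D i w = Y t w - Y 0 w.
  have -> : \sum_(i < n) D i w = \sum_(0 <= i < n) (Y (tau i.+1) w - Y (tau i) w).
    by rewrite big_mkord.
  by rewrite telescope_sumr// taun /tau mul0r.
pose J i := [set w | a < `|D i w|]%R.
pose W w := \prod_(i < n) phi (D i w).
have mW : measurable_fun setT W.
  by apply: measurable_prod => i _; apply: measurableT_comp.
have W0 w : 0 <= W w by rewrite prodr_ge0// => i _; rewrite expR_ge0.
pose c := expR (th * x / a).
pose E := [set w | c <= W w]%R.
have mlt (f : T -> R) b : measurable_fun setT f -> measurable [set w | b < f w]%R.
  move=> mf; have := measurable_fun_ltr (@measurable_cst _ _ T R setT b) mf.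
  by move=> /(_ measurableT [set true] I); rewrite setTI.
have mE : measurable E.
  have := measurable_fun_ler (@measurable_cst _ _ T R setT c) mW.
  by move=> /(_ measurableT [set true] I); rewrite setTI.
have mJ i : measurable (J i).
  by apply: (mlt (fun w => `|D i w|)); exact: measurableT_comp.
have [N [mN PN sN]] := rl_zero LY.
have incl : [set w | x < Y t w]%R `<=` N `|` (\big[setU/set0]_(i < n) J i `|` E).
  move=> w /= xY; have [Nw|Nw] := pselect (N w); [by left|right].
  have Y0 : Y 0 w = 0 by apply: contrapT => H; apply: Nw; apply: sN.
  have [Jw|Jw] := pselect ((\big[setU/set0]_(i < n) J i) w); [by left|right].
  have small (i : 'I_n) : `|D i w| <= a.
    rewrite leNgt; apply/negP => H; apply: Jw.
    by rewrite -bigcup_seq /=; exists i => //=; rewrite mem_index_enum.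
  rewrite /E/= /W /c.
  have -> : \prod_(i < n) phi (D i w) = \prod_(i < n) expR (th / a * D i w).
    apply: eq_bigr => i _; rewrite /phi.
    rewrite normrM normfV (gtr0_norm a0) ler_pdivrMr// mul1r small.
    by congr expR; rewrite mulrAC mulrA.
  rewrite -expR_sum ler_expR -mulr_sumr sumD Y0 subr0.
  by rewrite mulrAC ler_wpM2l ?divr_ge0 ?(ltW a0)// ltW.
have PY : (P [set w | x < Y t w]%R <= P (\big[setU/set0]_(i < n) J i) + P E)%E.
  apply: (@le_trans _ _ (P (N `|` (\big[setU/set0]_(i < n) J i `|` E)))).
    apply: le_measure; rewrite ?inE//.
      by apply: mlt; apply: (rl_meas LY); exact: ltW.
    apply: measurableU => //; apply: measurableU => //.
    exact: bigsetU_measurable.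
  have mB : measurable (\big[setU/set0]_(i < n) J i) by exact: bigsetU_measurable.
  apply: le_trans; first by apply: measureU2 => //; exact: measurableU.
  apply: (@le_trans _ _ (0 + P (\big[setU/set0]_(i < n) J i `|` E))%E).
    by apply: leeD => //; rewrite le_eqVlt; apply/orP; left; apply/eqP; exact: PN.
  rewrite add0e; exact: measureU2.
apply: (le_trans PY); rewrite EFinD; apply: leeD.
  apply: le_trans; first exact: (Boole_inequality P (A := J) (fun i _ => mJ i)).
  apply: (@le_trans _ _ (\sum_(i < n) (180 * s * q + 90 * s ^+ 2 * K ^+ 2)%:E)%E).
    apply: lee_sum => i _.
    apply: le_trans (large_jump (ltW s0)).
    rewrite le_eqVlt; apply/orP; left; apply/eqP.
    apply: (lawD i [set x | a < `|x|]%R).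
    have := measurable_fun_ltr (@measurable_cst _ _ R R setT a) (@normr_measurable R setT).
    by move=> /(_ measurableT [set true] I); rewrite setTI.
  rewrite sumEFin lee_fin sumr_const card_ord -mulr_natr le_eqVlt; apply/orP; left.
  by apply/eqP; rewrite /s; field; rewrite gt_eqF.
apply: le_trans (markov_prob mW W0 (expR_gt0 _)) _.
rewrite -/c (indep_seq_integral_prod (f := fun=> phi) mD iD) //; last first.
  by move=> _ y; exact: expR_ge0.
apply: (@le_trans _ _ (c^-1%:E * \prod_(i < n) (expR (s * L + s ^+ 2 * M))%:E)%E).
  rewrite lee_pmul2l//; last by rewrite lte_fin invr_gt0 expR_gt0.
  (* Products of extended reals are monotone for nonnegative factors, so nonnegativity is carried
     through the induction. *)
  suff [_] : (0 <= \prod_(i < n) \int[P]_w (phi (D i w))%:E)%E /\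
    (\prod_(i < n) \int[P]_w (phi (D i w))%:E <=
     \prod_(i < n) (expR (s * L + s ^+ 2 * M))%:E)%E by [].
  apply: (big_ind2 (fun y z => 0 <= y /\ y <= z)%E) => //.
    move=> y1 z1 y2 z2 [y10 yz1] [y20 yz2].
    by split; [exact: mule_ge0|exact: lee_pmul].
  move=> i _; split.
    by apply: integral_ge0 => w _; rewrite lee_fin expR_ge0.
  apply: le_trans (mean_phi (ltW s0)).
  rewrite le_eqVlt; apply/orP; left; apply/eqP.
  apply: (@eq_law_integral (D i) (Y s) (EFin \o phi)) => //.
  - by apply: (rl_meas LY); exact: ltW.
  - by move=> S mS; exact: lawD.
  - exact/measurable_EFinP.
  - by move=> y; rewrite lee_fin expR_ge0.
rewrite prodEFin -EFinM lee_fin prodr_const card_ord -expRM_natl /c -expRN -expRD.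
rewrite ler_expR le_eqVlt; apply/orP; left; apply/eqP.
by rewrite /s; field; rewrite !gt_eqF.
Qed.

(** The left side does not depend on [n], so [n] may tend to infinity in [tail_bound_step]; every
    occurrence of [K] disappears. *)
Lemma tail_bound t x : 0 < t ->
  (P [set w | x < Y t w]%R <=
   (180 * t * q + expR (- (th * x / a) +
      t * (th * B (1 / a) - (1 + e) * th ^+ 2 * A (1 / a) +
           180 * C * expR th * q)))%:E)%E.
Proof.
move=> t0; rewrite -/L.
set p := P _.
have pfin : p \is a fin_num.
  apply: fin_num_measure.
  have := measurable_fun_ltr (@measurable_cst _ _ T R setT x) (rl_meas LY (ltW t0)).
  by move=> /(_ measurableT [set true] I); rewrite setTI.
rewrite -(fineK pfin) lee_fin.
pose u n : R := 180 * t * q + 90 * t ^+ 2 * K ^+ 2 * n.+1%:R^-1 +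
    expR (- (th * x / a) + t * L + t ^+ 2 * M * n.+1%:R^-1).
have pu n : fine p <= u n.
  by rewrite -lee_fin (fineK pfin); exact: tail_bound_step.
have cu : u n @[n --> \oo] --> 180 * t * q + 90 * t ^+ 2 * K ^+ 2 * 0 +
    expR (- (th * x / a) + t * L + t ^+ 2 * M * 0).
  apply: cvgD.
    apply: cvgD; first exact: cvg_cst.
    by apply: cvgMr; exact: cvg_harmonic.
  apply: continuous_cvg; first exact: continuous_expR.
  apply: cvgD; first exact: cvg_cst.
  by apply: cvgMr; exact: cvg_harmonic.
move: cu; rewrite !mulr0 !addr0 => cu.
by apply: (ler_cvg_to (cvg_cst (fine p)) cu); exact: nearW.
Qed.
End tail.
End real_levy.

(** * Ottaviani's inequality *)

Section maximal.
Context {R : realType} {d0 : measure_display} {T : measurableType d0}.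
Variable P : probability T R.

Lemma measurable_set_lt d (S : measurableType d) (f : S -> R) b :
  measurable_fun setT f -> measurable [set w | b < f w].
Proof.
move=> mf; have := measurable_fun_ltr (@measurable_cst _ _ S R setT b) mf.
by move=> /(_ measurableT [set true] I); rewrite setTI.
Qed.

Lemma measurable_set_ge d (S : measurableType d) (f : S -> R) b :
  measurable_fun setT f -> measurable [set w | f w <= b].
Proof.
move=> mf; have := measurable_fun_ler mf (@measurable_cst _ _ S R setT b).
by move=> /(_ measurableT [set true] I); rewrite setTI.
Qed.

Lemma bigsetU_ordP (F : nat -> set T) n w :
  (\big[setU/set0]_(k < n) F k) w <-> exists2 k, (k < n)%N & F k w.
Proof.
rewrite -bigcup_mkord; split => [[k /= kn Fk]|[k kn Fk]]; first by exists k.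
by exists k.
Qed.

Variables (Y : R -> T -> R) (A B : R -> R).
Hypothesis LY : real_levy P Y A B.
Variables (t x y : R).
Hypotheses (t0 : 0 < t) (y0 : 0 <= y).
Hypothesis Yhalf : forall s, 0 <= s <= t -> (P [set w | Y s w < - y]%R <= (1 / 2)%:E)%E.

Let mY s : 0 <= s -> measurable_fun setT (Y s).
Proof. exact: (rl_meas LY). Qed.

Section grid.
Variable n : nat.
Hypothesis n0 : (0 < n)%N.
Let tau (i : nat) : R := i%:R * (t / n%:R).
(** The value is taken relative to [Y 0], which makes [F j] a function of the increments alone;
    [Y 0 = 0] is only known almost surely. *)
Let F (j : nat) := [set w | x + y < Y (tau j.+1) w - Y 0 w].

Let s0 : 0 < t / n%:R. Proof. by rewrite divr_gt0// ltr0n. Qed.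
Let tau0 i : 0 <= tau i. Proof. by rewrite mulr_ge0// ltW. Qed.
Let taun : tau n = t. Proof. by rewrite /tau mulrCA divff ?mulr1// gt_eqF ?ltr0n. Qed.
Let tau_lt i j : (i < j)%N -> tau i < tau j.
Proof. by move=> ij; rewrite /tau ltr_pM2r// ltr_nat. Qed.

Let mF j : measurable (F j).
Proof.
by apply: measurable_set_lt; apply: measurable_funB; apply: mY.
Qed.

Let mFU j : measurable (seqDU F j). Proof. exact: seqDU_measurable. Qed.

Let E j := [set w | - y <= Y t w - Y (tau j.+1) w].

Let mE j : measurable (E j).
Proof.
rewrite (_ : E j = [set w | Y (tau j.+1) w - Y t w <= y]).
  by apply: measurable_set_ge; apply: measurable_funB; apply: mY => //; exact: ltW.
by apply/seteqP; split => w; rewrite /E/= lerNl opprB.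
Qed.

(* The event that the running maximum first exceeds [x + y] at time [tau j.+1]
   is independent of the increment after that time. *)
Let indepFE j : (j.+1 < n)%N ->
  P (seqDU F j `&` E j) = (P (seqDU F j) * P (E j))%E.
Proof.
move=> jn.
(* The grid is followed up to [tau j.+1] and then left for [t]: the increments before index [j.+1]
   decide the first passage, the one of index [j.+1] is [Y t - Y (tau j.+1)]. *)
pose sg i := if (i < j.+2)%N then tau i else t.
have sg0 i : 0 <= sg i by rewrite /sg; case: ifP => _ //; exact: ltW.
pose D i w := Y (sg i.+1) w - Y (sg i) w.
have mD i : measurable_fun setT (D i) by apply: measurable_funB; apply: mY.
have iD : indep_seq P D j.+2.
  apply: (rl_indep LY) => // i ij; rewrite /sg ij.
  case: ifPn => [_|]; first exact: tau_lt.
  rewrite -leqNgt ltnS => ji; rewrite -taun; apply: tau_lt.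
  by rewrite (leq_ltn_trans _ jn).
pose C : set (j.+1.-tuple R) := [set u | x + y < \sum_(l < j.+1) tnth u l] `&`
  \bigcap_(i in [set i | (i < j)%N])
     [set u | \sum_(l < j.+1 | (l <= i)%N) tnth u l <= x + y].
have mC : measurable C.
  apply: measurableI.
    by apply: measurable_set_lt; apply: measurable_sum => l; exact: measurable_tnth.
  apply: bigcap_measurableType => i _.
  apply: measurable_set_ge; under eq_fun do rewrite big_mkcond/=.
  apply: measurable_sum => l; case: (l <= i)%N; first exact: measurable_tnth.
  exact: measurable_cst.
have sumD i w : (i <= j)%N ->
    \sum_(l < j.+1 | (l <= i)%N) D l w = Y (tau i.+1) w - Y 0 w.
  move=> ij.
  rewrite -(big_mkord (fun l => (l <= i)%N) (fun l => D l w)).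
  transitivity (\sum_(0 <= l < i.+1) D l w).
    by rewrite (big_nat_widen 0 i.+1 j.+1).
  rewrite (eq_big_nat _ _ (F2 := fun l => Y (tau l.+1) w - Y (tau l) w)); last first.
    move=> l /andP[_]; rewrite ltnS => li.
    by rewrite /D /sg !ltnS (leq_trans li ij) (leq_trans li (leqW ij)).
  by rewrite telescope_sumr// /tau mul0r.
have FC : seqDU F j = [set w | C [tuple D l w | l < j.+1]].
  have sumT w i : (i <= j)%N -> \sum_(l < j.+1 | (l <= i)%N) tnth [tuple D l w | l < j.+1] l
      = Y (tau i.+1) w - Y 0 w.
    move=> ij; rewrite -sumD//; apply: eq_bigr => l _; exact: tnth_mktuple.
  have sumTj w : \sum_(l < j.+1) tnth [tuple D l w | l < j.+1] l =
      Y (tau j.+1) w - Y 0 w.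
    by rewrite -sumT//; apply: eq_bigl => l; rewrite -ltnS ltn_ord.
  apply/seteqP; split => w /=.
    move=> [Fj nF]; split; first by rewrite /= sumTj.
    move=> i /= ij; rewrite sumT ?(ltnW ij)// leNgt; apply/negP => H.
    by apply: nF; apply/bigsetU_ordP; exists i.
  move=> [+ H]; rewrite /= sumTj => Fj; split => //.
  move=> /bigsetU_ordP[i ij Fi]; have := H i ij.
  by rewrite /= sumT ?(ltnW ij)// leNgt => /negP; apply.
have -> : E j = D j.+1 @^-1` [set v | - y <= v].
  by apply/seteqP; split => w; rewrite /E /D /sg/= ltnn leqnn.
rewrite FC; apply: (indep_seq_tuple iD mD mC).
rewrite (_ : mkset _ = `[- y, +oo[%classic); first exact: measurable_itv.
by apply/seteqP; split => v; rewrite /= in_itv/= andbT.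
Qed.

Let halfE j : (j < n)%N -> ((1 / 2)%:E <= P (E j))%E.
Proof.
move=> jn; have tj : tau j.+1 <= t.
  have [->|] := eqVneq j.+1 n; first by rewrite taun.
  by move=> jn1; rewrite -[leRHS]taun ltW// tau_lt// ltn_neqAle jn1 jn.
have -> : P (E j) = P [set w | - y <= Y (t - tau j.+1) w].
  apply: (rl_stat LY (tau0 _) tj (C := [set v | - y <= v])).
  rewrite (_ : mkset _ = `[- y, +oo[%classic); first exact: measurable_itv.
  by apply/seteqP; split => v; rewrite /= in_itv/= andbT.
have tj0 : 0 <= t - tau j.+1 by rewrite subr_ge0.
have mL : measurable [set w | Y (t - tau j.+1) w < - y].
  rewrite (_ : mkset _ = [set w | y < - Y (t - tau j.+1) w]).
    by apply: measurable_set_lt; apply: measurableT_comp => //; exact: mY.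
  by apply/seteqP; split => w; rewrite /= ltrNr.
have -> : [set w | - y <= Y (t - tau j.+1) w] = ~` [set w | Y (t - tau j.+1) w < - y].
  apply/seteqP; split => w /=; first by rewrite leNgt => /negP.
  by move=> /negP; rewrite -leNgt.
rewrite probability_setC//.
have h : (P [set w | Y (t - tau j.+1) w < - y]%R <= (1 / 2)%:E)%E.
  by apply: Yhalf; rewrite tj0/= lerBlDr lerDl.
have pf : P [set w | Y (t - tau j.+1) w < - y]%R \is a fin_num by exact: fin_num_measure.
by move: h; rewrite -(fineK pf) -EFinB !lee_fin; lra.
Qed.

(** Split according to the first grid time at which [x + y] is exceeded. Independently of that
    event, the process loses at most [y] afterwards with probability at least [1 / 2], and then
    [Y t > x]; the factor 2 is the inverse of this probability. *)
Lemma ottaviani_grid :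
  (P (\big[setU/set0]_(j < n) F j) <= 2%:E * P [set w | x < Y t w]%R)%E.
Proof.
have [N [mN PN sN]] := rl_zero LY.
have mX : measurable [set w | x < Y t w]%R.
  by apply: measurable_set_lt; apply: mY; exact: ltW.
have FE j : (j < n)%N -> (P (seqDU F j) <= 2%:E * P (seqDU F j `&` E j))%E.
  move=> jn; have pf : P (seqDU F j) \is a fin_num by exact: fin_num_measure.
  (* At the last grid time nothing remains of [[0, t]]: the increment would be degenerate, but [E j]
     is the whole space. *)
  have [ejn|jn'] := eqVneq j.+1 n.
    rewrite (_ : E j = setT) ?setIT; last first.
      by apply/seteqP; split => w // _; rewrite /E/= ejn taun subrr oppr_le0.
    by rewrite -(fineK pf) -EFinM lee_fin; have : 0 <= fine (P (seqDU F j)); [exact: fine_ge0|lra].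
  rewrite indepFE; last by rewrite ltn_neqAle jn' jn.
  have h := halfE jn.
  have ef : P (E j) \is a fin_num by exact: fin_num_measure.
  have q0 : 0 <= fine (P (seqDU F j)) by exact: fine_ge0.
  move: h; rewrite -(fineK pf) -(fineK ef) -!EFinM !lee_fin => h.
  have := ler_wpM2l q0 h; lra.
rewrite bigsetU_seqDU.
apply: le_trans; first exact: (Boole_inequality P (A := seqDU F) (fun i _ => mFU i)).
apply: (@le_trans _ _ (\sum_(j < n) (2%:E * P (seqDU F j `&` E j)))%E).
  by apply: lee_sum => j _; exact: FE.
rewrite -ge0_sume_distrr//; rewrite lee_pmul2l//.
have tFE : trivIset setT (fun j => seqDU F j `&` E j).
  move=> i j _ _ [w [[wi _] [wj _]]].
  by apply: (trivIset_seqDU F) => //; exists w; split.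
rewrite -(@measure_semi_additive_ord_I _ _ _ P (fun j => seqDU F j `&` E j)); last 3 first.
- by move=> k _; exact: measurableI.
- exact: sub_trivIset tFE.
- by apply: bigsetU_measurable => k _; exact: measurableI.
apply: (@le_trans _ _ (P (N `|` [set w | x < Y t w]%R))).
  apply: le_measure; rewrite ?inE.
  - by apply: bigsetU_measurable => k _; exact: measurableI.
  - exact: measurableU.
  move=> w /(bigsetU_ordP (fun k => seqDU F k `&` E k))[k kn [[Fk _] Ek]].
  have [Nw|Nw] := pselect (N w); [by left|right].
  have Y0 : Y 0 w = 0 by apply: contrapT => H; apply: Nw; apply: sN.
  by move: Fk Ek; rewrite /F /E/= Y0; lra.
have PN0 : P N = 0%E by exact: PN.
have hU : (P (N `|` [set w | x < Y t w]%R) <= P N + P [set w | x < Y t w]%R)%E.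
  exact: measureU2.
by rewrite PN0 add0e in hU.
Qed.
End grid.

(** The grid events of the dyadic partitions increase, so the bound passes to their union [G]. By
    right continuity a strict excess at [s < t] persists at a grid time just after [s]. The
    uncountable union over [s] is not itself measured, only covered almost surely by [G]. *)
Lemma ottaviani : exists G : set T, [/\ measurable G,
  (P G <= 2%:E * P [set w | x < Y t w]%R)%E &
  {ae P, forall w, forall s, 0 <= s <= t -> x + y < Y s w -> G w}].
Proof.
pose F m j := [set w | x + y < Y (j.+1%:R * (t / (2 ^ m)%:R)) w - Y 0 w].
pose H m := \big[setU/set0]_(j < 2 ^ m) F m j.
have pow0 m : (0 < 2 ^ m)%N by rewrite expn_gt0.
have mF m j : measurable (F m j).
  apply: measurable_set_lt; apply: measurable_funB; apply: mY => //.
  by rewrite mulr_ge0// divr_ge0// ltW.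
have mH m : measurable (H m) by exact: bigsetU_measurable.
have mHU : measurable (\bigcup_m H m) by exact: bigcup_measurable.
have ndH : nondecreasing_seq H.
  apply/nondecreasing_seqP => m; apply/subsetPset => w /bigsetU_ordP[j jm Fj].
  (* Index [j] stands for the grid time of rank [j.+1]; on the next grid its rank is [2 * j.+1], so
     its index is [j.*2.+1]. *)
  apply/bigsetU_ordP; exists j.*2.+1; first by rewrite expnS mul2n ltn_Sdouble.
  move: Fj; rewrite /F/= -doubleS -!mul2n expnS !natrM.
  have -> : 2 * j.+1%:R * (t / (2 * (2 ^ m)%:R)) = j.+1%:R * (t / (2 ^ m)%:R) :> R.
    by field; rewrite gt_eqF// ltr0n.
  by [].
exists (\bigcup_m H m); split => //.
  have cH := nondecreasing_cvg_mu (mu := P) mH mHU ndH.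
  rewrite -(cvg_lim _ cH)//; apply: lime_le; first by apply/cvg_ex; eexists; exact: cH.
  by apply: nearW => m; exact: ottaviani_grid.
apply: filterS2 (rl_right LY) (rl_zero LY) => w rw Y0 s /andP[s0 st] ys.
(* At [s = t] right continuity only gives times outside [[0, t]]; the grid of level 0, whose single
   point is [t], serves instead. *)
have [est|sneqt] := eqVneq s t.
  exists 0%N => //; apply/(bigsetU_ordP (F 0%N)); exists 0%N => //.
  by rewrite /F/= Y0 subr0 mul1r expn0 divr1 -est.
have {sneqt} sltt : s < t by rewrite lt_neqAle sneqt.
have [e e0 he] : exists2 e : R, 0 < e & forall u, s < u -> u < s + e -> x + y < Y u w.
  have := rw s s0 => /cvgrPdist_lt /(_ (Y s w - (x + y))).
  rewrite subr_gt0 => /(_ ys) [e /= e0 he]; exists e => // u su ue.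
  have := he u; rewrite /ball/= ltr0_norm ?subr_lt0// opprB ltrBlDl => /(_ ue su).
  by rewrite ltr_norml => /andP[_]; lra.
(* From [2 ^ m > m > t / e] the mesh is below [e], and the grid time following [s] lies strictly
   between [s] and [s + e]. *)
pose m := (Num.truncn (t / e)).+1.
have tm : t / (2 ^ m)%:R < e.
  rewrite ltr_pdivrMr ?ltr0n// mulrC -ltr_pdivrMr//.
  apply: lt_trans (truncnS_gt _) _; rewrite ltr_nat.
  exact: ltn_expl.
pose r := s / (t / (2 ^ m)%:R).
have tm0 : 0 < t / (2 ^ m)%:R by rewrite divr_gt0// ltr0n.
have r0 : 0 <= r by rewrite divr_ge0// ltW.
pose j := Num.truncn r.
have jr : j%:R <= r by rewrite truncn_le.
have rj : r < j.+1%:R by exact: truncnS_gt.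
exists m => //; apply/(bigsetU_ordP (F m)); exists j.
  rewrite -(ltr_nat R); apply: le_lt_trans jr _.
  by rewrite /r ltr_pdivrMr// mulrCA divff ?mulr1// gt_eqF// ltr0n.
rewrite /F/= Y0 subr0; apply: he; first by rewrite -ltr_pdivrMr.
rewrite -natr1 mulrDl mul1r; apply: ler_ltD => //.
by rewrite -ler_pdivlMr.
Qed.
End maximal.

(** * Projections of a Levy process *)

Section vectors.
Context {R : realType} {d : nat}.
Implicit Types (x y z : d.-tuple R).

Definition vscale (u : R) (z : d.-tuple R) : d.-tuple R := [tuple u * vcoord z i | i < d].

Lemma vcoord_mktuple (f : 'I_d -> R) i : vcoord [tuple f j | j < d] i = f i.
Proof. exact: tnth_mktuple. Qed.

Lemma vdot_scalel u z y : vdot (vscale u z) y = u * vdot z y.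
Proof.
rewrite /vdot mulr_sumr; apply: eq_bigr => i _.
by rewrite /vscale vcoord_mktuple mulrA.
Qed.

Lemma vdotC x y : vdot x y = vdot y x.
Proof. by apply: eq_bigr => i _; rewrite mulrC. Qed.

Lemma vdotB z x y : vdot z (vsub x y) = vdot z x - vdot z y.
Proof.
rewrite /vdot -sumrB; apply: eq_bigr => i _.
by rewrite /vsub vcoord_mktuple mulrBr.
Qed.

Lemma vdot0 z : vdot z (vzero R d) = 0.
Proof. by apply: big1 => i _; rewrite /vzero vcoord_mktuple mulr0. Qed.

Lemma vnorm_ge0 y : 0 <= vnorm y. Proof. exact: sqrtr_ge0. Qed.

Lemma sqr_vnorm y : vnorm y ^+ 2 = \sum_(i < d) vcoord y i ^+ 2.
Proof. by rewrite sqr_sqrtr// sumr_ge0// => i _; exact: sqr_ge0. Qed.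

Lemma vdot_self y : vdot y y = vnorm y ^+ 2.
Proof. by rewrite sqr_vnorm; apply: eq_bigr => i _; rewrite expr2. Qed.

(** Cauchy-Schwarz: [vnorm z ^ 2] times the deficit is the squared norm of
    [vnorm z ^ 2 * y - vdot z y * z]. The case [z = 0] is separate because that factor then
    vanishes. *)
Lemma abs_vdot_le z y : `|vdot z y| <= vnorm z * vnorm y.
Proof.
rewrite -ler_sqr ?nnegrE ?mulr_ge0 ?vnorm_ge0// real_normK ?num_real// exprMn.
have H : 0 <= vnorm z ^+ 2 * (vnorm z ^+ 2 * vnorm y ^+ 2 - vdot z y ^+ 2).
  have -> : vnorm z ^+ 2 * (vnorm z ^+ 2 * vnorm y ^+ 2 - vdot z y ^+ 2) =
      \sum_(i < d) (vnorm z ^+ 2 * vcoord y i - vdot z y * vcoord z i) ^+ 2.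
    under eq_bigr => i _ do rewrite sqrrB !exprMn.
    rewrite big_split sumrB/= -!mulr_sumr -!sqr_vnorm.
    have -> : \sum_(i < d) vnorm z ^+ 2 * vcoord y i * (vdot z y * vcoord z i) *+ 2 =
       (vnorm z ^+ 2 * vdot z y) *+ 2 * (\sum_(i < d) vcoord z i * vcoord y i).
      rewrite mulr_sumr; apply: eq_bigr => i _.
      by rewrite !mulr2n; ring.
    by rewrite -/(vdot z y) !mulr2n; ring.
  by apply: sumr_ge0 => i _; exact: sqr_ge0.
have [z0|z0] := eqVneq (vnorm z ^+ 2) 0; last first.
  by move: H; rewrite pmulr_rge0 ?subr_ge0// lt_neqAle eq_sym z0 sqr_ge0.
rewrite z0 mul0r (_ : vdot z y = 0) ?expr0n//.
have {}z0 := z0; apply: big1 => i _.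
have : vcoord z i ^+ 2 = 0.
  move: z0; rewrite sqr_vnorm => /eqP; rewrite psumr_eq0; last by move=> j _; exact: sqr_ge0.
  by move=> /allP/(_ i (mem_index_enum _)) /eqP.
by move=> /eqP; rewrite sqrf_eq0 => /eqP ->; rewrite mul0r.
Qed.

Lemma abs_vdot_le1 z y : vnorm z <= 1 -> `|vdot z y| <= vnorm y.
Proof.
move=> z1; apply: le_trans (abs_vdot_le z y) _.
by rewrite ler_piMl// vnorm_ge0.
Qed.

Lemma measurable_vcoord i : measurable_fun setT (fun y : d.-tuple R => vcoord y i).
Proof. exact: measurable_tnth. Qed.

Lemma measurable_vdot z : measurable_fun setT (vdot z).
Proof.
apply: (@measurable_sum _ _ _ setT _ _ (fun i y => vcoord z i * vcoord y i)) => i.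
apply: measurable_funM; first exact: measurable_cst.
exact: measurable_vcoord.
Qed.

Lemma measurable_vnorm : measurable_fun setT (@vnorm R d).
Proof.
apply: (@measurableT_comp _ _ _ _ _ _ (@Num.sqrt R)).
  by apply: continuous_measurable_fun; exact: sqrt_continuous.
apply: (@measurable_sum _ _ _ setT _ _ (fun i y => vcoord y i ^+ 2)) => i.
by apply: measurable_funX; exact: measurable_vcoord.
Qed.

Lemma qform0 x : qform (0 : 'M[R]_d) x = 0.
Proof. by apply: big1 => i _; apply: big1 => j _; rewrite mxE mulr0 mul0r. Qed.

End vectors.

Section projection.
Context {R : realType} {d : nat} {d0 : measure_display} {T : measurableType d0}.
Variables (P : probability T R) (X : R -> T -> d.-tuple R).
Variables (gamma : d.-tuple R) (Pi : {measure set (d.-tuple R) -> \bar R}).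
Hypothesis LX : levy_process P X gamma 0 Pi.

(** The characteristic function of [<z, X_t>] at [u] is that of [X_t] at [u z]. With zero Gaussian
    part, the real exponent is an integral of [cos - 1], hence nonpositive. *)
Lemma real_levy_projection (z : d.-tuple R) :
  real_levy P (fun t w => vdot z (X t w)) (fun u => LK_re 0 Pi (vscale u z))
    (fun u => LK_im gamma Pi (vscale u z)).
Proof.
have [_ [mX [X0 [iX [sX [rX cX]]]]]] := LX.
have mY t : 0 <= t -> measurable_fun setT (fun w => vdot z (X t w)).
  by move=> t0; apply: measurableT_comp; [exact: measurable_vdot|exact: mX].
have mpre C : measurable C -> measurable (vdot z @^-1` C).
  by move=> mC; rewrite -[X in measurable X]setTI; exact: measurable_vdot.
split => //.
- by apply: filterS X0 => w ->; rewrite vdot0.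
- move=> n tau tau0 taulen B mB.
  have := iX n (fun i => tau i) tau0 (fun i => taulen i (ltn_ord i))
    (fun i => vdot z @^-1` B i) (fun i => mpre _ (mB i)).
  rewrite /= => H.
  transitivity (P (\bigcap_(i in [set: 'I_n])
      [set w | B i (vdot z (vsub (X (tau (lift ord0 i)) w) (X (tau (widen_ord (leqnSn n) i)) w)))])).
    congr (P _); apply/seteqP; split => w /= Hw.
      by move=> i _ /=; rewrite vdotB; exact: Hw.
    move=> i lt_in; have := Hw (Ordinal lt_in) I.
    by rewrite /= vdotB.
  rewrite [LHS]H; apply: eq_bigr => i _; congr (P _).
  by apply/seteqP; split => w /=; rewrite vdotB.
- move=> s t s0 st C mC.
  have := sX s t s0 st _ (mpre C mC).
  move=> H; rewrite -[RHS]H; congr (P _).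
  by apply/seteqP; split => w /=; rewrite vdotB.
- apply: filterS rX => w rw t t0.
  have H (r : seq 'I_d) :
      (\sum_(i <- r) vcoord z i * vcoord (X s w) i) @[s --> t^'+] -->
      \sum_(i <- r) vcoord z i * vcoord (X t w) i.
    elim: r => [|i r IH].
      by rewrite big_nil; under eq_cvg do rewrite big_nil; exact: cvg_cst.
    rewrite big_cons; under eq_cvg do rewrite big_cons.
    apply: cvgD IH; apply: cvgM; first exact: cvg_cst.
    by have [] := rw t t0 i.
  exact: H.
- move=> u; rewrite /LK_re qform0 oppr0 mul0r add0r.
  rewrite -oppr_ge0 /Rintegral -fineN; apply: fine_ge0.
  rewrite integralE [X in (X - _)%E]integral0_eq; last first.
    move=> y _; rewrite funeposE; apply/max_idPr; rewrite lee_fin subr_le0; exact: cos_le1.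
  by rewrite sub0e oppeK; apply: integral_ge0.
- by move=> t t0 u; have [+ _] := cX t t0 (vscale u z); under eq_integral do rewrite vdot_scalel.
- by move=> t t0 u; have [_ +] := cX t t0 (vscale u z); under eq_integral do rewrite vdot_scalel.
Qed.
End projection.

(** * Integrals against the Levy measure *)

Section levy_measure.
Context {R : realType} {d : nat}.
Variable Pi : {measure set (d.-tuple R) -> \bar R}.
Hypothesis HPi : is_levy_measure Pi.
Implicit Types (y z : d.-tuple R) (b u : R).
Local Notation mu2 y := (Num.min 1 (vnorm y ^+ 2)).

Lemma levy_integrable (f : d.-tuple R -> R) c : 0 <= c ->
  measurable_fun setT f -> (forall y, `|f y| <= c * mu2 y) ->
  Pi.-integrable setT (EFin \o f).
Proof.
move=> c0 mf fc; have [_ Pi1] := HPi.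
have mmu : measurable_fun setT (fun y => mu2 y).
  apply: measurable_minr; first exact: measurable_cst.
  by apply: measurable_funX; exact: measurable_vnorm.
apply/integrableP; split; first exact/measurable_EFinP.
apply: (@le_lt_trans _ _ (\int[Pi]_y (c%:E * (mu2 y)%:E))%E).
  apply: ge0_le_integral => //.
  - apply/measurable_EFinP; exact: measurableT_comp.
  - by apply: measurable_funeM; exact/measurable_EFinP.
  - by move=> y _; rewrite /= -EFinM lee_fin.
rewrite ge0_integralZl//; last 2 first.
- exact/measurable_EFinP.
- by move=> y _; rewrite lee_fin le_min ler01 sqr_ge0.
by rewrite lte_mul_pinfty.
Qed.

(** The moments into which the exponent is cut at the levels [b] and 1. [jump4] is [q] per unit of
    time and [trunc_dot2] is the integral under the supremum in [Vfun]; [trunc2], [mid1] and [big0]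
    enter the drift. *)
Definition jump4 b : R := \int[Pi]_y Num.min 1 ((vnorm y / b) ^+ 4).
Definition trunc2 b : R := \int[Pi]_y (if vnorm y <= b then vnorm y ^+ 2 else 0).
Definition trunc_dot2 b z : R := \int[Pi]_y (if vnorm y <= b then vdot z y ^+ 2 else 0).
Definition mid1 b : R := \int[Pi]_y (if b < vnorm y <= 1 then vnorm y else 0).
Definition big0 : R := \int[Pi]_y (if 1 < vnorm y then 1 else 0).

Let n0 y : 0 <= vnorm y := vnorm_ge0 y.

Let mu2_le1 y : vnorm y <= 1 -> mu2 y = vnorm y ^+ 2.
Proof. by move=> y1; rewrite min_r// expr_le1. Qed.

Let mu2_gt1 y : 1 < vnorm y -> mu2 y = 1.
Proof. by move=> y1; rewrite min_l// exprn_ege1// ltW. Qed.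

Let mu2_ge0 y : 0 <= mu2 y. Proof. by rewrite le_min ler01 sqr_ge0. Qed.

Let mif (B : d.-tuple R -> bool) (f : d.-tuple R -> R) :
  measurable_fun setT B -> measurable_fun setT f ->
  measurable_fun setT (fun y => if B y then f y else 0).
Proof. by move=> mB mf; apply: measurable_fun_ifT => //; exact: measurable_cst. Qed.

Let mle b : measurable_fun setT (fun y : d.-tuple R => vnorm y <= b).
Proof. by apply: measurable_fun_ler; [exact: measurable_vnorm|exact: measurable_cst]. Qed.

Let mlt b : measurable_fun setT (fun y : d.-tuple R => b < vnorm y).
Proof. by apply: measurable_fun_ltr; [exact: measurable_cst|exact: measurable_vnorm]. Qed.

Let mn2 : measurable_fun setT (fun y : d.-tuple R => vnorm y ^+ 2).
Proof. by apply: measurable_funX; exact: measurable_vnorm. Qed.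

Lemma integrable_jump4 b : 0 < b ->
  Pi.-integrable setT (EFin \o (fun y => Num.min 1 ((vnorm y / b) ^+ 4))).
Proof.
move=> b0; have c0 : 0 <= b^-1 ^+ 4 by rewrite exprn_ge0// invr_ge0 ltW.
apply: (@levy_integrable _ (1 + b^-1 ^+ 4)); first by rewrite addr_ge0.
  apply: measurable_minr; first exact: measurable_cst.
  apply: measurable_funX; apply: measurable_funM; first exact: measurable_vnorm.
  exact: measurable_cst.
move=> y; have m0 : 0 <= (vnorm y / b) ^+ 4 by rewrite exprn_even_ge0.
rewrite ger0_norm; last by rewrite le_min ler01.
have [y1|y1] := leP (vnorm y) 1.
  rewrite mu2_le1// ge_min; apply/orP; right.
  rewrite exprMn mulrDl mul1r -[leLHS]add0r lerD ?sqr_ge0//.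
  rewrite mulrC ler_wpM2l// (_ : 4%N = (2 + 2)%N)// exprD ler_piMr ?sqr_ge0//.
  by rewrite expr_le1.
by rewrite mu2_gt1// mulr1 ge_min lerDl c0.
Qed.

Lemma integrable_trunc2 b :
  Pi.-integrable setT (EFin \o (fun y => if vnorm y <= b then vnorm y ^+ 2 else 0)).
Proof.
apply: (@levy_integrable _ (1 + b ^+ 2)); first by rewrite addr_ge0 ?sqr_ge0.
  exact: mif.
move=> y; case: ifPn => [yb|_]; last first.
  by rewrite normr0 mulr_ge0// addr_ge0 ?sqr_ge0.
rewrite ger0_norm ?sqr_ge0//.
have [y1|y1] := leP (vnorm y) 1.
  by rewrite mu2_le1// ler_peMl ?sqr_ge0// lerDl sqr_ge0.
rewrite mu2_gt1// mulr1 -[leLHS]add0r lerD// ler_sqr ?nnegrE//.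
by rewrite (le_trans _ yb).
Qed.

Lemma integrable_trunc_dot2 b z : vnorm z <= 1 ->
  Pi.-integrable setT (EFin \o (fun y => if vnorm y <= b then vdot z y ^+ 2 else 0)).
Proof.
move=> z1; apply: le_integrable (integrable_trunc2 b) => //.
  by apply/measurable_EFinP; apply: mif => //; apply: measurable_funX; exact: measurable_vdot.
move=> y _ /=; rewrite lee_fin; case: ifPn => // _.
rewrite !ger0_norm ?sqr_ge0// -real_normK ?num_real// ler_sqr ?nnegrE//.
exact: abs_vdot_le1.
Qed.

Lemma integrable_mid1 b : 0 < b ->
  Pi.-integrable setT (EFin \o (fun y => if b < vnorm y <= 1 then vnorm y else 0)).
Proof.
move=> b0; have c0 : 0 <= b^-1 by rewrite invr_ge0 ltW.
apply: (@levy_integrable _ (1 + b^-1)); first by rewrite addr_ge0.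
  apply: mif; last exact: measurable_vnorm.
  by apply: measurable_and.
move=> y; case: ifPn => [/andP[yb y1]|_]; last first.
  by rewrite normr0 mulr_ge0// addr_ge0.
rewrite ger0_norm// mu2_le1// mulrDl mul1r -[leLHS]add0r lerD ?sqr_ge0//.
by rewrite ler_pdivlMl// expr2 ler_wpM2r// ltW.
Qed.

Lemma integrable_big0 :
  Pi.-integrable setT (EFin \o (fun y => if 1 < vnorm y then 1 : R else 0)).
Proof.
apply: (@levy_integrable _ 1) => //.
  by apply: mif => //; exact: measurable_cst.
move=> y; rewrite mul1r; case: ifPn => [y1|_]; last by rewrite normr0.
by rewrite normr1 mu2_gt1.
Qed.

Section direction.
Variables (gamma z : d.-tuple R).
Hypothesis z1 : vnorm z <= 1.
Let A u := LK_re 0 Pi (vscale u z).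
Let B u := LK_im gamma Pi (vscale u z).
Let v y := vdot z y.

Let vn y : `|v y| <= vnorm y. Proof. exact: abs_vdot_le1. Qed.

Let vn2 y : v y ^+ 2 <= vnorm y ^+ 2.
Proof. by rewrite -real_normK ?num_real// ler_sqr ?nnegrE. Qed.

Let mv : measurable_fun setT v. Proof. exact: measurable_vdot. Qed.

Let mcosv u : measurable_fun setT (fun y => cos (u * v y)).
Proof.
apply: measurableT_comp; first by apply: continuous_measurable_fun; exact: continuous_cos.
by apply: measurable_funM => //; exact: measurable_cst.
Qed.

Let msinv u : measurable_fun setT (fun y => sin (u * v y)).
Proof.
apply: measurableT_comp; first by apply: continuous_measurable_fun; exact: continuous_sin.
by apply: measurable_funM => //; exact: measurable_cst.
Qed.

Let icos u : Pi.-integrable setT (EFin \o (fun y => cos (u * v y) - 1)).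
Proof.
apply: (@levy_integrable _ (2 + u ^+ 2)); first by rewrite addr_ge0 ?sqr_ge0.
  by apply: measurable_funB => //; exact: measurable_cst.
move=> y; rewrite ler0_norm ?subr_le0 ?cos_le1// opprB.
have [y1|y1] := leP (vnorm y) 1.
  rewrite mu2_le1//; have := cos_ge_quadratic (u * v y); rewrite exprMn.
  have := ler_wpM2l (sqr_ge0 u) (vn2 y); have := sqr_ge0 (vnorm y).
  have := mulr_ge0 (sqr_ge0 u) (sqr_ge0 (vnorm y)); lra.
by rewrite mu2_gt1// mulr1; have := cos_geN1 (u * v y); have := sqr_ge0 u; lra.
Qed.

Let isin u : Pi.-integrable setT
  (EFin \o (fun y => sin (u * v y) - u * v y * (if vnorm y <= 1 then 1 else 0))).
Proof.
apply: (@levy_integrable _ (1 + u ^+ 2)); first by rewrite addr_ge0 ?sqr_ge0.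
  apply: measurable_funB => //; apply: measurable_funM.
    by apply: measurable_funM => //; exact: measurable_cst.
  by apply: mif => //; exact: measurable_cst.
move=> y; case: ifPn => [y1|].
  rewrite mulr1 mu2_le1//; apply: le_trans (sin_sub_id_le_sqr _) _.
  rewrite exprMn; have := ler_wpM2l (sqr_ge0 u) (vn2 y); have := sqr_ge0 (vnorm y); lra.
rewrite -ltNge mulr0 subr0 => y1; rewrite mu2_gt1// mulr1.
by have := sin_max (u * v y); have := sqr_ge0 u; lra.
Qed.

Let AE u : A u = \int[Pi]_y (cos (u * v y) - 1).
Proof.
rewrite /A /LK_re qform0 oppr0 mul0r add0r.
by congr fine; apply: eq_integral => y _; rewrite vdot_scalel.
Qed.

Let BE u : B u = u * vdot z gamma +
  \int[Pi]_y (sin (u * v y) - u * v y * (if vnorm y <= 1 then 1 else 0)).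
Proof.
rewrite /B /LK_im vdotC vdot_scalel; congr (_ + _).
by congr fine; apply: eq_integral => y _; rewrite vdot_scalel.
Qed.

(** Only the existence of [K] matters, since it multiplies the terms that vanish as the increments
    get shorter. It comes from bounding both integrands by a multiple of [min 1 (|y| ^ 2)],
    uniformly for [u <= M]. *)
Lemma levy_exponent_bounded M : exists K, forall u, 0 <= u <= M -> `|A u| <= K /\ `|B u| <= K.
Proof.
have imu : Pi.-integrable setT (EFin \o (fun y => mu2 y)).
  apply: (@levy_integrable _ 1) => // [|y].
    by apply: measurable_minr => //; exact: measurable_cst.
  by rewrite mul1r ger0_norm.
pose I0 := \int[Pi]_y mu2 y.
have I00 : 0 <= I0 by exact: Rintegral_ge0.
have bnd f c : 0 <= c -> Pi.-integrable setT (EFin \o f) ->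
    (forall y, `|f y| <= c * mu2 y) -> `|\int[Pi]_y f y| <= c * I0.
  move=> c0 fi fc; apply: le_trans (le_normr_Rintegral _ fi) _ => //.
  rewrite -RintegralZl//; apply: le_Rintegral => //.
    have := integrable_abse fi; apply: eq_integrable => // y _ /=.
  apply: (@levy_integrable _ c) => // [|y].
    apply: measurable_funM; first exact: measurable_cst.
    by apply: measurable_minr => //; exact: measurable_cst.
  by rewrite ger0_norm// mulr_ge0.
exists (M * `|vdot z gamma| + (2 + M ^+ 2) * I0) => u /andP[u0 uM].
have M0 : 0 <= M by exact: le_trans uM.
have uM2 : u ^+ 2 <= M ^+ 2 by rewrite ler_sqr.
have h2 : (2 + u ^+ 2) * I0 <= (2 + M ^+ 2) * I0 by rewrite ler_wpM2r// lerD2l.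
have h3 : 0 <= M * `|vdot z gamma| by rewrite mulr_ge0.
split.
- rewrite AE; apply: (@le_trans _ _ ((2 + u ^+ 2) * I0)); last by lra.
  apply: bnd => // [|y]; first by rewrite addr_ge0 ?sqr_ge0.
  rewrite ler0_norm ?subr_le0 ?cos_le1// opprB.
  have [y1|y1] := leP (vnorm y) 1.
    rewrite mu2_le1//; have := cos_ge_quadratic (u * v y); rewrite exprMn.
    have := ler_wpM2l (sqr_ge0 u) (vn2 y); have := sqr_ge0 (vnorm y).
    have := mulr_ge0 (sqr_ge0 u) (sqr_ge0 (vnorm y)); lra.
  by rewrite mu2_gt1// mulr1; have := cos_geN1 (u * v y); have := sqr_ge0 u; lra.
- rewrite BE; apply: le_trans (ler_normD _ _) _; apply: lerD.
    by rewrite normrM (ger0_norm u0) ler_wpM2r.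
  apply: (@le_trans _ _ ((2 + u ^+ 2) * I0)) => //.
  apply: bnd => // [|y]; first by rewrite addr_ge0 ?sqr_ge0.
  case: ifPn => [y1|].
    rewrite mulr1 mu2_le1//; apply: le_trans (sin_sub_id_le_sqr _) _.
    rewrite exprMn; have := ler_wpM2l (sqr_ge0 u) (vn2 y); have := sqr_ge0 (vnorm y); lra.
  rewrite -ltNge mulr0 subr0 => y1; rewrite mu2_gt1// mulr1.
  by have := sin_max (u * v y); have := sqr_ge0 u; lra.
Qed.

Variables (b delta : R).
Hypotheses (b01 : 0 < b <= 1) (delta01 : 0 < delta <= 1).
Let a := delta * b.
Let b0 : 0 < b. Proof. by case/andP: b01. Qed.
Let del0 : 0 < delta. Proof. by case/andP: delta01. Qed.
Let a0 : 0 < a. Proof. by rewrite mulr_gt0. Qed.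
Let di4 : 1 <= delta^-1 ^+ 4.
Proof. by rewrite exprn_ege1// invf_ge1//; case/andP: delta01. Qed.

(** The left side is the integral of [(1 - cos p) ^ 2] with [p = u * <z, y>], which is at most 4 and
    at most [p ^ 4 / 4]. For [u <= 1 / a] one has [|p| <= |y| / (delta * b)], whence the power of
    [delta^-1]. *)
Lemma levy_exponent_quartic u : 0 <= u <= 1 / a ->
  A (2 * u) / 2 - 2 * A u <= 4 * (delta^-1 ^+ 4 * jump4 b).
Proof.
move=> /andP[u0 ua]; rewrite !AE.
have iZ c f : Pi.-integrable setT (EFin \o f) -> Pi.-integrable setT (EFin \o (fun y => c * f y)).
  by move=> fi; have := integrableZl measurableT c fi; apply: eq_integrable.
have ij := integrable_jump4 b0.
rewrite (_ : _ / 2 = 1 / 2 * \int[Pi]_y (cos (2 * u * v y) - 1)); last by rewrite mulrC div1r.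
rewrite -!RintegralZl//; last exact: iZ.
rewrite -RintegralB//; try exact: iZ.
apply: le_Rintegral => //.
- by have := integrableB measurableT (iZ (1 / 2) _ (icos (2 * u))) (iZ 2 _ (icos u)); apply: eq_integrable.
- exact: (iZ _ _ (iZ _ _ ij)).
move=> y _; set p := u * v y.
have -> : 2 * u * v y = p *+ 2 by rewrite -mulr_natl /p; ring.
rewrite cos_mulr2n mulr2n.
have -> : 1 / 2 * (cos p ^+ 2 + cos p ^+ 2 - 1 - 1) - 2 * (cos p - 1) = (1 - cos p) ^+ 2 by field.
have c0 : 0 <= 1 - cos p by rewrite subr_ge0 cos_le1.
have h1 : (1 - cos p) ^+ 2 <= 2 ^+ 2.
  by rewrite ler_sqr ?nnegrE//; have := cos_geN1 p; lra.
have h2 : (1 - cos p) ^+ 2 <= (p ^+ 2 / 2) ^+ 2.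
  by rewrite ler_sqr ?nnegrE ?divr_ge0 ?sqr_ge0//; have := cos_ge_quadratic p; lra.
have pn : `|p| <= delta^-1 * (vnorm y / b).
  rewrite normrM (ger0_norm u0).
  apply: le_trans (ler_pM u0 (normr_ge0 _) ua (vn y)) _.
  by rewrite /a le_eqVlt; apply/orP; left; apply/eqP; field; rewrite !gt_eqF.
have p4 : p ^+ 4 <= delta^-1 ^+ 4 * (vnorm y / b) ^+ 4.
  rewrite -exprMn -[p ^+ 4]ger0_norm ?exprn_even_ge0// normrX lerXn2r ?nnegrE//.
  by rewrite mulr_ge0 ?divr_ge0 ?invr_ge0 ?(ltW b0) ?(ltW del0).
have [_|_] := leP 1 ((vnorm y / b) ^+ 4); first by have := di4; lra.
have p40 : 0 <= p ^+ 4 by rewrite exprn_even_ge0.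
have h3 : (p ^+ 2 / 2) ^+ 2 = p ^+ 4 / 4 by field.
by lra.
Qed.

(** The function [a ^ 2 * (1 - cos (v / a))] is at most [v ^ 2 / 2], used for [|y| <= b], and at
    most [2 * a ^ 2], used beyond [b], where the integrand of [jump4] is 1. The factor [1 / 2] of
    the variance is kept intact. *)
Lemma levy_exponent_variance :
  - (a ^+ 2 * A (1 / a)) <= trunc_dot2 b z / 2 + 2 * a ^+ 2 * jump4 b.
Proof.
rewrite AE mulrC -mulNr (_ : - _ = -1 * \int[Pi]_y (cos (1 / a * v y) - 1)); last by rewrite mulN1r.
rewrite mulrC mulrA mulrN1 (_ : _ / 2 = 1 / 2 * trunc_dot2 b z); last by rewrite mulrC div1r.
have iZ c f : Pi.-integrable setT (EFin \o f) -> Pi.-integrable setT (EFin \o (fun y => c * f y)).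
  by move=> fi; have := integrableZl measurableT c fi; apply: eq_integrable.
have ij := integrable_jump4 b0.
have it := integrable_trunc_dot2 b z1.
rewrite -!RintegralZl// -RintegralD//; try exact: iZ.
apply: le_Rintegral => //.
- exact: iZ.
- by have := integrableD measurableT (iZ (1 / 2) _ it) (iZ (2 * a ^+ 2) _ ij); apply: eq_integrable.
move=> y _.
have a2 : 0 <= a ^+ 2 by exact: sqr_ge0.
have m0 : 0 <= a ^+ 2 * Num.min 1 ((vnorm y / b) ^+ 4).
  by rewrite mulr_ge0// le_min ler01 exprn_even_ge0.
case: ifPn => [yb|].
  have := ler_wpM2l a2 (cos_ge_quadratic (1 / a * v y)).
  rewrite (_ : a ^+ 2 * (1 - (1 / a * v y) ^+ 2 / 2) = a ^+ 2 - v y ^+ 2 / 2).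
    by rewrite /v; lra.
  by field; rewrite gt_eqF.
rewrite -ltNge => yb; rewrite min_l; last first.
  by rewrite exprn_ege1// ler_pdivlMr// mul1r ltW.
have := ler_wpM2l a2 (cos_geN1 (1 / a * v y)); lra.
Qed.

(** The Levy-Khintchine compensator is cut at 1 and the sine acts at scale [a]; the mismatch is a
    drift. Its integrand is at most [v ^ 2 / a] for [|y| <= b], at most [2 |v|] between [b] and 1,
    and at most [a] beyond 1. *)
Lemma levy_exponent_mean :
  a * B (1 / a) <= vnorm gamma + (trunc2 b / a + 2 * mid1 b + a * big0).
Proof.
rewrite BE div1r mulrDr mulrA divff ?gt_eqF// mul1r; apply: lerD.
  apply: le_trans (ler_norm _) _; apply: le_trans (abs_vdot_le _ _) _.
  by rewrite ler_piMl// vnorm_ge0.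
have iZ c f : Pi.-integrable setT (EFin \o f) -> Pi.-integrable setT (EFin \o (fun y => c * f y)).
  by move=> fi; have := integrableZl measurableT c fi; apply: eq_integrable.
have iD f g : Pi.-integrable setT (EFin \o f) -> Pi.-integrable setT (EFin \o g) ->
    Pi.-integrable setT (EFin \o (fun y => f y + g y)).
  by move=> fi gi; have := integrableD measurableT fi gi; apply: eq_integrable.
have i2 := integrable_trunc2 b.
have im := integrable_mid1 b0.
have ib := integrable_big0.
rewrite (mulrC (trunc2 b)) -!RintegralZl// -!RintegralD//; try exact: iZ; last first.
  by apply: iD; exact: iZ.
apply: le_Rintegral => //.
- exact: iZ.
- by apply: (iD); [apply: (iD)|]; exact: iZ.
move=> y _; apply: le_trans (ler_norm _) _.
have -> : a * (sin (a^-1 * v y) - a^-1 * v y * (if vnorm y <= 1 then 1 else 0)) =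
    a * sin (a^-1 * v y) - v y * (if vnorm y <= 1 then 1 else 0).
  by rewrite mulrBr; congr (_ - _); rewrite !mulrA divff ?gt_eqF// mul1r.
have as1 : `|a * sin (a^-1 * v y)| <= a.
  by rewrite normrM (gtr0_norm a0) ler_piMr ?(ltW a0)// sin_max.
have asv : `|a * sin (a^-1 * v y)| <= `|v y|.
  rewrite normrM (gtr0_norm a0); have := ler_wpM2l (ltW a0) (abs_sin_le (a^-1 * v y)).
  by rewrite normrM normfV (gtr0_norm a0) mulrA mulfV ?gt_eqF// mul1r.
have b1 : b <= 1 by case/andP: b01.
have [yb|yb] := leP (vnorm y) b.
  rewrite (le_trans yb b1) ltNge (le_trans yb b1)/= !mulr0 !addr0 mulr1.
  have -> : a * sin (a^-1 * v y) - v y = a * (sin (a^-1 * v y) - a^-1 * v y).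
    by rewrite mulrBr; congr (_ - _); rewrite !mulrA divff ?gt_eqF// mul1r.
  rewrite normrM (gtr0_norm a0).
  apply: le_trans (ler_wpM2l (ltW a0) (sin_sub_id_le_sqr _)) _.
  rewrite (_ : a * (a^-1 * v y) ^+ 2 = a^-1 * v y ^+ 2); last by field; rewrite gt_eqF.
  by rewrite ler_wpM2l// invr_ge0 ltW.
have [y1|y1] := leP (vnorm y) 1; rewrite /= !mulr0 !mulr1 ?add0r ?addr0 ?subr0 ?add0r//.
apply: le_trans (ler_normB _ _) _.
by have := vn y; lra.
Qed.
End direction.
End levy_measure.

(** * Tail bound for a projection at the scale [b] *)

Section levy_tail.
Context {R : realType} {d : nat} {d0 : measure_display} {T : measurableType d0}.
Variables (P : probability T R) (X : R -> T -> d.-tuple R).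
Variables (gamma : d.-tuple R) (Pi : {measure set (d.-tuple R) -> \bar R}).
Hypothesis LX : levy_process P X gamma 0 Pi.

Lemma jump4_ge0 b : 0 <= jump4 Pi b.
Proof. by apply: Rintegral_ge0 => y _; rewrite le_min ler01 exprn_even_ge0. Qed.

Lemma trunc2_ge0 b : 0 <= trunc2 Pi b.
Proof. by apply: Rintegral_ge0 => y _; case: ifP => // _; exact: sqr_ge0. Qed.

Lemma mid1_ge0 b : 0 <= mid1 Pi b.
Proof. by apply: Rintegral_ge0 => y _; case: ifP => // _; exact: vnorm_ge0. Qed.

Lemma big0_ge0 : 0 <= big0 Pi.
Proof. by apply: Rintegral_ge0 => y _; case: ifP. Qed.

(* The bound is of Fuk-Nagaev type: [th] may still be chosen, and the jumps of
   size between a small multiple of [b] and [b] only enter through [q]. *)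
Lemma levy_tail (e delta : R) : 0 < e <= 1 -> 0 < delta <= 1 ->
  exists2 C, 0 < C & forall (z : d.-tuple R) (t b q v eta : R), vnorm z <= 1 ->
    0 < t -> 0 < b <= 1 ->
    t * jump4 Pi b <= q -> t * trunc_dot2 Pi b z <= v * b ^+ 2 ->
    t * (vnorm gamma + (trunc2 Pi b / (delta * b) + 2 * mid1 Pi b +
         delta * b * big0 Pi)) <= eta * b ->
    forall s th x : R, 0 < s <= t -> 0 <= th ->
    (P [set w | x * b < vdot z (X s w)]%R <=
     (C * q + expR (- (th * x) + th * eta + (1 + e) * th ^+ 2 * v / 2 +
                    C * (expR (delta * th) * q)))%:E)%E.
Proof.
move=> e01 del01; have [e0 e1] := andP e01; have [del0 del1] := andP del01.
have [C1 C10 Hdom] := expR_trunc_le e01.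
have D0 : 0 < delta^-1 ^+ 4 by rewrite exprn_gt0// invr_gt0.
(* [180 * delta^-1 ^+ 4] covers the large increments, its product with [C1] the quartic remainder of
   the truncated exponential, and 16 the [jump4] part of the variance, through [(delta * th) ^ 2 <=
   4 * expR (delta * th)]. *)
exists (180 * (delta^-1 ^+ 4 * (1 + C1)) + 16).
  apply: addr_gt0 => //; apply: mulr_gt0 => //; apply: mulr_gt0 => //; lra.
move=> z t b q v eta z1 t0 b01 hq hv heta s th x /andP[s0 st] th0.
have [b0 b1] := andP b01.
have HPi : is_levy_measure Pi by have [[_ [_ ?]] _] := LX.
have LY := real_levy_projection LX z.
pose A u := LK_re 0 Pi (vscale u z); pose B u := LK_im gamma Pi (vscale u z).
pose a := delta * b.
have a0 : 0 < a by rewrite mulr_gt0.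
have [K HK] := levy_exponent_bounded HPi gamma z1 (2 / a).
have AK u : 0 <= u <= 2 / a -> `|A u| <= K by move=> /HK[].
have BK u : 0 <= u <= 2 / a -> `|B u| <= K by move=> /HK[].
have Aq := levy_exponent_quartic HPi z1 b01 del01.
have thd0 : 0 <= delta * th by rewrite mulr_ge0// ltW.
(* The truncation level is [a = delta * b], so the exponent [delta * th] relative to [a] is [th]
   relative to [b]. *)
have H := tail_bound LY a0 AK BK Aq (ltW e0) (ltW C10) thd0
  (fun v => Hdom (delta * th) v thd0) (x * b) s0.
apply: (le_trans H); rewrite lee_fin.
have j0 := jump4_ge0 b.
have sq : s * jump4 Pi b <= q by apply: le_trans hq; rewrite ler_wpM2r.
have q0 : 0 <= q by apply: le_trans sq; rewrite mulr_ge0// ltW.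
have E0 := expR_ge0 (delta * th).
have h1 : 180 * s * (delta^-1 ^+ 4 * jump4 Pi b) <= 180 * delta^-1 ^+ 4 * q.
  by rewrite (_ : 180 * s * _ = 180 * delta^-1 ^+ 4 * (s * jump4 Pi b)); [rewrite ler_wpM2l// mulr_ge0// ltW|ring].
have DC : 0 <= delta^-1 ^+ 4 * C1 * q by apply: mulr_ge0 => //; apply: mulr_ge0; exact: ltW.
apply: lerD; first by lra.
rewrite ler_expR.
have -> : - (delta * th * (x * b) / a) = - (th * x).
  by rewrite /a; field; rewrite !gt_eqF.
have sD p1 p2 p3 : s * (p1 - p2 + p3) = s * p1 + s * - p2 + s * p3 by ring.
rewrite sD.
have hm : s * (delta * th * B (1 / a)) <= th * eta.
  have -> : s * (delta * th * B (1 / a)) = th * (s * (a * B (1 / a)) / b).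
    by rewrite /a; field; rewrite gt_eqF.
  rewrite ler_wpM2l// ler_pdivrMr//.
  have := levy_exponent_mean HPi gamma z1 b01 del01; rewrite -/a -/B => hB.
  apply: (le_trans (ler_wpM2l (ltW s0) hB)).
  apply: le_trans heta; rewrite ler_wpM2r//.
  apply: addr_ge0; first exact: vnorm_ge0.
  apply: addr_ge0; last by apply: mulr_ge0; [exact: ltW|exact: big0_ge0].
  apply: addr_ge0; last by apply: mulr_ge0 => //; exact: mid1_ge0.
  by apply: divr_ge0; [exact: trunc2_ge0|exact: ltW].
have hv1 : s * - ((1 + e) * (delta * th) ^+ 2 * A (1 / a)) <=
    (1 + e) * th ^+ 2 * v / 2 + 16 * (expR (delta * th) * q).
  have -> : s * - ((1 + e) * (delta * th) ^+ 2 * A (1 / a)) =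
     (1 + e) * th ^+ 2 / b ^+ 2 * (s * - (a ^+ 2 * A (1 / a))).
    by rewrite /a; field; rewrite gt_eqF.
  have := levy_exponent_variance HPi z1 b01 del01; rewrite -/a -/A => hV.
  have := ler_wpM2l (ltW s0) hV; rewrite -/A => {}hV.
  have c0 : 0 <= (1 + e) * th ^+ 2 / b ^+ 2.
    by rewrite divr_ge0 ?sqr_ge0// mulr_ge0 ?sqr_ge0// addr_ge0 ?(ltW e0).
  apply: (le_trans (ler_wpM2l c0 hV)).
  have d20 : 0 <= trunc_dot2 Pi b z.
    by apply: Rintegral_ge0 => y _; case: ifP => // _; exact: sqr_ge0.
  have h2 : s * trunc_dot2 Pi b z <= v * b ^+ 2.
    by apply: le_trans hv; rewrite ler_wpM2r.
  have h3 : s * (trunc_dot2 Pi b z / 2 + 2 * a ^+ 2 * jump4 Pi b) <=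
     b ^+ 2 * (v / 2 + 2 * delta ^+ 2 * q).
    have : a ^+ 2 * (s * jump4 Pi b) <= a ^+ 2 * q by rewrite ler_wpM2l ?sqr_ge0.
    rewrite /a exprMn; lra.
  apply: (le_trans (ler_wpM2l c0 h3)).
  rewrite (_ : _ / b ^+ 2 * _ = (1 + e) * th ^+ 2 * v / 2 +
    2 * (1 + e) * ((delta * th) ^+ 2 * q)); last by field; rewrite gt_eqF.
  rewrite lerD2l.
  have h4 : (delta * th) ^+ 2 * q <= 4 * expR (delta * th) * q.
    by rewrite ler_wpM2r// sqr_le_expR.
  have h5 : 0 <= (delta * th) ^+ 2 * q by rewrite mulr_ge0 ?sqr_ge0.
  have : e * ((delta * th) ^+ 2 * q) <= 1 * ((delta * th) ^+ 2 * q) by rewrite ler_wpM2r.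
  lra.
have hc : s * (180 * C1 * expR (delta * th) * (delta^-1 ^+ 4 * jump4 Pi b)) <=
    180 * delta^-1 ^+ 4 * C1 * (expR (delta * th) * q).
  rewrite (_ : s * _ = 180 * delta^-1 ^+ 4 * C1 * (expR (delta * th) * (s * jump4 Pi b))); last by ring.
  apply: ler_wpM2l; last exact: ler_wpM2l.
  by apply: mulr_ge0; [apply: mulr_ge0 => //|]; exact: ltW.
have hd : 0 <= delta^-1 ^+ 4 * (expR (delta * th) * q) by apply: mulr_ge0; [exact: ltW|exact: mulr_ge0].
rewrite -/A -/B.
move: (s * _) (s * - _) (s * _) hm hv1 hc hd => p1 p2 p3.
move: (expR (delta * th) * q) (delta^-1 ^+ 4) => p4 p5.
by move=> *; lra.
Qed.
End levy_tail.

(** * Summing over a scale, for each jump size separately *)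

Section geometric_scale.
Context {R : realType} {d : nat}.
Variable Pi : {measure set (d.-tuple R) -> \bar R}.
Hypothesis HPi : is_levy_measure Pi.
Variables (t b : nat -> R) (rho sigma M : R).
Hypotheses (t0 : forall k, 0 < t k) (b0 : forall k, 0 < b k).
Hypothesis bS : forall k, b k.+1 <= b k.
Hypotheses (rho1 : 1 < rho) (quart : forall k, rho * (t k / b k ^+ 4) <= t k.+1 / b k.+1 ^+ 4).
Hypotheses (sigma01 : 0 < sigma < 1) (lin : forall k, t k.+1 / b k.+1 <= sigma * (t k / b k)).
Hypothesis bM : forall k, b k <= M * b k.+1.
Hypothesis b_to0 : b @ \oo --> (0 : R).
Hypothesis sum_Pibar : (\sum_(0 <= k <oo) (t k)%:E * Pibar Pi (b k) < +oo)%E.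

(** A jump of size [n] contributes [hit n k] to [t k * Pibar Pi (b k)] and [quad n k] to
    [t k * jump4 Pi (b k)]. The two sums over [k] are compared for each fixed [n], and only then
    integrated against [Pi]. *)
Let hit (n : R) k : R := t k * (b k < n)%R%:R.
Let quad (n : R) k : R := t k * Num.min 1 ((n / b k) ^+ 4).
(** [c] solves [c + 1 = c * rho], which closes the induction on the geometric sum. [C] is dictated
    by the first [N] with [b N < n]: there [n] is at most the preceding level, hence at most
    [M * b N], and the sum accumulated before is at most [c * M ^ 4 * t N]. *)
Let c := (rho - 1)^-1.
Let C := c * M ^+ 4 + 1.

Let hit_ge0 n k : 0 <= hit n k. Proof. by rewrite mulr_ge0// ltW. Qed.
Let quad_ge0 n k : 0 <= quad n k.
Proof. by rewrite mulr_ge0 ?(ltW (t0 k))// le_min ler01 exprn_even_ge0. Qed.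
Let c0 : 0 < c. Proof. by rewrite invr_gt0 subr_gt0. Qed.
Let C0 : 0 < C. Proof. by rewrite ltr_wpDl// mulr_ge0 ?(ltW c0)// exprn_even_ge0. Qed.

Let b_anti j k : (j <= k)%N -> b k <= b j.
Proof.
move=> jk; rewrite -(subnKC jk); elim: (k - j)%N => [|i IH]; first by rewrite addn0.
by rewrite addnS (le_trans (bS _)).
Qed.

(* As long as [n] has not been exceeded by the truncation level, the sum of
   the quartic terms is a geometric sum dominated by its last term; from the
   first index with [b k < n] on, every term is counted by [hit]. *)
Let quad_hit n N : 0 <= n ->
  ((forall k, (k < N)%N -> n <= b k) /\
     \sum_(0 <= k < N) quad n k <= c * (t N * (n / b N) ^+ 4)) \/
  ((exists2 k, (k < N)%N & b k < n) /\
     \sum_(0 <= k < N) quad n k <= C * \sum_(0 <= k < N) hit n k).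
Proof.
move=> n0; elim: N => [|N IH].
  left; split => //; rewrite big_geq//.
  by rewrite mulr_ge0 ?(ltW c0)// mulr_ge0 ?(ltW (t0 _))// exprn_even_ge0.
have quad_le1 : quad n N <= t N by rewrite ler_piMr ?(ltW (t0 _))// ge_min lexx.
have hitN0 : 0 <= \sum_(0 <= k < N) hit n k by exact: sumr_ge0.
case: IH => [[nb SN]|[[k kN bn] SN]]; last first.
  right; split; first by exists k => //; exact: ltnW.
  rewrite !big_nat_recr//= mulrDr lerD// (le_trans quad_le1)//.
  have -> : hit n N = t N.
    by rewrite /hit (le_lt_trans _ bn) ?mulr1// b_anti// ltnW.
  by rewrite ler_peMl ?(ltW (t0 _))// lerDr mulr_ge0 ?(ltW c0)// exprn_even_ge0.
have [nbN|nbN] := leP n (b N).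
  left; split.
    by move=> k; rewrite ltnS leq_eqVlt => /predU1P[->//|/nb].
  rewrite big_nat_recr//=.
  have h1 : quad n N <= t N * (n / b N) ^+ 4.
    by rewrite ler_wpM2l ?(ltW (t0 _))// ge_min lexx orbT.
  have h2 : rho * (t N * (n / b N) ^+ 4) <= t N.+1 * (n / b N.+1) ^+ 4.
    have n4 : 0 <= n ^+ 4 by rewrite exprn_ge0.
    have := ler_wpM2l n4 (quart N).
    rewrite (_ : n ^+ 4 * (rho * (t N / b N ^+ 4)) = rho * (t N * (n / b N) ^+ 4)); last first.
      by field; rewrite gt_eqF.
    by rewrite (_ : n ^+ 4 * (t N.+1 / b N.+1 ^+ 4) = t N.+1 * (n / b N.+1) ^+ 4)//; field; rewrite gt_eqF.
  apply: le_trans (lerD SN h1) _.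
  apply: le_trans (ler_wpM2l (ltW c0) h2).
  rewrite le_eqVlt; apply/orP; left; apply/eqP.
  have rn : rho - 1 != 0 by rewrite gt_eqF// subr_gt0.
  by rewrite /c; field; rewrite ?rn ?gt_eqF.
right; split; first by exists N.
rewrite !big_nat_recr//= mulrDr.
have -> : hit n N = t N by rewrite /hit nbN mulr1.
have h1 : \sum_(0 <= k < N) quad n k <= c * M ^+ 4 * t N.
  case: N => [|N] in nb SN quad_le1 hitN0 nbN *.
    by rewrite big_geq// mulr_ge0 ?(ltW (t0 _))// mulr_ge0 ?(ltW c0)// exprn_even_ge0.
  apply: (le_trans SN); rewrite mulrCA (mulrC (c * _)) ler_wpM2l ?(ltW (t0 _))//.
  rewrite ler_wpM2l ?(ltW c0)//.
  have nM : n / b N.+1 <= M by rewrite ler_pdivrMr// (le_trans _ (bM N))// nb.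
  have nM0 : 0 <= n / b N.+1 by rewrite divr_ge0// ltW.
  by rewrite lerXn2r ?nnegrE// (le_trans nM0).
have h2 : 0 <= C * \sum_(0 <= k < N) hit n k by rewrite mulr_ge0 ?(ltW C0).
by rewrite /C in h2 *; lra.
Qed.

Let hits n : \bar R := (\sum_(0 <= k <oo) (hit n k)%:E)%E.

Let hit_le_hits n N : ((\sum_(0 <= k < N) hit n k)%:E <= hits n)%E.
Proof.
rewrite -sumEFin; apply: nneseries_lim_ge => k _ _.
by rewrite lee_fin.
Qed.

(** For [n > 0] the levels [b k] eventually fall below [n], which excludes the first alternative of
    [quad_hit] for long sums. *)
Let quads_le_hits n : 0 <= n ->
  (\sum_(0 <= k <oo) (quad n k)%:E <= C%:E * hits n)%E.
Proof.
move=> n0; have [->|nneq0] := eqVneq n 0.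
  rewrite eseries0 => [|k _ _]; last first.
    by rewrite /quad mul0r expr0n/= min_r ?ler01// mulr0.
  rewrite mule_ge0 ?lee_fin ?(ltW C0)//.
  by apply: nneseries_ge0 => k _ _; rewrite lee_fin.
have {nneq0} {}n0 : 0 < n by rewrite lt_neqAle eq_sym nneq0.
have [K _ HK] : \forall k \near \oo, b k < n.
  have /cvgrPdist_lt /(_ n n0) := b_to0.
  by apply: filterS => k; rewrite sub0r normrN gtr0_norm.
apply: lime_le; first by apply: is_cvg_nneseries => k _ _; rewrite lee_fin.
apply: nearW => N.
rewrite sumEFin.
apply: (@le_trans _ _ (\sum_(0 <= k < maxn N K.+1) quad n k)%:E).
  rewrite lee_fin [leRHS](@big_cat_nat _ _ _ N) ?leq_maxl//=.
  by rewrite lerDl; apply: sumr_ge0.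
have [[nb _]|[_ S]] := quad_hit (maxn N K.+1) (ltW n0).
  have := nb K; rewrite leq_max ltnSn orbT => /(_ isT).
  by rewrite leNgt HK//=.
apply: (@le_trans _ _ (C * \sum_(0 <= k < maxn N K.+1) hit n k)%:E).
  by rewrite lee_fin.
by rewrite EFinM lee_pmul2l ?lte_fin// hit_le_hits.
Qed.

Let mhit k : measurable_fun setT (fun y : d.-tuple R => (hit (vnorm y) k)%:E).
Proof.
apply/measurable_EFinP; apply: measurable_funM; first exact: measurable_cst.
rewrite (_ : (fun y => _) = (fun y => if b k < vnorm y then 1 else 0 : R)).
  apply: measurable_fun_ifT; try exact: measurable_cst.
  by apply: measurable_fun_ltr; [exact: measurable_cst|exact: measurable_vnorm].
by apply/funext => y; case: ifP.
Qed.

Let integral_hit k : (\int[Pi]_y (hit (vnorm y) k)%:E = (t k)%:E * Pibar Pi (b k))%E.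
Proof.
have mE : measurable [set y : d.-tuple R | b k < vnorm y].
  by apply: measurable_set_lt; exact: measurable_vnorm.
rewrite /Pibar -(setIT [set y | _]) -integral_indic//.
rewrite -ge0_integralZl//; last 2 first.
- by apply/measurable_EFinP; apply: measurable_indic.
- by rewrite lee_fin ltW.
apply: eq_integral => y _; rewrite -EFinM /hit indicE.
suff -> : (y \in [set y : d.-tuple R | b k < vnorm y]) = (b k < vnorm y) by [].
by apply/idP/idP; rewrite inE.
Qed.

Lemma integral_hits_lty : (\int[Pi]_y hits (vnorm y) < +oo)%E.
Proof.
rewrite /hits integral_nneseries//.
  by under eq_eseriesr do rewrite integral_hit.
by move=> k y _; rewrite lee_fin.
Qed.

Let mhits : measurable_fun setT (fun y : d.-tuple R => hits (vnorm y)).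
Proof. by apply: ge0_emeasurable_sum => // k y _ _; rewrite lee_fin. Qed.

Lemma jump4_summable : (\sum_(0 <= k <oo) (t k * jump4 Pi (b k))%:E < +oo)%E.
Proof.
have ij k := integrable_jump4 HPi (b0 k).
have E k : ((t k * jump4 Pi (b k))%:E = \int[Pi]_y (quad (vnorm y) k)%:E)%E.
  rewrite EFinM /jump4 /Rintegral fineK; last exact: (integrable_fin_num _ (ij k)).
  rewrite -ge0_integralZl//.
  - by have /integrableP[] := ij k.
  - by move=> y _; rewrite lee_fin le_min ler01 exprn_even_ge0.
  - by rewrite lee_fin ltW.
have mq k : measurable_fun setT (fun y : d.-tuple R => (quad (vnorm y) k)%:E).
  apply/measurable_EFinP; apply: measurable_funM; first exact: measurable_cst.
  by have /integrableP[/measurable_EFinP] := ij k.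
under eq_eseriesr do rewrite E.
rewrite -integral_nneseries//; last by move=> k y _; rewrite lee_fin.
apply: (@le_lt_trans _ _ (\int[Pi]_y (C%:E * hits (vnorm y)))%E).
  apply: ge0_le_integral => //.
  - by move=> y _; apply: nneseries_ge0 => k _ _; rewrite lee_fin.
  - by apply: ge0_emeasurable_sum => // k y _ _; rewrite lee_fin.
  - exact: measurable_funeM.
  - by move=> y _; apply: quads_le_hits; exact: vnorm_ge0.
rewrite ge0_integralZl//; last 2 first.
- by move=> y _; apply: nneseries_ge0 => k _ _; rewrite lee_fin.
- by rewrite lee_fin ltW.
by rewrite lte_mul_pinfty ?lee_fin ?(ltW C0)//; exact: integral_hits_lty.
Qed.

Lemma scale_ratio_cvg0 : t k / b k @[k --> \oo] --> (0 : R).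
Proof.
have [s0 s1] := andP sigma01.
have H k : t k / b k <= geometric (t 0%N / b 0%N) sigma k.
  elim: k => [|k IH]; first by rewrite /= expr0 mulr1.
  apply: le_trans (lin k) _.
  have -> : geometric (t 0%N / b 0%N) sigma k.+1 =
      sigma * geometric (t 0%N / b 0%N) sigma k by rewrite /= exprS; ring.
  by rewrite ler_wpM2l// ltW.
apply: (@squeeze_cvgr _ _ _ _ (cst 0) (geometric (t 0%N / b 0%N) sigma)).
- by apply: nearW => k; rewrite H divr_ge0// ltW.
- exact: cvg_cst.
- by apply: cvg_geometric; rewrite ger0_norm// ltW.
Qed.

(** Take the first [j] with [b j < n]; from there on [t / b] decreases. If [j] has a predecessor,
    its level is at least [n], so [n <= M * b j] and the product is at most [M * t j]. If [j = 0],
    use [n <= 1]. Hence the two terms of the constant. *)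
Let mid_hit n k : b k < n <= 1 ->
  exists2 j, (j <= k)%N & b j < n /\ t k / b k * n <= (`|M| + (b 0%N)^-1) * t j.
Proof.
have bi0 : 0 <= (b 0%N)^-1 by rewrite invr_ge0 ltW.
have [s0 s1] := andP sigma01.
move=> /andP[+ n1]; elim: k => [bn|k IH bn].
  exists 0%N => //; split => //.
  apply: (@le_trans _ _ (t 0%N / b 0%N)).
    by rewrite ler_piMr// divr_ge0// ltW.
  by rewrite mulrC ler_wpM2r ?(ltW (t0 _))// lerDr.
have n0 : 0 <= n by apply: le_trans (ltW bn); exact: ltW.
have [bkn|bkn] := ltP (b k) n.
  have [j jk [bj H]] := IH bkn; exists j; first exact: leqW.
  split => //; apply: le_trans H; rewrite ler_wpM2r//.
  apply: le_trans (lin k) _; rewrite ler_piMl ?(ltW s1)//.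
  by rewrite divr_ge0// ltW.
exists k.+1 => //; split => //.
rewrite mulrAC -mulrA mulrC ler_wpM2r ?(ltW (t0 _))//.
rewrite ler_pdivrMr// (le_trans bkn)// (le_trans (bM k))// ler_wpM2r ?(ltW (b0 _))//.
by apply: le_trans (ler_norm M) _; rewrite lerDl.
Qed.

(** Dominated convergence: at each [y] the integrand is at most [t k / b k * |y|], which tends to 0,
    and [mid_hit] bounds it for all [k] by a multiple of [hits], which is integrable by the
    hypothesis on [Pibar]. *)
Lemma mid1_cvg0 : t k / b k * mid1 Pi (b k) @[k --> \oo] --> (0 : R).
Proof.
pose D := `|M| + (b 0%N)^-1.
have D0 : 0 <= D by rewrite addr_ge0// invr_ge0 ltW.
pose f k (y : d.-tuple R) : \bar R :=
  (t k / b k * (if b k < vnorm y <= 1 then vnorm y else 0))%:E.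
have im k := integrable_mid1 HPi (b0 k).
have mf k : measurable_fun setT (f k).
  apply/measurable_EFinP; apply: measurable_funM; first exact: measurable_cst.
  by have /integrableP[/measurable_EFinP] := im k.
have ig : Pi.-integrable setT (fun y => D%:E * hits (vnorm y))%E.
  apply: integrableZl => //; apply/integrableP; split => //.
  under eq_integral => y _.
    rewrite gee0_abs; last by apply: nneseries_ge0 => k _ _; rewrite lee_fin.
    over.
  exact: integral_hits_lty.
have [_ _ H] : [/\ Pi.-integrable setT (cst 0%E : d.-tuple R -> \bar R),
  [sequence \int[Pi]_y `|f k y - 0|]_k @ \oo --> 0 &
  [sequence \int[Pi]_y f k y]_k @ \oo --> \int[Pi]_y (cst 0 y)]%E.
  apply: (@dominated_convergence _ _ _ Pi setT measurableT f (cst 0%E) (fun y => D%:E * hits (vnorm y))%E) => //.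
  - apply: aeW => y _.
    rewrite /f; apply: cvg_EFin; first exact: nearW.
    have H : t k / b k * vnorm y @[k --> \oo] --> 0.
      rewrite -[X in _ --> X](mul0r (vnorm y)); apply: cvgM; last exact: cvg_cst.
      exact: scale_ratio_cvg0.
    apply: (@squeeze_cvgr _ _ _ _ (cst 0) (fun k => t k / b k * vnorm y)) => //; last exact: cvg_cst.
    apply: nearW => k /=.
    have tb : 0 <= t k / b k by rewrite divr_ge0// ltW.
    by case: ifP => _; rewrite ?mulr0 ?lexx mulr_ge0 ?vnorm_ge0.
  - apply: aeW => y k _; rewrite /f.
    have tb : 0 <= t k / b k by rewrite divr_ge0// ltW.
    have h0 : (0 <= D%:E * hits (vnorm y))%E.
      by rewrite mule_ge0// nneseries_ge0// => j _ _; rewrite lee_fin.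
    case: ifPn => [yb|_]; last by rewrite mulr0 abse0.
    rewrite gee0_abs; last by rewrite lee_fin mulr_ge0// vnorm_ge0.
    have [j jk [bj H]] := mid_hit yb.
    apply: (@le_trans _ _ (D * \sum_(0 <= i < j.+1) hit (vnorm y) i)%:E).
      rewrite lee_fin (le_trans H)// ler_wpM2l// big_nat_recr//=.
      rewrite {2}/hit bj mulr1 lerDr.
      by apply: sumr_ge0.
    by rewrite EFinM lee_wpmul2l.
have E k : (\int[Pi]_y f k y = (t k / b k * mid1 Pi (b k))%:E)%E.
  rewrite /mid1 -RintegralZl// /Rintegral fineK//.
  apply: integrable_fin_num => //.
  by have := integrableZl measurableT (t k / b k) (im k); apply: eq_integrable.
move: H; rewrite integral0.
under eq_fun do rewrite E.
by move=> /fine_cvgP[].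
Qed.
End geometric_scale.

(** * Geometric scales *)

(* No measurability is needed: the integral of a nonnegative function is the
   supremum of the integrals of the simple functions below it. *)
Lemma ge0_le_integral_nomeas {R : realType} d (T : measurableType d)
  (mu : {measure set T -> \bar R}) (D : set T) (f g : T -> \bar R) :
  (forall x, D x -> 0 <= f x)%E -> (forall x, D x -> f x <= g x)%E ->
  (\int[mu]_(x in D) f x <= \int[mu]_(x in D) g x)%E.
Proof.
move=> f0 fg; rewrite !ge0_integralE//; last first.
  by move=> x Dx; apply: le_trans (fg x Dx); exact: f0.
apply: le_ereal_sup => _ [h hf <-]; exists h => // x.
by apply: le_trans (hf x) _; rewrite !patchE; case: ifPn => // /set_mem /fg.
Qed.

Section scale_function.
Context {R : realType}.
Implicit Types s t x : R.

Definition loglog t : R := ln (ln t^-1).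

Lemma ln_le_subr1 x : 0 < x -> ln x <= x - 1.
Proof.
move=> x0; have := expR_ge1Dx (ln x); rewrite lnK ?posrE//; lra.
Qed.

(** Below this threshold [ln (1 / t) >= e], hence [loglog t >= 1]. *)
Definition t_small : R := expR (- expR 1).

Lemma lnV_small t : 0 < t <= t_small -> expR 1 <= ln t^-1.
Proof.
move=> /andP[t0 ts]; rewrite lnV ?posrE// lerNr -(expRK (- expR 1)).
by rewrite ler_ln ?posrE ?expR_gt0.
Qed.

Lemma loglog_ge1 t : 0 < t <= t_small -> 1 <= loglog t.
Proof.
move=> ts; rewrite -(expRK 1) /loglog ler_ln ?posrE ?expR_gt0 ?lnV_small//.
by apply: lt_le_trans (lnV_small ts); exact: expR_gt0.
Qed.

(** By [ln x <= x - 1], used twice, [loglog s - loglog t <= ln (t / s) / ln (1 / t) <= t / s - 1],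
    and the last term is at most [(t / s - 1) * loglog t] because [loglog t >= 1]. *)
Lemma mul_loglog_le s t : 0 < s -> s <= t -> t <= t_small ->
  s * loglog s <= t * loglog t.
Proof.
move=> s0 st ts; have t0 : 0 < t by apply: lt_le_trans st.
have tt : 0 < t <= t_small by rewrite t0.
have ss : 0 < s <= t_small by rewrite s0 (le_trans st).
have l1 := loglog_ge1 tt.
have lt1 : 1 <= ln t^-1.
  by apply: le_trans (lnV_small tt); have := expR_ge1Dx (1 : R); lra.
have lt0 : 0 < ln t^-1 by apply: lt_le_trans lt1.
have ls0 : 0 < ln s^-1 by apply: lt_le_trans (lnV_small ss); exact: expR_gt0.
have h1 : loglog s - loglog t <= ln s^-1 / ln t^-1 - 1.
  rewrite /loglog -ln_div ?posrE//; apply: ln_le_subr1; exact: divr_gt0.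
have h2 : ln s^-1 / ln t^-1 - 1 <= t / s - 1.
  have -> : ln s^-1 / ln t^-1 - 1 = ln (t / s) / ln t^-1.
    have -> : ln (t / s) = ln s^-1 - ln t^-1.
      by rewrite ln_div ?posrE// !lnV ?posrE// opprK addrC.
    by field; rewrite gt_eqF.
  have h3 : ln (t / s) <= t / s - 1 by apply: ln_le_subr1; exact: divr_gt0.
  rewrite ler_pdivrMr// (le_trans h3)// ler_peMr// subr_ge0 ler_pdivlMr// mul1r //.
have h4 : t / s - 1 <= (t / s - 1) * loglog t.
  by rewrite ler_peMr// subr_ge0 ler_pdivlMr// mul1r.
have h5 : loglog s <= t / s * loglog t by lra.
by have := ler_wpM2l (ltW s0) h5; rewrite mulrA mulrCA divff ?mulr1// gt_eqF.
Qed.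

Section bfun.
Variables (h : R -> R) (t0 : R).
Hypothesis Hh : in_H1 h.
Hypothesis t00 : 0 < t0.
Hypothesis hpos : forall t, 0 < t <= t0 -> 0 < h t^-1.

Let hmono x y : 0 <= x -> x <= y -> h x <= h y.
Proof. by case: Hh => _ [H _]; exact: H. Qed.

Lemma bfun_gt0 t : 0 < t <= t0 -> t <= t_small -> 0 < bfun h t.
Proof.
move=> tt ts; rewrite /bfun divr_gt0 ?hpos// sqrtr_gt0 mulr_gt0//; case/andP: tt => // t1 _.
by apply: lt_le_trans (loglog_ge1 _); rewrite ?t1.
Qed.

Lemma bfun_le s t : 0 < s -> s <= t -> t <= t0 -> t <= t_small ->
  bfun h s <= bfun h t.
Proof.
move=> s0 st tt0 ts; have tt : 0 < t by apply: lt_le_trans st.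
rewrite /bfun ler_pM ?sqrtr_ge0//.
- by rewrite invr_ge0 ltW// hpos// s0 (le_trans st).
- by rewrite ler_wsqrtr// mul_loglog_le.
- rewrite lef_pV2 ?posrE ?hpos ?tt ?s0 ?(le_trans st)//.
  by apply: hmono; rewrite ?invr_ge0 ?(ltW tt)// lef_pV2.
Qed.

Section geometric.
Variable w : R.
Hypothesis w1 : 1 < w.
Let r := w^-1 ^+ 2.
Let w0 : 0 < w. Proof. by apply: lt_trans w1. Qed.
Let tg k := r ^+ k.
Let r0 : 0 < r. Proof. by rewrite exprn_gt0// invr_gt0. Qed.
Let r1 : r < 1. Proof. by rewrite exprn_ilt1// ?invr_ge0 ?(ltW w0)// invf_lt1. Qed.
Let tg0 k : 0 < tg k. Proof. by rewrite exprn_gt0. Qed.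

Lemma geometric_to0 : tg @ \oo --> (0 : R).
Proof. by apply: cvg_expr; rewrite ger0_norm// ltW. Qed.

Let tg_small (x : R) : 0 < x -> \forall k \near \oo, tg k <= x.
Proof.
move=> x0; move/cvgr0Pnorm_lt: geometric_to0 => /(_ x x0); apply: filterS => k.
by rewrite gtr0_norm// => /ltW.
Qed.

(** The factor [sqrt t] contributes exactly [w]. The ratio of the values of [h] tends to 1 by slow
    variation at the constant [r^-1], and the ratio of the values of [loglog] because [ln (1 / t)]
    is linear in [k]. *)
Lemma bfun_ratio_cvg : bfun h (tg k) / bfun h (tg k.+1) @[k --> \oo] --> w.
Proof.
have hr : h (tg k.+1)^-1 / h (tg k)^-1 @[k --> \oo] --> (1 : R).
  have [_ [_ [_ sv]]] := Hh.
  have := sv r^-1; rewrite invr_gt0 => /(_ r0) Hsv.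
  have tV : (tg k)^-1 @[k --> \oo] --> +oo.
    by apply/(cvgrVy (f := tg)); [exact: nearW|exact: geometric_to0].
  have := cvg_comp _ _ tV Hsv; apply: cvg_trans.
  apply: near_eq_cvg; apply: nearW => k /=.
  by rewrite /tg exprS (_ : (r * r ^+ k)^-1 = r^-1 * (r ^+ k)^-1) ?invfM.
have lr : loglog (tg k) / loglog (tg k.+1) @[k --> \oo] --> (1 : R).
  have lnt k : ln (tg k)^-1 = k%:R * ln r^-1.
    by rewrite /tg -exprVn lnXn ?invr_gt0// mulr_natl.
  have lr0 : 0 < ln r^-1 by rewrite ln_gt0// invf_gt1.
  apply: (@squeeze_cvgr _ _ _ _ (fun k => 1 - 2 * harmonic k) (cst 1)); last 2 first.
  - rewrite -[X in _ --> X](subr0 1) -(mulr0 2); apply: cvgB; first exact: cvg_cst.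
    by apply: cvgM; [exact: cvg_cst|exact: cvg_harmonic].
  - exact: cvg_cst.
  have ts0 : 0 < t_small by exact: expR_gt0.
  near=> k.
  have k0 : (0 < k)%N by near: k; exact: nbhs_infty_gt.
  have kR : 0 < k%:R :> R by rewrite ltr0n.
  have kt : 0 < tg k <= t_small by rewrite tg0/=; near: k; exact: tg_small.
  have tS : tg k.+1 <= tg k by rewrite /tg exprS ler_piMl ?(ltW r1)// ltW.
  have kt' : 0 < tg k.+1 <= t_small.
    by rewrite tg0/= (le_trans tS)//; case/andP: kt.
  have l1 := loglog_ge1 kt; have l1' := loglog_ge1 kt'.
  have l0' : 0 < loglog (tg k.+1) by apply: lt_le_trans l1'.
  have lnk0 : 0 < k%:R * ln r^-1 by rewrite mulr_gt0.
  have lnk0' : 0 < k.+1%:R * ln r^-1 by rewrite mulr_gt0// ltr0n.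
  apply/andP; split; last first.
    rewrite ler_pdivrMr// mul1r /loglog !lnt ler_ln ?posrE//.
    by rewrite ler_wpM2r ?(ltW lr0)// ler_nat.
  have dl : loglog (tg k.+1) - loglog (tg k) <= k%:R^-1.
    rewrite /loglog !lnt -ln_div ?posrE//.
    apply: le_trans (ln_le_subr1 _) _; first exact: divr_gt0.
    rewrite -natr1 le_eqVlt; apply/orP; left; apply/eqP; field.
    by rewrite !gt_eqF.
  have kh : k%:R^-1 <= 2 * k.+1%:R^-1 :> R.
    rewrite ler_pdivlMr ?ltr0n// ler_pdivrMl// -natr1.
    have : 1 <= k%:R :> R by rewrite ler1n.
    lra.
  rewrite /harmonic/= ler_pdivlMr// mulrBl mul1r.
  have : k%:R^-1 <= 2 * k.+1%:R^-1 * loglog (tg k.+1).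
    by apply: le_trans kh _; rewrite ler_peMr// mulr_ge0// invr_ge0.
  move: dl; move: (k.+1%:R^-1) (k%:R^-1) (loglog _) (loglog _) => *; lra.
have sr : Num.sqrt (loglog (tg k) / loglog (tg k.+1)) @[k --> \oo] --> (1 : R).
  rewrite -[X in _ --> X]sqrtr1; apply: continuous_cvg; first exact: sqrt_continuous.
  exact: lr.
rewrite -[X in _ --> X]mulr1 -[X in _ --> X]mulr1.
have H3 : w * Num.sqrt (loglog (tg k) / loglog (tg k.+1)) *
    (h (tg k.+1)^-1 / h (tg k)^-1) @[k --> \oo] --> w * 1 * 1.
  by apply: cvgM => //; apply: cvgM => //; exact: cvg_cst.
apply: cvg_trans H3.
apply: near_eq_cvg; near=> k.
have kt0 : tg k <= t0 by near: k; exact: tg_small.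
have kts : tg k <= t_small by near: k; apply: tg_small; exact: expR_gt0.
have tS : tg k.+1 <= tg k by rewrite /tg exprS ler_piMl ?(ltW r1)// ltW.
have l1 : 1 <= loglog (tg k) by apply: loglog_ge1; rewrite tg0.
have l1' : 1 <= loglog (tg k.+1) by apply: loglog_ge1; rewrite tg0 (le_trans tS).
have h0 : 0 < h (tg k)^-1 by apply: hpos; rewrite tg0.
have h0' : 0 < h (tg k.+1)^-1 by apply: hpos; rewrite tg0 (le_trans tS).
have l0 : 0 < loglog (tg k) by apply: lt_le_trans l1.
have l0' : 0 < loglog (tg k.+1) by apply: lt_le_trans l1'.
rewrite /bfun -/(loglog (tg k)) -/(loglog (tg k.+1)).
rewrite /= [in RHS]sqrtrM ?(ltW (tg0 _))// [in X in _ = _ / X]sqrtrM ?(ltW (tg0 _))//.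
rewrite sqrtrM ?(ltW l0)// sqrtrV ?(ltW l0')//.
have -> : Num.sqrt (tg k.+1) = w^-1 * Num.sqrt (tg k).
  by rewrite /tg exprS sqrtrM ?(ltW r0)// /r sqrtr_sqr gtr0_norm// invr_gt0.
have st0 : Num.sqrt (tg k) != 0 by rewrite gt_eqF// sqrtr_gt0.
have sl0 : Num.sqrt (loglog (tg k.+1)) != 0 by rewrite gt_eqF// sqrtr_gt0.
field; rewrite ?st0 ?sl0 !gt_eqF//.
Unshelve. all: by end_near.
Qed.
End geometric.
End bfun.
End scale_function.

Section scale_sequence.
Context {R : realType} {d : nat}.
Variable Pi : {measure set (d.-tuple R) -> \bar R}.
Variables (h : R -> R) (t0 : R).
Hypothesis Hh : in_H1 h.
Hypothesis t00 : 0 < t0.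
Hypothesis hpos : forall t, 0 < t <= t0 -> 0 < h t^-1.
Hypothesis Iint :
  (\int[lebesgue_measure]_(t in `]0%R, t0]%classic) Pibar Pi (bfun h t) < +oo)%E.

Lemma Pibar_anti x y : x <= y -> (Pibar Pi y <= Pibar Pi x)%E.
Proof.
move=> xy; apply: le_measure; rewrite ?inE.
- by apply: measurable_set_lt; exact: measurable_vnorm.
- by apply: measurable_set_lt; exact: measurable_vnorm.
- by move=> z /=; exact: le_lt_trans.
Qed.

Variable w : R.
Hypothesis w1 : 1 < w.
Let r := w^-1 ^+ 2.
Let w0 : 0 < w. Proof. by apply: lt_trans w1. Qed.
Let tg k := r ^+ k.
Let bg k := bfun h (tg k).
Let r0 : 0 < r. Proof. by rewrite exprn_gt0// invr_gt0. Qed.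
Let r1 : r < 1. Proof. by rewrite exprn_ilt1// ?invr_ge0 ?(ltW w0)// invf_lt1. Qed.
Let tg0 k : 0 < tg k. Proof. by rewrite exprn_gt0. Qed.
Let tgS k : tg k.+1 = r * tg k. Proof. by rewrite /tg exprS. Qed.
Let tg_lt k : tg k.+1 < tg k.
Proof. by rewrite tgS gtr_pMl. Qed.
Let tg_anti j k : (j <= k)%N -> tg k <= tg j.
Proof.
move=> jk; rewrite -(subnKC jk); elim: (k - j)%N => [|i IH]; first by rewrite addn0.
by rewrite addnS (le_trans (ltW (tg_lt _))).
Qed.

(** A lower Riemann sum: [Pibar Pi (bfun h t)] is nonincreasing in [t], hence at least its value at
    [tg k] on []tg k.+1, tg k]], an interval of length [(1 - r) * tg k]. *)
Lemma sum_Pibar_lty K : tg K <= t0 -> tg K <= t_small ->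
  (\sum_(0 <= k <oo) (tg (K + k)%N)%:E * Pibar Pi (bg (K + k)%N) < +oo)%E.
Proof.
move=> Kt0 Kts.
pose mu := @lebesgue_measure R.
pose D : set R := `]0%R, t0]%classic.
pose E k : set R := `]tg (K + k).+1, tg (K + k)%N]%classic.
pose c k := Pibar Pi (bg (K + k)%N).
have c0 k : (0 <= c k)%E by exact: measure_ge0.
have mE k : measurable (E k) by exact: measurable_itv.
have tK k : tg (K + k)%N <= t0 by apply: le_trans Kt0; apply: tg_anti; exact: leq_addr.
have tKs k : tg (K + k)%N <= t_small by apply: le_trans Kts; apply: tg_anti; exact: leq_addr.
have ED k : E k `&` D = E k.
  apply/setIidPl => x; rewrite /E /D /= !in_itv/= => /andP[x1 x2].
  by rewrite (lt_trans _ x1)//= (le_trans x2).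
have muE k : mu (E k) = ((1 - r) * tg (K + k)%N)%:E.
  rewrite /mu /E lebesgue_measure_itv/= lte_fin tg_lt -EFinB tgS.
  by rewrite mulrBl mul1r.
pose I := (\int[mu]_(t in D) Pibar Pi (bfun h t))%E.
have HN N : ((1 - r)%:E * \sum_(0 <= k < N) (tg (K + k)%N)%:E * c k <= I)%E.
  pose g (t : R) : \bar R := (\sum_(0 <= k < N) c k * (\1_(E k) t)%:E)%E.
  have -> : ((1 - r)%:E * \sum_(0 <= k < N) (tg (K + k)%N)%:E * c k =
      \int[mu]_(t in D) g t)%E.
    rewrite ge0_integral_sum//; last 3 first.
    - exact: measurable_itv.
    - move=> k; apply: measurable_funeM; apply/measurable_EFinP.
      apply: measurable_indic. exact: mE.
    - by move=> k t _; rewrite mule_ge0// lee_fin.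
    rewrite ge0_sume_distrr; last first.
      by move=> k _; rewrite mule_ge0// lee_fin ltW.
    apply: eq_bigr => k _; transitivity (c k * mu (E k `&` D))%E.
      by rewrite ED muE muleA -EFinM muleC.
    have <- : (\int[mu]_(t in D) (\1_(E k) t)%:E = mu (E k `&` D))%E.
      by apply: integral_indic; [exact: measurable_itv|exact: mE].
    rewrite ge0_integralZl//; first exact: measurable_itv.
    by apply/measurable_EFinP; apply: measurable_indic; exact: mE.
  apply: ge0_le_integral_nomeas.
    by move=> t _; apply: sume_ge0 => k _; rewrite mule_ge0// lee_fin.
  move=> t _.
  have [[k kN Ek]|nE] := pselect (exists2 k, (k < N)%N & E k t); last first.
    rewrite /g big1_seq ?measure_ge0// => k /andP[_]; rewrite mem_index_iota => /andP[_ kN].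
    rewrite indicE memNset ?mule0// => Ek; apply: nE; by exists k.
  have t1 : tg (K + k).+1 < t <= tg (K + k)%N by move: Ek; rewrite /E /= in_itv.
  case/andP: t1 => t1 t2.
  apply: (@le_trans _ _ (c k)).
    rewrite /g (bigD1_seq k)//= ?iota_uniq// ?mem_index_iota//.
    rewrite indicE mem_set// mule1 big1_seq ?adde0// => j /andP[jk _].
    rewrite indicE memNset ?mule0// /E /= in_itv/= => /andP[t3 t4].
    move: jk; rewrite neq_ltn => /orP[jk|kj].
      have : tg (K + k)%N <= tg (K + j).+1 by apply: tg_anti; rewrite -addnS leq_add2l.
      by move=> H; have := lt_le_trans t3 (le_trans t2 H); rewrite ltxx.
    have : tg (K + j)%N <= tg (K + k).+1 by apply: tg_anti; rewrite -addnS leq_add2l.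
    by move=> H; have := lt_le_trans t1 (le_trans t4 H); rewrite ltxx.
  apply: Pibar_anti; apply: (bfun_le Hh hpos) => //.
  by apply: lt_trans t1.
have r1' : 0 < 1 - r by rewrite subr_gt0.
apply: (@le_lt_trans _ _ ((1 - r)^-1%:E * I)%E); last first.
  by rewrite lte_mul_pinfty// lee_fin invr_ge0 ltW.
apply: lime_le.
  by apply: is_cvg_nneseries => k _ _; rewrite mule_ge0// lee_fin ltW.
apply: nearW => N.
have := lee_wpmul2l (_ : 0 <= (1 - r)^-1%:E)%E (HN N).
rewrite muleA -EFinM mulVf ?gt_eqF// mul1e; apply.
by rewrite lee_fin invr_ge0 ltW.
Qed.

(** As [bg k / bg k.+1] tends to [w], the step ratios of [t / b ^ 4] and [t / b] tend to [w ^ 2] and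
    [w^-1]. The constants [w], [(1 + w^-1) / 2] and [w ^ 2] leave strict room around the limits
    [w ^ 2], [w^-1] and [w], so the three inequalities hold from some index on. *)
Lemma scale_sequence : exists K, [/\
  forall k, tg (K + k)%N <= t0 /\ tg (K + k)%N <= t_small,
  forall k, 0 < bg (K + k)%N <= 1,
  forall k, w * (tg (K + k)%N / bg (K + k)%N ^+ 4) <=
            tg (K + k).+1 / bg (K + k).+1 ^+ 4,
  forall k, tg (K + k).+1 / bg (K + k).+1 <=
            (1 + w^-1) / 2 * (tg (K + k)%N / bg (K + k)%N) &
  forall k, bg (K + k)%N <= w ^+ 2 * bg (K + k).+1] /\
  bg (K + k)%N @[k --> \oo] --> (0 : R).
Proof.
have cu := bfun_ratio_cvg Hh t00 hpos w1.
have wi : w^-1 < 1 by rewrite invf_lt1.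
have tsmall (x : R) : 0 < x -> \forall k \near \oo, tg k <= x.
  move=> x0; move/cvgr0Pnorm_lt: (geometric_to0 w1) => /(_ x x0).
  by apply: filterS => k; rewrite gtr0_norm// => /ltW.
have n1 := tsmall _ t00.
have n2 := tsmall _ (expR_gt0 (- expR 1) : 0 < t_small).
have n3 : \forall k \near \oo, w ^+ 3 <= (bg k / bg k.+1) ^+ 4.
  have c4 : (bg k / bg k.+1) ^+ 4 @[k --> \oo] --> w ^+ 4.
    have H (u : nat -> R) : u @ \oo --> w -> u k ^+ 4 @[k --> \oo] --> w ^+ 4.
      move=> Hu; rewrite (_ : w ^+ 4 = w * (w * (w * w))); last by ring.
      rewrite (_ : (fun k => u k ^+ 4) = (fun k => u k * (u k * (u k * u k)))).
        by do 3!(apply: cvgM => //).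
      by apply/funext => k; ring.
    exact: H cu.
  have w34 : w ^+ 3 < w ^+ 4 by rewrite ltr_eXn2l.
  have H4 : \forall k \near \oo, w ^+ 3 < (bg k / bg k.+1) ^+ 4 by exact: (cvgr_gt _ c4).
  by apply: filterS H4 => k; exact: ltW.
have n4 : \forall k \near \oo, r * (bg k / bg k.+1) <= (1 + w^-1) / 2.
  have cr : r * (bg k / bg k.+1) @[k --> \oo] --> r * w.
    by apply: cvgM; [exact: cvg_cst|exact: cu].
  have rw : r * w < (1 + w^-1) / 2.
    by rewrite /r expr2 -mulrA mulVf ?gt_eqF// mulr1; lra.
  have H4 : \forall k \near \oo, r * (bg k / bg k.+1) < (1 + w^-1) / 2 by exact: (cvgr_lt _ cr).
  by apply: filterS H4 => k; exact: ltW.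
have n5 : \forall k \near \oo, bg k / bg k.+1 <= w ^+ 2.
  have ww : w < w ^+ 2 by rewrite -[ltLHS]expr1 ltr_eXn2l.
  have H4 : \forall k \near \oo, bg k / bg k.+1 < w ^+ 2 by exact: (cvgr_lt _ cu).
  by apply: filterS H4 => k; exact: ltW.
have nn : \forall k \near \oo, [/\ tg k <= t0, tg k <= t_small,
    w ^+ 3 <= (bg k / bg k.+1) ^+ 4, r * (bg k / bg k.+1) <= (1 + w^-1) / 2 &
    bg k / bg k.+1 <= w ^+ 2].
  by near=> k; split; near: k.
have [K1 _ HK1] := nn.
have bpos k : (K1 <= k)%N -> 0 < bg k.
  by move=> kK; have [? ? _ _ _] := HK1 k kK; apply: (bfun_gt0 hpos) => //; rewrite tg0.
have quart k : (K1 <= k)%N -> w * (tg k / bg k ^+ 4) <= tg k.+1 / bg k.+1 ^+ 4.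
  move=> kK; have [_ _ + _ _] := HK1 k kK.
  have p1 := bpos k kK; have p2 := bpos k.+1 (leqW kK).
  rewrite exprMn exprVn ler_pdivlMr ?exprn_gt0// => H.
  rewrite ler_pdivlMr ?exprn_gt0// tgS.
  have -> : w * (tg k / bg k ^+ 4) * bg k.+1 ^+ 4 =
    (w ^+ 3 * bg k.+1 ^+ 4) * (r * tg k / bg k ^+ 4).
    by rewrite /r; field; rewrite !gt_eqF.
  have p3 : 0 <= r * tg k / bg k ^+ 4.
    apply: divr_ge0; last by apply: exprn_ge0; exact: ltW.
    by apply: mulr_ge0; exact: ltW.
  apply: le_trans (ler_wpM2r p3 H) _.
  by rewrite le_eqVlt; apply/orP; left; apply/eqP; field; rewrite gt_eqF.
(* Since [t / b ^ 4] does not decrease along the scale, [b ^ 4] is at most a constant times [t]. *)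
have b0 : bg (K1 + k)%N @[k --> \oo] --> (0 : R).
  apply/cvgr0Pnorm_lt => e e0.
  have Hb k : bg (K1 + k)%N ^+ 4 <= tg (K1 + k)%N * (bg K1 ^+ 4 / tg K1).
    have pk := bpos (K1 + k)%N (leq_addr _ _); have p0 := bpos K1 (leqnn _).
    suff H : tg K1 / bg K1 ^+ 4 <= tg (K1 + k)%N / bg (K1 + k)%N ^+ 4.
      move: H; rewrite ler_pdivlMr ?exprn_gt0// => H.
      rewrite mulrA ler_pdivlMr// mulrC.
      by move: H; rewrite mulrAC ler_pdivrMr ?exprn_gt0.
    elim: k {pk} => [|k IH]; first by rewrite addn0.
    have pk := bpos (K1 + k)%N (leq_addr _ _).
    rewrite addnS; apply: le_trans (quart _ (leq_addr _ _)).
    apply: (le_trans IH); rewrite ler_peMl ?(ltW w1)//.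
    by rewrite divr_ge0 ?(ltW (tg0 _))// exprn_ge0// ltW.
  have p0 := bpos K1 (leqnn _).
  have x0 : 0 < e ^+ 4 / 2 / (bg K1 ^+ 4 / tg K1) by apply: divr_gt0; apply: divr_gt0 => //; exact: exprn_gt0.
  have [K2 _ HK2] := tsmall _ x0.
  exists K2 => // k /= k2; rewrite gtr0_norm ?bpos ?leq_addr//.
  rewrite -(@ltr_pXn2r _ 4) ?nnegrE ?(ltW e0) ?ltW ?bpos ?leq_addr//.
  apply: le_lt_trans (Hb k) _.
  have y0 : 0 < bg K1 ^+ 4 / tg K1 by apply: divr_gt0 => //; exact: exprn_gt0.
  have H := HK2 (K1 + k)%N (leq_trans k2 (leq_addl _ _)).
  have {}H := ler_wpM2r (ltW y0) H.
  apply: (le_lt_trans H); rewrite divfK ?gt_eqF//.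
  have : 0 < e ^+ 4 by rewrite exprn_gt0.
  lra.
have [K2 _ HK2] : \forall k \near \oo, bg (K1 + k)%N <= 1.
  by move/cvgr0Pnorm_lt: b0 => /(_ 1 ltr01); apply: filterS => k /ltW; exact: le_trans (ler_norm _).
exists (K1 + K2)%N; split; last first.
  rewrite (_ : (fun k => _) = (fun k => bg (K1 + (k + K2))%N)).
    by rewrite (cvg_shiftn K2 (fun k => bg (K1 + k)%N)).
  by apply/funext => k; rewrite (addnC k) addnA.
have le1 k : (K1 <= K1 + K2 + k)%N by rewrite -addnA leq_addr.
split => k.
- by have [? ? _ _ _] := HK1 _ (le1 k).
- by rewrite bpos//= -addnA HK2//= leq_addr.
- exact: quart.
- have [_ _ _ H _] := HK1 _ (le1 k).
  have p1 := bpos _ (le1 k); have p2 := bpos _ (leqW (le1 k)).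
  have p3 : 0 <= tg (K1 + K2 + k)%N / bg (K1 + K2 + k)%N by rewrite divr_ge0 ?ltW.
  apply: le_trans (ler_wpM2r p3 H).
  rewrite tgS le_eqVlt; apply/orP; left; apply/eqP; field.
  by rewrite !gt_eqF.
- have [_ _ _ _ H] := HK1 _ (le1 k).
  by rewrite -ler_pdivrMr// bpos// leqW.
Unshelve. all: by end_near.
Qed.
End scale_sequence.

(** * Elementary series *)

Section series.
Context {R : realType}.

Lemma nneseries_le_bound (u : nat -> R) M : (forall k, 0 <= u k) ->
  (forall N, \sum_(0 <= k < N) u k <= M) -> (\sum_(0 <= k <oo) (u k)%:E <= M%:E)%E.
Proof.
move=> u0 uM; apply: lime_le; first by apply: is_cvg_nneseries => k _ _; rewrite lee_fin.
by apply: nearW => N; rewrite sumEFin lee_fin.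
Qed.

Lemma nneseries_lty_cvg0 (u : nat -> R) : (forall k, 0 <= u k) ->
  (\sum_(0 <= k <oo) (u k)%:E < +oo)%E -> u @ \oo --> (0 : R).
Proof.
move=> u0 su; apply: cvg_series_cvg_0.
apply: nondecreasing_is_cvgn.
  by apply: nondecreasing_series => k _ _.
exists (fine (\sum_(0 <= k <oo) (u k)%:E)%E) => _ [N _ <-].
have s0 : (0 <= \sum_(0 <= k <oo) (u k)%:E)%E.
  by apply: nneseries_ge0 => k _ _; rewrite lee_fin.
rewrite -lee_fin fineK ?ge0_fin_numE// /series/= -sumEFin.
by apply: nneseries_lim_ge => k _ _; rewrite lee_fin.
Qed.

Lemma loglog_ge (A t : R) : 0 < t <= expR (- expR A) -> A <= loglog t.
Proof.
move=> /andP[t0 ts].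
have h : expR A <= ln t^-1.
  rewrite lnV ?posrE// lerNr -(expRK (- expR A)).
  by rewrite ler_ln ?posrE ?expR_gt0.
rewrite -(expRK A) /loglog ler_ln ?posrE ?expR_gt0//.
by apply: lt_le_trans h; exact: expR_gt0.
Qed.

(* By comparison with the telescoping series of [x ^ - kappa]. *)
Lemma power_series_bounded (x : nat -> R) (rho kappa : R) :
  (forall k, 0 < x k) -> 0 < rho -> 0 < kappa ->
  (forall k, x k.+1 = x k + rho) ->
  exists M, forall N, \sum_(0 <= k < N) expR (- ((1 + kappa) * ln (x k))) <= M.
Proof.
move=> x0 rho0 k0 xS.
pose u k := expR (- ((1 + kappa) * ln (x k))).
pose f k := expR (- (kappa * ln (x k))).
have step k : u k.+1 <= (kappa * rho)^-1 * (f k - f k.+1).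
  have d1 : ln (x k) - ln (x k.+1) <= - (rho / x k.+1).
    rewrite -ln_div ?posrE//; apply: le_trans (ln_le_subr1 _) _; first exact: divr_gt0.
    rewrite le_eqVlt; apply/orP; left; apply/eqP; rewrite xS; field.
    by rewrite gt_eqF// addr_gt0.
  have fE : f k = f k.+1 * expR (kappa * (ln (x k.+1) - ln (x k))).
    by rewrite /f -expRD; congr expR; ring.
  have uE : u k.+1 = f k.+1 / x k.+1.
    rewrite -[X in _ / X]lnK ?posrE// -expRN /f -expRD; congr expR; ring.
  have e1 := expR_ge1Dx (kappa * (ln (x k.+1) - ln (x k))).
  have e2 : kappa * (rho / x k.+1) <= kappa * (ln (x k.+1) - ln (x k)).
    by rewrite ler_wpM2l ?(ltW k0)//; lra.
  rewrite ler_pdivlMl ?mulr_gt0// fE uE.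
  have f0 : 0 <= f k.+1 by exact: expR_ge0.
  have e3 : kappa * (rho / x k.+1) <= expR (kappa * (ln (x k.+1) - ln (x k))) - 1 by lra.
  have := ler_wpM2l f0 e3.
  rewrite (_ : f k.+1 * (kappa * (rho / x k.+1)) = kappa * rho * (f k.+1 / x k.+1)); last by ring.
  by rewrite mulrBr mulr1.
exists (u 0%N + (kappa * rho)^-1 * f 0%N) => N.
have c0 : 0 <= (kappa * rho)^-1 by rewrite invr_ge0 mulr_ge0// ltW.
suff H : \sum_(0 <= k < N.+1) u k <= u 0%N + (kappa * rho)^-1 * (f 0%N - f N).
  apply: le_trans (_ : \sum_(0 <= k < N.+1) u k <= _).
    by rewrite big_nat_recr//= lerDl expR_ge0.
  apply: (le_trans H); rewrite lerD2l ler_wpM2l// gerBl; exact: expR_ge0.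
elim: N => [|N IH]; first by rewrite big_nat1 subrr mulr0 addr0.
rewrite big_nat_recr//=; apply: le_trans (lerD IH (step N)) _.
by rewrite -addrA lerD2l -mulrDr addrA subrK.
Qed.

Lemma geometric_half_bounded N : \sum_(0 <= k < N) (2^-1 ^+ k : R) <= 2.
Proof.
suff : \sum_(0 <= k < N) (2^-1 ^+ k : R) <= 2 - 2 * 2^-1 ^+ N.
  have : 0 <= 2^-1 ^+ N :> R by rewrite exprn_ge0.
  lra.
elim: N => [|N IH]; first by rewrite big_geq// expr0; lra.
by rewrite big_nat_recr//= exprS; lra.
Qed.
End series.

Section truncated_moments.
Context {R : realType} {d : nat}.
Variable Pi : {measure set (d.-tuple R) -> \bar R}.
Hypothesis HPi : is_levy_measure Pi.

Lemma trunc_dot2_le_Vfun b z : vnorm z <= 1 ->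
  ((trunc_dot2 Pi b z)%:E <= Vfun Pi b)%E.
Proof.
move=> z1; apply: ereal_sup_ubound; exists z => //.
rewrite /trunc_dot2 /Rintegral fineK; last first.
  exact: (integrable_fin_num _ (integrable_trunc_dot2 HPi b z1)).
rewrite [LHS]integral_mkcond; apply: eq_integral => y _.
rewrite patchE; case: ifPn => [|].
  by rewrite inE /= => ->; rewrite vdotC.
by rewrite notin_setE /= => /negP/negbTE ->.
Qed.

Definition vbasis (i : 'I_d) : d.-tuple R := [tuple (j == i)%:R | j < d].

Lemma vdot_basis i y : vdot (vbasis i) y = vcoord y i.
Proof.
rewrite /vdot (bigD1 i)//= vcoord_mktuple eqxx mul1r big1 ?addr0// => j ji.
by rewrite vcoord_mktuple (negbTE ji) mul0r.
Qed.

Lemma vnorm_basis i : vnorm (vbasis i) = 1.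
Proof.
have h : vnorm (vbasis i) ^+ 2 = 1 by rewrite -vdot_self vdot_basis vcoord_mktuple eqxx.
by apply/eqP; rewrite -(@eqrXn2 _ 2) ?expr1n ?vnorm_ge0// h.
Qed.

(** [Vfun] is a supremum over single directions; summing over a basis lets it control the full
    truncated second moment up to the factor [d]. *)
Lemma trunc2_sum b : trunc2 Pi b = \sum_(i < d) trunc_dot2 Pi b (vbasis i).
Proof.
have ii i : Pi.-integrable setT
    (EFin \o (fun y => if vnorm y <= b then vdot (vbasis i) y ^+ 2 else 0)).
  by apply: (integrable_trunc_dot2 HPi); rewrite vnorm_basis.
have H (s : seq 'I_d) : Pi.-integrable setT (EFin \o
      (fun y => \sum_(i <- s) (if vnorm y <= b then vdot (vbasis i) y ^+ 2 else 0))) /\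
    \int[Pi]_y \sum_(i <- s) (if vnorm y <= b then vdot (vbasis i) y ^+ 2 else 0) =
    \sum_(i <- s) trunc_dot2 Pi b (vbasis i).
  elim: s => [|i s [IH1 IH2]].
    split; last by rewrite big_nil; under eq_Rintegral do rewrite big_nil; rewrite /Rintegral integral0.
    rewrite (_ : EFin \o _ = cst 0%E); first exact: integrable0.
    by apply/funext => y; rewrite /= big_nil.
  split.
    have := integrableD measurableT (ii i) IH1; apply: eq_integrable => // y _.
    by rewrite /= big_cons.
  rewrite big_cons; under eq_Rintegral do rewrite big_cons.
  by rewrite RintegralD// IH2.
rewrite -(H _).2 /trunc2; apply: eq_Rintegral => y _.
case: ifP => yb; last by rewrite big1.
by rewrite sqr_vnorm; apply: eq_bigr => i _; rewrite vdot_basis.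
Qed.
End truncated_moments.

Section choice_of_exponent.
Context {R : realType}.

(* The optimal exponent [2 * l / L] is capped at [- ln q / delta], where the
   remainder [expR (delta * th) * q] stays bounded; since [delta <= L / 2], the
   capped exponent still yields a bound of order [q]. *)
Lemma fuk_nagaev_choice (C q l L g delta eta v e : R) :
  0 < q < 1 -> 0 < L -> 0 < g -> 1 <= l -> 0 < delta <= L / 2 -> eta <= g / 8 ->
  (1 + e) * v <= L ^+ 2 / (2 * l) -> 0 < C ->
  exists2 th, 0 <= th &
    expR (- (th * (L + g / 4)) + th * eta + (1 + e) * th ^+ 2 * v / 2 +
          C * (expR (delta * th) * q)) <=
    expR C * (q + expR (- ((1 + g / (4 * L)) * l))).
Proof.
move=> /andP[q0 q1] L0 g0 l1 /andP[del0 delL] heta hv C0.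
have l0 : 0 < l by apply: lt_le_trans l1.
have lnq : 0 < - ln q by rewrite oppr_gt0 ln_lt0// q0.
pose th := Num.min (2 * l / L) (- ln q / delta).
have th0 : 0 <= th by rewrite le_min !divr_ge0 ?mulr_ge0 ?(ltW l0) ?(ltW L0) ?(ltW del0) ?(ltW lnq).
exists th => //.
have thl : th <= 2 * l / L by rewrite ge_min lexx.
have thq : th <= - ln q / delta by rewrite ge_min lexx orbT.
have h1 : expR (delta * th) * q <= 1.
  have : delta * th <= - ln q by rewrite mulrC -ler_pdivlMr.
  rewrite -ler_expR => /(ler_wpM2r (ltW q0)) /le_trans; apply.
  by rewrite expRN lnK ?posrE// mulVf// gt_eqF.
have h2 : (1 + e) * th ^+ 2 * v / 2 <= th * (L / 2).
  have t2 : 0 <= th ^+ 2 by exact: sqr_ge0.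
  apply: (@le_trans _ _ (th ^+ 2 * (L ^+ 2 / (2 * l)) / 2)).
    by have := ler_wpM2l t2 hv; lra.
  have -> : th ^+ 2 * (L ^+ 2 / (2 * l)) / 2 = th * (L / 2) * (th * (L / (2 * l))).
    by field; rewrite gt_eqF.
  rewrite ler_piMr// ?mulr_ge0 ?divr_ge0 ?(ltW L0)//.
  by rewrite mulrA ler_pdivrMr ?mulr_gt0// mul1r -ler_pdivlMr.
have h3 : th * eta <= th * (g / 8) by rewrite ler_wpM2l.
have h4 : C * (expR (delta * th) * q) <= C * 1 by rewrite ler_wpM2l// ltW.
apply: (@le_trans _ _ (expR (C - th * (L / 2 + g / 8)))).
  by rewrite ler_expR; lra.
rewrite expRD ler_wpM2l ?expR_ge0//.
have [thE|thE] : th = 2 * l / L \/ th = - ln q / delta.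
  by rewrite /th; case: (leP (2 * l / L)) => _; [left|right].
- apply: (@le_trans _ _ (expR (- ((1 + g / (4 * L)) * l)))); last by rewrite lerDr ltW.
  rewrite ler_expR thE le_eqVlt; apply/orP; left; apply/eqP; field.
  by rewrite gt_eqF.
- apply: (@le_trans _ _ q); last by rewrite lerDl expR_ge0.
  rewrite -[leRHS]lnK ?posrE// ler_expR lerNl.
  apply: (@le_trans _ _ (th * delta)).
    by rewrite thE divfK ?gt_eqF.
  by rewrite ler_wpM2l//; lra.
Qed.

(** With [th = 4 / y] the exponent is at most [- 4 + 1 + 1 / 2 + 1 / 2 = - 2], and
    [1 / 8 + expR (- 2)] is below [1 / 2]; the four components of [c] ensure these bounds. This
    prepares the hypothesis of Ottaviani's inequality. *)
Lemma half_choice (C delta y : R) : 0 < C -> 0 < y ->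
  exists2 c, 0 < c & forall q eta v e, 0 <= q <= c -> eta <= c -> 0 <= v <= c ->
    0 <= e <= 1 ->
    C * q + expR (- (4 / y * y) + 4 / y * eta + (1 + e) * (4 / y) ^+ 2 * v / 2 +
                  C * (expR (delta * (4 / y)) * q)) <= 1 / 2.
Proof.
move=> C0 y0; pose th := 4 / y.
have th0 : 0 < th by rewrite divr_gt0.
pose E := expR (delta * th).
have E0 : 0 < E by exact: expR_gt0.
have CE : 0 < C * E by rewrite mulr_gt0.
have th20 : 0 < th ^+ 2 by rewrite exprn_gt0.
pose c1 := (8 * C)^-1; pose c2 := th^-1; pose c3 := (2 * th ^+ 2)^-1.
pose c4 := (2 * (C * E))^-1.
exists (Num.min (Num.min c1 c2) (Num.min c3 c4)).
  rewrite !lt_min; apply/andP; split; apply/andP; split; rewrite invr_gt0//; exact: mulr_gt0.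
move=> q eta v e; rewrite !le_min => /andP[q0 /andP[/andP[q1 _] /andP[_ q4]]].
move=> /andP[/andP[_ eta2] _] /andP[v0 /andP[_ /andP[v3 _]]] /andP[e0 e1].
rewrite -/th -/E.
have h1 : C * q <= 1 / 8.
  have := ler_wpM2l (ltW C0) q1; rewrite /c1 invfM mulrCA mulfV ?gt_eqF//; lra.
have h2 : th * eta <= 1.
  by have := ler_wpM2l (ltW th0) eta2; rewrite /c2 mulfV ?gt_eqF.
have h3 : th ^+ 2 * v <= 1 / 2.
  have := ler_wpM2l (ltW th20) v3; rewrite /c3 invfM mulrCA mulfV ?gt_eqF//; lra.
have h4 : C * (E * q) <= 1 / 2.
  have := ler_wpM2l (ltW CE) q4; rewrite /c4 invfM mulrCA mulfV ?gt_eqF//; lra.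
have h5 : th * y = 4 by rewrite divfK ?gt_eqF.
have h6 : e * (th ^+ 2 * v) <= 1 * (th ^+ 2 * v).
  by rewrite ler_wpM2r// mulr_ge0// ltW.
have h7 : expR (- (th * y) + th * eta + (1 + e) * th ^+ 2 * v / 2 + C * (E * q)) <=
    expR (- 2).
  by rewrite ler_expR h5; lra.
have h8 : expR (- 2) <= 1 / 3 :> R.
  rewrite expRN div1r lef_pV2 ?posrE ?expR_gt0//.
  by have := expR_ge1Dx (2 : R); lra.
lra.
Qed.
End choice_of_exponent.

Section good_scale.
Context {R : realType} {d : nat}.
Variable Pi : {measure set (d.-tuple R) -> \bar R}.
Hypothesis HPi : is_levy_measure Pi.
Variables (h : R -> R) (t0 lambda : R).
Hypothesis Hh : in_H1 h.
Hypothesis t00 : 0 < t0.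
Hypothesis hpos : forall t, 0 < t <= t0 -> 0 < h t^-1.
Hypothesis Iint :
  (\int[lebesgue_measure]_(t in `]0%R, t0]%classic) Pibar Pi (bfun h t) < +oo)%E.
Hypothesis HV :
  (limf_esup (fun t : R => Vfun Pi (bfun h t) * ((h t^-1) ^+ 2)%:E) ((0:R)^'+)
     <= (lambda ^+ 2 / 2)%:E)%E.

(* The [T] in mind is [w ^ (- 2 (K + k))] with [K] large: slow variation makes
   [bfun h] behave there like the square root up to a slowly varying factor, so
   that a step multiplies [bfun h (T k)] by about [w^-1], [T / b] decays
   geometrically and [T / b ^ 4] grows geometrically. *)
Record good_scale (w : R) (T : nat -> R) : Prop := GoodScale {
  gs_gt0 : forall k, 0 < T k;
  gs_to0 : T @ \oo --> (0 : R);
  gs_le : forall k, T k <= t0 /\ T k <= t_small;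
  gs_b : forall k, 0 < bfun h (T k) <= 1;
  gs_bS : forall k, bfun h (T k.+1) <= bfun h (T k);
  gs_quart : forall k, w * (T k / bfun h (T k) ^+ 4) <= T k.+1 / bfun h (T k.+1) ^+ 4;
  gs_lin : forall k, T k.+1 / bfun h (T k.+1) <= (1 + w^-1) / 2 * (T k / bfun h (T k));
  gs_bM : forall k, bfun h (T k) <= w ^+ 2 * bfun h (T k.+1);
  gs_bto0 : bfun h (T k) @[k --> \oo] --> (0 : R);
  gs_sum : (\sum_(0 <= k <oo) (T k)%:E * Pibar Pi (bfun h (T k)) < +oo)%E;
  gs_ln : exists2 rho, 0 < rho & forall k, ln (T k.+1)^-1 = ln (T k)^-1 + rho }.

Lemma good_scale_ex w : 1 < w -> exists T, good_scale w T.
Proof.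
move=> w1.
have [K [[Kle Kb Kq Kl KM] K0]] := scale_sequence Hh t00 hpos w1.
have w0 : 0 < w by apply: lt_trans w1.
pose r := w^-1 ^+ 2.
have r0 : 0 < r by rewrite exprn_gt0// invr_gt0.
have r1 : r < 1 by rewrite exprn_ilt1// ?invr_ge0 ?(ltW w0)// invf_lt1.
pose T k := r ^+ (K + k)%N.
have T0 k : 0 < T k by rewrite exprn_gt0.
have TS k : T k.+1 = r * T k by rewrite /T addnS exprS.
have Tanti k : T k.+1 <= T k by rewrite TS ler_piMl ?(ltW r1)// ltW.
exists T; split => //.
- rewrite (_ : T = (fun k => r ^+ (k + K)%N)).
    by rewrite (cvg_shiftn K (fun k => r ^+ k)); exact: geometric_to0.
  by apply/funext => k; rewrite /T addnC.
- move=> k; apply: (bfun_le Hh hpos) => //; by case: (Kle k).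
- by move=> k; have := Kq k; rewrite /T addnS.
- by move=> k; have := Kl k; rewrite /T addnS.
- by move=> k; have := KM k; rewrite /T addnS.
- apply: (sum_Pibar_lty Hh hpos Iint w1); have := Kle 0%N; rewrite addn0; by case.
- exists (ln r^-1); first by rewrite ln_gt0// invf_gt1.
  by move=> k; rewrite TS invfM lnM ?posrE ?invr_gt0// addrC.
Qed.

Variables (w : R) (T : nat -> R).
Hypotheses (w1 : 1 < w) (GS : good_scale w T).
Let B k := bfun h (T k).
Let B0 k : 0 < B k. Proof. by case/andP: (gs_b GS k). Qed.
Let T0 k : 0 < T k := gs_gt0 GS k.
Let LL k := loglog (T k).
Let LL1 k : 1 <= LL k.
Proof. by apply: loglog_ge1; rewrite T0/=; case: (gs_le GS k). Qed.
Let LL0 k : 0 < LL k. Proof. exact: lt_le_trans (LL1 k). Qed.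
Let w0 : 0 < w. Proof. by apply: lt_trans w1. Qed.
Let sigma01 : 0 < (1 + w^-1) / 2 < 1.
Proof.
have wi : w^-1 < 1 by rewrite invf_lt1.
have : 0 < w^-1 by rewrite invr_gt0.
by move=> ?; apply/andP; split; lra.
Qed.

Lemma good_scale_loglog A : \forall k \near \oo, A <= LL k.
Proof.
move/cvgr0Pnorm_lt: (gs_to0 GS) => /(_ (expR (- expR A)) (expR_gt0 _)).
apply: filterS => k; rewrite gtr0_norm// => /ltW H.
by apply: loglog_ge; rewrite T0.
Qed.

Lemma good_scale_sqr k : B k ^+ 2 * h (T k)^-1 ^+ 2 = T k * LL k.
Proof.
have hp : 0 < h (T k)^-1 by apply: hpos; rewrite T0; case: (gs_le GS k).
rewrite -exprMn /B /bfun divfK ?gt_eqF// sqr_sqrtr// mulr_ge0 ?ltW//.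
exact: LL0.
Qed.

(** By [good_scale_sqr], a bound on [Vfun * h ^ 2] is a bound of order [1 / loglog] on the variance
    relative to [B k ^ 2]; this makes the Gaussian exponent proportional to [loglog]. *)
Lemma good_scale_variance eta : 0 < eta -> \forall k \near \oo,
  forall z, vnorm z <= 1 ->
    T k * trunc_dot2 Pi (B k) z <= (lambda ^+ 2 / 2 + eta) / LL k * B k ^+ 2.
Proof.
move=> eta0.
have lt_eta : ((lambda ^+ 2 / 2)%:E < (lambda ^+ 2 / 2 + eta)%:E)%E.
  by rewrite lte_fin ltrDl.
have := le_lt_trans HV lt_eta.
move=> /ereal_inf_lt[_ [V VF <-] HVlt].
have VT : \forall k \near \oo, V (T k).
  move: VF; rewrite /= /at_right => -[e /= e0 He].
  move/cvgr0Pnorm_lt: (gs_to0 GS) => /(_ e e0); apply: filterS => k Tke.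
  by apply: He => //=; rewrite sub0r normrN.
apply: filterS VT => k VTk z z1.
have hp : 0 < h (T k)^-1 by apply: hpos; rewrite T0; case: (gs_le GS k).
have H1 : (Vfun Pi (B k) * ((h (T k)^-1) ^+ 2)%:E <= (lambda ^+ 2 / 2 + eta)%:E)%E.
  apply: le_trans (ltW HVlt); apply: ereal_sup_ubound.
  by exists (T k).
have H2 : trunc_dot2 Pi (B k) z * h (T k)^-1 ^+ 2 <= lambda ^+ 2 / 2 + eta.
  rewrite -lee_fin EFinM; apply: le_trans H1.
  by apply: lee_wpmul2r; rewrite ?lee_fin ?sqr_ge0//; exact: trunc_dot2_le_Vfun.
have E : B k ^+ 2 = T k * LL k / h (T k)^-1 ^+ 2.
  by rewrite -good_scale_sqr mulfK// gt_eqF// exprn_gt0.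
rewrite E.
have -> : (lambda ^+ 2 / 2 + eta) / LL k * (T k * LL k / h (T k)^-1 ^+ 2) =
   T k * ((lambda ^+ 2 / 2 + eta) / h (T k)^-1 ^+ 2).
  by field; rewrite !gt_eqF// ?exprn_gt0.
by rewrite ler_wpM2l ?(ltW (T0 k))// ler_pdivlMr// exprn_gt0.
Qed.

Lemma good_scale_jump : (\sum_(0 <= k <oo) (T k * jump4 Pi (B k))%:E < +oo)%E.
Proof.
exact: (jump4_summable HPi T0 B0 (gs_bS GS) w1 (gs_quart GS) (gs_bM GS) (gs_bto0 GS)
  (gs_sum GS)).
Qed.

Lemma invr_loglog_cvg0 : (LL k)^-1 @[k --> \oo] --> (0 : R).
Proof.
apply/cvgr0Pnorm_lt => e e0; have := good_scale_loglog (e^-1 + 1).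
apply: filterS => k H; rewrite gtr0_norm ?invr_gt0//.
rewrite invf_plt ?posrE//; apply: lt_le_trans H; lra.
Qed.

Variable gamma : d.-tuple R.

(** After division by [B k] the terms are, up to constants, [T / B], [1 / loglog] (from the variance
    bound in each basis direction), [T / B * mid1] and [T]; all of them tend to 0. *)
Lemma good_scale_mean delta c : 0 < delta -> 0 < c -> \forall k \near \oo,
  T k * (vnorm gamma + (trunc2 Pi (B k) / (delta * B k) + 2 * mid1 Pi (B k) +
         delta * B k * big0 Pi)) <= c * B k.
Proof.
move=> del0 c0.
have cTB : T k / B k @[k --> \oo] --> (0 : R).
  exact: (scale_ratio_cvg0 T0 B0 sigma01 (gs_lin GS)).
have cmid : T k / B k * mid1 Pi (B k) @[k --> \oo] --> (0 : R).
  exact: (mid1_cvg0 HPi T0 B0 sigma01 (gs_lin GS) (gs_bM GS) (gs_sum GS)).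
pose M := d%:R * (lambda ^+ 2 / 2 + 1) / delta.
have cU : vnorm gamma * (T k / B k) + M * (LL k)^-1 + 2 * (T k / B k * mid1 Pi (B k)) +
    delta * big0 Pi * T k @[k --> \oo] --> (0 : R).
  rewrite -[X in _ --> X](_ : vnorm gamma * 0 + M * 0 + 2 * 0 + delta * big0 Pi * 0 = 0); last by ring.
  apply: cvgD; last by apply: cvgM; [exact: cvg_cst|exact: (gs_to0 GS)].
  apply: cvgD; last by apply: cvgM; [exact: cvg_cst|exact: cmid].
  apply: cvgD; first by apply: cvgM; [exact: cvg_cst|exact: cTB].
  by apply: cvgM; [exact: cvg_cst|exact: invr_loglog_cvg0].
have nU : \forall k \near \oo, vnorm gamma * (T k / B k) + M * (LL k)^-1 +
    2 * (T k / B k * mid1 Pi (B k)) + delta * big0 Pi * T k < c.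
  exact: (cvgr_lt _ cU).
apply: filterS2 nU (good_scale_variance ltr01) => k Uk Vk.
have h2 : T k * trunc2 Pi (B k) <= d%:R * (lambda ^+ 2 / 2 + 1) / LL k * B k ^+ 2.
  rewrite trunc2_sum// mulr_sumr.
  apply: (@le_trans _ _ (\sum_(i < d) ((lambda ^+ 2 / 2 + 1) / LL k * B k ^+ 2))).
    by apply: ler_sum => i _; apply: Vk; rewrite vnorm_basis.
  rewrite sumr_const card_ord -[leLHS]mulr_natl le_eqVlt; apply/orP; left; apply/eqP; ring.
have h3 : T k * trunc2 Pi (B k) / (delta * B k) <= M * (LL k)^-1 * B k.
  rewrite (ler_pdivrMr _ _ (mulr_gt0 del0 (B0 k))); apply: (le_trans h2).
  rewrite /M le_eqVlt; apply/orP; left; apply/eqP; field.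
  by rewrite !gt_eqF.
have h4 := ler_wpM2r (ltW (B0 k)) (ltW Uk).
apply: le_trans h4.
have -> : T k * (vnorm gamma + (trunc2 Pi (B k) / (delta * B k) + 2 * mid1 Pi (B k) + delta * B k * big0 Pi))
  = vnorm gamma * T k + T k * trunc2 Pi (B k) / (delta * B k) + 2 * (T k * mid1 Pi (B k)) +
    delta * big0 Pi * T k * B k by ring.
have -> : (vnorm gamma * (T k / B k) + M / LL k + 2 * (T k / B k * mid1 Pi (B k)) + delta * big0 Pi * T k) * B k
  = vnorm gamma * T k + M / LL k * B k + 2 * (T k * mid1 Pi (B k)) + delta * big0 Pi * T k * B k.
  by field; rewrite !gt_eqF.
by rewrite !lerD2r lerD2l.
Qed.

(** [ln (1 / T k)] is an arithmetic progression, and the terms are its powers with exponent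
    [- (1 + kappa)]. *)
Lemma good_scale_loglog_series kappa : 0 < kappa -> exists M, forall N,
  \sum_(0 <= k < N) expR (- ((1 + kappa) * LL k)) <= M.
Proof.
move=> k0; have [rho rho0 Hrho] := gs_ln GS.
apply: (power_series_bounded (x := fun k => ln (T k)^-1) _ rho0) => // k.
apply: lt_le_trans (lnV_small _); first exact: expR_gt0.
by rewrite T0; case: (gs_le GS k).
Qed.
End good_scale.

(** * Maximal inequality along a scale *)

Section along_scale.
Context {R : realType} {d : nat} {d0 : measure_display} {T : measurableType d0}.
Variables (P : probability T R) (X : R -> T -> d.-tuple R).
Variables (gamma : d.-tuple R) (Pi : {measure set (d.-tuple R) -> \bar R}).
Variables (h : R -> R) (t0 lambda : R).
Hypothesis LX : levy_process P X gamma 0 Pi.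
Hypothesis hpos : forall t, 0 < t <= t0 -> 0 < h t^-1.
Hypothesis HV :
  (limf_esup (fun t : R => Vfun Pi (bfun h t) * ((h t^-1) ^+ 2)%:E) ((0:R)^'+)
     <= (lambda ^+ 2 / 2)%:E)%E.

Let HPi : is_levy_measure Pi. Proof. by have [[_ [_ ?]] _] := LX. Qed.

Lemma vnorm_scaleN1 (z : d.-tuple R) : vnorm (vscale (-1) z) = vnorm z.
Proof.
apply/eqP; rewrite -(@eqrXn2 _ 2) ?vnorm_ge0// -!vdot_self vdot_scalel vdotC vdot_scalel.
by rewrite !mulN1r opprK.
Qed.

Section scale.
Variables (L g e eta1 r delta C c : R) (S : nat -> R).
Hypotheses (L0 : 0 < L) (g0 : 0 < g) (e01 : 0 < e <= 1) (eta10 : 0 < eta1).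
Hypothesis he : (1 + e) * (lambda ^+ 2 / 2 + eta1) <= L ^+ 2 / 2.
Hypotheses (r1 : 1 < r) (GS : good_scale Pi h t0 r S).
Hypotheses (del1 : 0 < delta <= 1) (delL : delta <= L / 2) (C0 : 0 < C) (c0 : 0 < c).
Let B k := bfun h (S k).
Let LL k := loglog (S k).
(** The summand [2^-1 ^+ k] keeps [q k] positive, as the logarithm in [fuk_nagaev_choice] demands,
    and leaves the series summable. *)
Let q k := S k * jump4 Pi (B k) + 2^-1 ^+ k.
Let v k := (lambda ^+ 2 / 2 + eta1) / LL k.
Hypothesis HC : forall (z : d.-tuple R) (t b q v eta : R), vnorm z <= 1 ->
    0 < t -> 0 < b <= 1 ->
    t * jump4 Pi b <= q -> t * trunc_dot2 Pi b z <= v * b ^+ 2 ->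
    t * (vnorm gamma + (trunc2 Pi b / (delta * b) + 2 * mid1 Pi b +
         delta * b * big0 Pi)) <= eta * b ->
    forall s th x : R, 0 < s <= t -> 0 <= th ->
    (P [set w | x * b < vdot z (X s w)]%R <=
     (C * q + expR (- (th * x) + th * eta + (1 + e) * th ^+ 2 * v / 2 +
                    C * (expR (delta * th) * q)))%:E)%E.
Hypothesis Hhalf : forall q eta v e, 0 <= q <= c -> eta <= c -> 0 <= v <= c ->
    0 <= e <= 1 ->
    C * q + expR (- (4 / (g / 8) * (g / 8)) + 4 / (g / 8) * eta +
                  (1 + e) * (4 / (g / 8)) ^+ 2 * v / 2 +
                  C * (expR (delta * (4 / (g / 8))) * q)) <= 1 / 2.

Let S0 k : 0 < S k := gs_gt0 GS k.
Let LL1 k : 1 <= LL k.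
Proof. by apply: loglog_ge1; rewrite S0/=; case: (gs_le GS k). Qed.
Let LL0 k : 0 < LL k. Proof. exact: lt_le_trans (LL1 k). Qed.
Let q0 k : 0 < q k.
Proof.
by rewrite ltr_wpDl ?exprn_gt0 ?invr_gt0// mulr_ge0 ?(ltW (S0 k))// jump4_ge0.
Qed.
Let v0 k : 0 <= v k.
Proof. by rewrite divr_ge0 ?(ltW (LL0 k))// addr_ge0 ?(ltW eta10)// divr_ge0 ?sqr_ge0. Qed.

Let sum_q : exists M, forall N, \sum_(0 <= k < N) q k <= M.
Proof.
have j0 k : 0 <= S k * jump4 Pi (B k) by rewrite mulr_ge0 ?(ltW (S0 k))// jump4_ge0.
exists (fine (\sum_(0 <= k <oo) (S k * jump4 Pi (B k))%:E)%E + 2) => N.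
rewrite /q big_split/= lerD ?geometric_half_bounded//.
have s0 : (0 <= \sum_(0 <= k <oo) (S k * jump4 Pi (B k))%:E)%E.
  by apply: nneseries_ge0 => k _ _; rewrite lee_fin.
have slt := good_scale_jump HPi r1 GS.
rewrite -lee_fin fineK ?ge0_fin_numE// -sumEFin.
by apply: nneseries_lim_ge => k _ _; rewrite lee_fin.
Qed.

Let q_to0 : q @ \oo --> (0 : R).
Proof.
apply: nneseries_lty_cvg0; first by move=> k; exact: ltW.
have [M HM] := sum_q.
apply: le_lt_trans (nneseries_le_bound _ HM) (ltry M).
by move=> k; exact: ltW.
Qed.

Let v_to0 : v @ \oo --> (0 : R).
Proof.
rewrite -[X in _ --> X](mulr0 (lambda ^+ 2 / 2 + eta1)).
by apply: cvgM; [exact: cvg_cst|exact: (invr_loglog_cvg0 GS)].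
Qed.

(** The drift allowance has two users: [g / 8] is what the tail at time [S k] tolerates, [c] what
    the bound by [1 / 2] tolerates. *)
Let eta := Num.min (g / 8) c.

Lemma eventually_good : \forall k \near \oo,
  [/\ q k < 1, q k <= c, v k <= c,
   forall z, vnorm z <= 1 -> S k * trunc_dot2 Pi (B k) z <= v k * B k ^+ 2 &
   S k * (vnorm gamma + (trunc2 Pi (B k) / (delta * B k) + 2 * mid1 Pi (B k) +
         delta * B k * big0 Pi)) <= eta * B k].
Proof.
have n1 : \forall k \near \oo, q k < 1 by exact: (cvgr_lt _ q_to0).
have n2 : \forall k \near \oo, q k < c by exact: (cvgr_lt _ q_to0).
have n3 : \forall k \near \oo, v k < c by exact: (cvgr_lt _ v_to0).
have n4 := good_scale_variance HPi hpos HV GS eta10.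
have eta0 : 0 < eta by rewrite lt_min c0 divr_gt0.
have del0 : 0 < delta by case/andP: del1.
have n5 := good_scale_mean HPi hpos HV r1 GS gamma del0 eta0.
by near=> k; split; [near: k|apply: ltW; near: k|apply: ltW; near: k|near: k|near: k].
Unshelve. all: by end_near.
Qed.

Variable z : d.-tuple R.
Hypothesis z1 : vnorm z <= 1.
Let LY := real_levy_projection LX z.
Variable K : nat.
Hypothesis HK : forall k, (K <= k)%N ->
  [/\ q k < 1, q k <= c, v k <= c,
   forall z, vnorm z <= 1 -> S k * trunc_dot2 Pi (B k) z <= v k * B k ^+ 2 &
   S k * (vnorm gamma + (trunc2 Pi (B k) / (delta * B k) + 2 * mid1 Pi (B k) +
         delta * B k * big0 Pi)) <= eta * B k].

Let jq k : S k * jump4 Pi (B k) <= q k.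
Proof. by rewrite lerDl exprn_ge0. Qed.

Lemma tail_at_scale k : (K <= k)%N ->
  (P [set w | (L + g / 4) * B k < vdot z (X (S k) w)]%R <=
   (C * q k + expR C * (q k + expR (- ((1 + g / (4 * L)) * LL k))))%:E)%E.
Proof.
move=> Kk; have [k1 k2 k3 k4 k5] := HK Kk.
have del0 : 0 < delta <= L / 2 by case/andP: del1 => ->.
have etag : eta <= g / 8 by rewrite ge_min lexx.
have hv : (1 + e) * v k <= L ^+ 2 / (2 * LL k).
  rewrite mulrA ler_pdivrMr// (le_trans he)// le_eqVlt; apply/orP; left; apply/eqP.
  by field; rewrite gt_eqF.
have q01 : 0 < q k < 1 by rewrite q0.
have [th th0 Hth] := fuk_nagaev_choice q01 L0 g0 (LL1 k) del0 etag hv C0.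
have ss : 0 < S k <= S k by rewrite S0 lexx.
apply: le_trans (HC z1 (S0 k) (gs_b GS k) (jq k) (k4 z z1) k5 (L + g / 4) ss th0) _.
by rewrite lee_fin lerD2l.
Qed.

(** A lower tail in the direction [z] is an upper tail in the direction [-z]. The tail bound asks
    for a positive time, so [s = 0] is settled by [Y 0 = 0] almost surely. *)
Lemma half_at_scale k s : (K <= k)%N -> 0 <= s <= S k ->
  (P [set w | vdot z (X s w) < - (g / 8 * B k)]%R <= (1 / 2)%:E)%E.
Proof.
move=> Kk /andP[s0 sk]; have [k1 k2 k3 k4 k5] := HK Kk.
have B0 : 0 < B k by case/andP: (gs_b GS k).
have [->|sn0] := eqVneq s 0.
  have [N [mN PN sN]] := rl_zero LY.
  apply: (@le_trans _ _ (P N)).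
    apply: le_measure; rewrite ?inE//.
      rewrite (_ : mkset _ = [set w | g / 8 * B k < - vdot z (X 0 w)]).
        by apply: measurable_set_lt; apply: measurableT_comp => //; exact: (rl_meas LY).
      by apply/seteqP; split => w; rewrite /= ltrNr.
    move=> w /= Hw; apply: sN => /= Y0; move: Hw; rewrite Y0 oppr_gt0.
    by apply/negP; rewrite -leNgt mulr_ge0 ?(ltW B0)// divr_ge0// ltW.
  by rewrite (PN : P N = 0%E) lee_fin divr_ge0.
have sp : 0 < s <= S k by rewrite lt_neqAle eq_sym sn0 s0.
pose z' := vscale (-1) z.
have z'1 : vnorm z' <= 1 by rewrite vnorm_scaleN1.
have th0 : 0 <= 4 / (g / 8) by rewrite divr_ge0// divr_ge0// ltW.
have H := HC z'1 (S0 k) (gs_b GS k) (jq k) (k4 z' z'1) k5 (g / 8) sp th0.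
rewrite (_ : mkset _ = [set w | g / 8 * B k < vdot z' (X s w)]).
  apply: (le_trans H); rewrite lee_fin; apply: Hhalf.
  - by rewrite (ltW (q0 k)).
  - by rewrite ge_min lexx orbT.
  - by rewrite v0.
  - by case/andP: e01 => ? ->; rewrite ltW.
by apply/seteqP; split => w; rewrite /= /z' vdot_scalel mulN1r ltrNr.
Qed.

(** Ottaviani's inequality at the level [L + g / 4] with shift [g / 8], in units of [B k], explains
    [3 * g / 8]. Its covering events have summable probabilities, since [q] is summable and the
    Gaussian term is a power of [ln (1 / S k)] with exponent below [- 1]; Borel-Cantelli
    concludes. *)
Lemma maximal_at_scale : {ae P, forall w, exists n, forall k, (n <= k)%N ->
  forall s, 0 <= s <= S k -> vdot z (X s w) <= (L + 3 * g / 8) * B k}.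
Proof.
have B0 k : 0 < B k by case/andP: (gs_b GS k).
pose a k := C * q k + expR C * (q k + expR (- ((1 + g / (4 * L)) * LL k))).
have a0 k : 0 <= a k.
  rewrite addr_ge0// mulr_ge0 ?expR_ge0 ?(ltW C0) ?(ltW (q0 k))//.
  by rewrite addr_ge0 ?expR_ge0 ?(ltW (q0 k)).
have HG k : exists G : set T, [/\ measurable G, (P G <= (2 * a (K + k)%N)%:E)%E &
    {ae P, forall w, forall s, 0 <= s <= S (K + k)%N ->
      (L + g / 4) * B (K + k)%N + g / 8 * B (K + k)%N < vdot z (X s w) -> G w}].
  have Kk : (K <= K + k)%N by exact: leq_addr.
  have y0 : 0 <= g / 8 * B (K + k)%N by rewrite mulr_ge0 ?(ltW (B0 _))// divr_ge0// ltW.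
  have [G [mG PG aeG]] := ottaviani LY ((L + g / 4) * B (K + k)%N) (S0 (K + k)%N) y0
    (fun s hs => half_at_scale Kk hs).
  exists G; split; [exact: mG| |exact: aeG].
  apply: le_trans PG _.
  rewrite EFinM; apply: lee_wpmul2l; first by rewrite lee_fin.
  exact: tail_at_scale.
have [G HG'] := choice HG.
have sumG : (\sum_(0 <= k <oo) P (G k) < +oo)%E.
  have [M1 HM1] := sum_q.
  have gL : 0 < g / (4 * L) by rewrite divr_gt0// mulr_gt0.
  have [M2 HM2] := good_scale_loglog_series GS gL.
  have HaM N : \sum_(0 <= k < N) a k <= C * M1 + expR C * (M1 + M2).
    have -> : \sum_(0 <= k < N) a k = C * (\sum_(0 <= k < N) q k) + expR C *
      (\sum_(0 <= k < N) q k + \sum_(0 <= k < N) expR (- ((1 + g / (4 * L)) * LL k))).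
      by rewrite -big_split/= !mulr_sumr -big_split.
    apply: lerD; first by rewrite ler_wpM2l ?(ltW C0)//; exact: HM1.
    by rewrite ler_wpM2l ?expR_ge0//; apply: lerD; [exact: HM1|exact: HM2].
  apply: (@le_lt_trans _ _ (\sum_(0 <= k <oo) (2 * a (K + k)%N)%:E)%E).
    by apply: lee_nneseries => k _ *; [exact: measure_ge0|have [] := HG' k].
  apply: le_lt_trans (ltry (2 * (C * M1 + expR C * (M1 + M2)))).
  apply: nneseries_le_bound => [k|N]; first by rewrite mulr_ge0.
  rewrite -mulr_sumr ler_wpM2l//; apply: le_trans (HaM (K + N)%N).
  have -> : \sum_(0 <= k < N) a (K + k)%N = \sum_(K <= j < K + N) a j.
    rewrite -{2}[K]add0n big_addn addKn; apply: eq_bigr => k _.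
    by rewrite addnC.
  rewrite [leRHS](@big_cat_nat _ _ _ K) ?leq_addr//=.
  by rewrite lerDr; apply: sumr_ge0 => k _; exact: a0.
have mG k : measurable (G k) by have [] := HG' k.
have PG0 := lim_sup_set_cvg0 (mu := P) mG sumG.
have ae1 : {ae P, forall w, ~ lim_sup_set G w}.
  exists (lim_sup_set G); split => //.
    by apply: bigcap_measurableType => n _; exact: bigcup_measurable.
  by move=> w /= H; apply: contrapT.
have ae2 : {ae P, forall w, forall k, forall s, 0 <= s <= S (K + k)%N ->
      (L + g / 4) * B (K + k)%N + g / 8 * B (K + k)%N < vdot z (X s w) -> G k w}.
  by apply: ae_foralln => k; have [] := HG' k.
apply: filterS2 ae1 ae2 => w nG wG.
have [n Hn] : exists n, forall j, (n <= j)%N -> ~ G j w.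
  apply: contrapT => H; apply: nG => n _; apply: contrapT => H2.
  by apply: H; exists n => j nj Gj; apply: H2; exists j.
exists (K + n)%N => k Knk s hs.
have Kk : (K <= k)%N by apply: leq_trans Knk; exact: leq_addr.
rewrite leNgt; apply/negP => H.
apply: (Hn (k - K)%N); first by rewrite leq_subRL.
apply: (wG (k - K)%N s); rewrite subnKC// -mulrDl.
by rewrite (_ : L + g / 4 + g / 8 = L + 3 * g / 8)//; field.
Qed.
End scale.
End along_scale.

(** * Finitely many directions *)

Section net.
Context {R : realType} {d : nat}.
Variable N : nat.
Hypothesis N0 : (0 < N)%N.

(** The grid of step [1 / N] in the cube [[-1, 1]^d], a Boolean giving the sign of each coordinate.
    The index type is finite, so almost sure statements can be intersected over it; points of norm
    above 1 are filtered out where it is used. *)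
Definition net_vector (f : {ffun 'I_d -> bool * 'I_N.+1}) : d.-tuple R :=
  [tuple (-1) ^+ (f i).1 * ((f i).2%:R / N%:R) | i < d].

(** Round the numbers [|x_i| / vnorm x] down to multiples of [1 / N] and restore the signs of the
    [x_i]. Rounding down keeps the norm at most 1, and each of the [d] coordinates loses at most
    [vnorm x / N] in the inner product. *)
Lemma net_vector_ex (x : d.-tuple R) : exists f,
  vnorm (net_vector f) <= 1 /\ vnorm x * (1 - d%:R / N%:R) <= vdot (net_vector f) x.
Proof.
have NR : 0 < N%:R :> R by rewrite ltr0n.
pose u i := `|vcoord x i| / vnorm x.
have u0 i : 0 <= u i by rewrite divr_ge0// vnorm_ge0.
have xi_le i : `|vcoord x i| <= vnorm x.
  rewrite -ler_sqr ?nnegrE ?vnorm_ge0// sqr_vnorm (bigD1 i)//= real_normK ?num_real//.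
  by rewrite lerDl sumr_ge0// => j _; exact: sqr_ge0.
have u1 i : u i <= 1.
  (* For [x = 0] the inverse of 0 is 0 by convention, so [u i = 0]. *)
  have [E|nz] := eqVneq (vnorm x) 0; first by rewrite /u E invr0 mulr0.
  by rewrite ler_pdivrMr ?mul1r// lt_neqAle eq_sym nz vnorm_ge0.
pose n i := Num.truncn (N%:R * u i).
have Nu0 i : 0 <= N%:R * u i by rewrite mulr_ge0.
have nN i : (n i < N.+1)%N.
  rewrite ltnS -(ler_nat R); have /andP[H _] := truncn_itv (Nu0 i).
  by apply: (le_trans H); rewrite ler_piMr// ltW.
pose f := [ffun i => (vcoord x i < 0, Ordinal (nN i))].
have zE i : vcoord (net_vector f) i = (-1) ^+ (vcoord x i < 0)%R * ((n i)%:R / N%:R).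
  by rewrite vcoord_mktuple ffunE.
have z_le i : 0 <= (n i)%:R / N%:R :> R /\ (n i)%:R / N%:R <= u i.
  have /andP[H _] := truncn_itv (Nu0 i).
  by split; [rewrite divr_ge0|rewrite ler_pdivrMr// mulrC].
have z_ge i : u i - 1 / N%:R <= (n i)%:R / N%:R.
  have /andP[_ H] := truncn_itv (Nu0 i).
  by rewrite lerBlDr -mulrDl ler_pdivlMr// mulrC natr1 ltW.
exists f; split.
  rewrite -(@ler_pXn2r _ 2) ?nnegrE ?vnorm_ge0// sqr_vnorm expr1n.
  apply: (@le_trans _ _ (\sum_(i < d) u i ^+ 2)).
    apply: ler_sum => i _; rewrite zE exprMn sqrr_sign mul1r.
    by case: (z_le i) => h1 h2; rewrite ler_pXn2r ?nnegrE.
  have -> : \sum_(i < d) u i ^+ 2 = vnorm x ^+ 2 * (vnorm x ^+ 2)^-1.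
    rewrite [in RHS]sqr_vnorm mulr_suml; apply: eq_bigr => i _.
    by rewrite -sqr_vnorm exprMn real_normK ?num_real// exprVn.
  have [->|nz] := eqVneq (vnorm x ^+ 2) 0; first by rewrite mul0r.
  by rewrite mulfV.
have -> : vdot (net_vector f) x = \sum_(i < d) `|vcoord x i| * ((n i)%:R / N%:R).
  by apply: eq_bigr => i _; rewrite zE mulrAC -normrEsign.
apply: (@le_trans _ _ (\sum_(i < d) (`|vcoord x i| * u i - vnorm x / N%:R))).
  rewrite sumrB sumr_const card_ord.
  have -> : \sum_(i < d) `|vcoord x i| * u i = vnorm x.
    have [E|nz] := eqVneq (vnorm x) 0.
      by rewrite E big1// => i _; rewrite /u E invr0 !mulr0.
    rewrite -[RHS](mulfK nz) -expr2 sqr_vnorm mulr_suml; apply: eq_bigr => i _.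
    by rewrite /u mulrA -expr2 real_normK ?num_real.
  by rewrite -[X in _ <= _ - X]mulr_natl le_eqVlt; apply/orP; left; apply/eqP; ring.
apply: ler_sum => i _.
apply: (@le_trans _ _ (`|vcoord x i| * (u i - 1 / N%:R))); last by rewrite ler_wpM2l.
by rewrite mulrBr lerB// mulrA mulr1 ler_wpM2r// invr_ge0 ltW.
Qed.
End net.

Lemma between_scales {R : realType} (S : nat -> R) n t : S @ \oo --> (0 : R) -> 0 < t -> t < S n ->
  exists2 k, (n <= k)%N & S k.+1 < t <= S k.
Proof.
move=> cS t_gt0 tn.
have ex : exists m, S (n + m)%N < t.
  have [N _ HN] : \forall k \near \oo, S k < t by exact: (cvgr_lt _ cS).
  by exists N; apply: HN; exact: leq_addl.
have [[|m] Hm minm] := ex_minnP ex; first by rewrite addn0 in Hm; rewrite ltNge (ltW tn) in Hm.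
exists (n + m)%N; first exact: leq_addr.
rewrite -addnS Hm leNgt; apply/negP => H.
by have := minm _ H; rewrite ltnn.
Qed.

(** * From one direction to the norm, and the limit superior *)

Section norm_limit.
Context {R : realType} {d : nat} {d0 : measure_display} {T : measurableType d0}.
Variables (P : probability T R) (X : R -> T -> d.-tuple R).
Variables (gamma : d.-tuple R) (Pi : {measure set (d.-tuple R) -> \bar R}).
Variables (h : R -> R) (t0 lambda : R).
Hypothesis LX : levy_process P X gamma 0 Pi.
Hypothesis Hh : in_H1 h.
Hypothesis t00 : 0 < t0.
Hypothesis hpos : forall t, 0 < t <= t0 -> 0 < h t^-1.
Hypothesis Iint :
  (\int[lebesgue_measure]_(t in `]0%R, t0]%classic) Pibar Pi (bfun h t) < +oo)%E.
Hypothesis lam0 : 0 <= lambda.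
Hypothesis HV :
  (limf_esup (fun t : R => Vfun Pi (bfun h t) * ((h t^-1) ^+ 2)%:E) ((0:R)^'+)
     <= (lambda ^+ 2 / 2)%:E)%E.

(** Of the surplus [g = L' - lambda], one quarter goes into [L] for the variance and [3 * g / 8]
    into the maximal inequality. The rest pays for [S k.+1 < t <= S k]: replacing [bfun h (S k)] by
    [bfun h t] costs a factor [r ^ 2 = L' / m5]. *)
Lemma direction_bound (z : d.-tuple R) (L' : R) : vnorm z <= 1 -> lambda < L' ->
  {ae P, forall w, \forall t \near (0:R)^'+, vdot z (X t w) <= L' * bfun h t}.
Proof.
move=> z1 lL; pose g := L' - lambda.
have g0 : 0 < g by rewrite subr_gt0.
have L'E : L' = lambda + g by rewrite /g; ring.
clearbody g.
pose L := lambda + g / 4.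
have L0 : 0 < L by rewrite ltr_wpDl// divr_gt0.
pose D := L ^+ 2 - lambda ^+ 2.
have D0 : 0 < D.
  have -> : D = g / 4 * (2 * lambda + g / 4) by rewrite /D /L; field.
  by rewrite mulr_gt0 ?divr_gt0// ltr_wpDl ?mulr_ge0 ?divr_gt0.
have DL : D <= L ^+ 2 by rewrite /D lerBlDr lerDl sqr_ge0.
have L20 : 0 < L ^+ 2 by rewrite exprn_gt0.
(* With this [e] and [eta1 = D / 8], the three errors [eta1], [e * lambda ^ 2 / 2] and [e * eta1]
   are at most [D / 8] each, while [D / 2] is available. *)
pose e := D / (4 * L ^+ 2).
have e01 : 0 < e <= 1.
  rewrite divr_gt0 ?mulr_gt0//= ler_pdivrMr ?mulr_gt0//; lra.
pose eta1 := D / 8.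
have eta10 : 0 < eta1 by rewrite divr_gt0.
have he : (1 + e) * (lambda ^+ 2 / 2 + eta1) <= L ^+ 2 / 2.
  have eL : e * L ^+ 2 = D / 4 by rewrite /e; field; rewrite gt_eqF.
  have e1 : e <= 1 by case/andP: e01.
  have el : e * lambda ^+ 2 <= D / 4.
    rewrite -eL ler_wpM2l//; last by move: D0; rewrite /D subr_gt0 => /ltW.
    by case/andP: e01 => /ltW.
  have ee : e * eta1 <= eta1 by rewrite ler_piMl ?(ltW eta10).
  have DE : D = L ^+ 2 - lambda ^+ 2 by [].
  rewrite mulrDl mul1r mulrDr mulrA; rewrite /eta1 in ee *.
  lra.
pose m5 := lambda + 5 * g / 8.
have m50 : 0 < m5 by rewrite /m5 ltr_wpDl// divr_gt0// mulr_gt0.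
have q1 : 1 < L' / m5.
  rewrite ltr_pdivlMr// mul1r /m5 L'E ltrD2l; lra.
pose r := Num.sqrt (L' / m5).
have r2 : r ^+ 2 = L' / m5 by rewrite sqr_sqrtr// ltW// (lt_trans ltr01).
have r1 : 1 < r by rewrite -sqrtr1 ltr_sqrt// (lt_trans ltr01).
pose delta := Num.min 1 (L / 2).
have del1 : 0 < delta <= 1 by rewrite lt_min ltr01 divr_gt0//= ge_min lexx.
have delL : delta <= L / 2 by rewrite ge_min lexx orbT.
have [C C0 HC] := levy_tail LX e01 del1.
have g80 : 0 < g / 8 by rewrite divr_gt0.
have [c c0 Hc] := half_choice delta C0 g80.
have [S GS] := good_scale_ex Hh t00 hpos Iint r1.
have HPi : is_levy_measure Pi by have [[_ [_ ?]] _] := LX.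
have [K _ HK] := eventually_good LX hpos HV g0 eta10 r1 GS del1 c0.
have Hmax := maximal_at_scale LX L0 g0 e01 eta10 he r1 GS del1 delL C0 HC Hc z1 HK.
apply: filterS Hmax => w [n Hn].
have [n0 _ Sn0] : \forall k \near \oo, S k < Num.min t0 t_small.
  by apply: (cvgr_lt _ (gs_to0 GS)); rewrite lt_min t00 expR_gt0.
have Sn_gt0 := gs_gt0 GS (maxn n n0).
near=> t.
have t_gt0 : 0 < t by near: t; exact: nbhs_right_gt.
have tS : t < S (maxn n n0) by near: t; exact: nbhs_right_lt.
have [k nk /andP[Skt tSk]] := between_scales (gs_to0 GS) t_gt0 tS.
have [tt0 tts] : t <= t0 /\ t <= t_small.
  have := Sn0 _ (leq_maxr n n0); rewrite lt_min => /andP[h1 h2].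
  by split; apply: ltW; apply: (lt_trans tS).
have nk' : (n <= k)%N by apply: leq_trans nk; exact: leq_maxl.
have tk : 0 <= t <= S k by rewrite (ltW t_gt0).
apply: le_trans (Hn k nk' t tk) _.
have -> : L + 3 * g / 8 = m5 by rewrite /L /m5; field.
apply: (@le_trans _ _ (m5 * (r ^+ 2 * bfun h (S k.+1)))).
  by rewrite ler_wpM2l ?(ltW m50)// (gs_bM GS).
rewrite r2 mulrA (mulrC m5) divfK ?gt_eqF//.
rewrite ler_wpM2l//; first by rewrite L'E addr_ge0// ltW.
by apply: (bfun_le Hh hpos) => //; [exact: gs_gt0 GS k.+1|exact: ltW].
Unshelve. all: by end_near.
Qed.

(** [N] is so large that [1 - d / N >= L1 / L]: the loss of the net is covered by the gap between
    [L1] and [L]. The net being finite, the null sets and the neighbourhoods of 0 can be intersected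
    over it. *)
Lemma norm_bound L : lambda < L ->
  {ae P, forall w, \forall t \near (0:R)^'+, vnorm (X t w) <= L * bfun h t}.
Proof.
move=> lL; pose L1 := (lambda + L) / 2.
have [lL1 L1L] : lambda < L1 /\ L1 < L by rewrite /L1; split; lra.
have L10 : 0 < L1 by apply: le_lt_trans lL1.
have L0 : 0 < L by apply: lt_trans L1L.
have gap : 0 < L - L1 by rewrite subr_gt0.
pose N := (Num.truncn (d%:R * L / (L - L1))).+1.
have N0 : (0 < N)%N by [].
have NR : 0 < N%:R :> R by rewrite ltr0n.
have dN : d%:R / N%:R <= (L - L1) / L.
  have a0 : 0 <= d%:R * L / (L - L1) by rewrite divr_ge0 ?mulr_ge0// ltW.
  have /andP[_ /ltW H] := truncn_itv a0.
  by rewrite ler_pdivrMr// mulrAC ler_pdivlMr// -ler_pdivrMl// mulrC.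
have ae_net (f : {ffun 'I_d -> bool * 'I_N.+1}) : {ae P, forall w,
    vnorm (@net_vector R d N f) <= 1 ->
    \forall t \near (0:R)^'+, vdot (@net_vector R d N f) (X t w) <= L1 * bfun h t}.
  have [z1|z1] := boolP (vnorm (@net_vector R d N f) <= 1).
    have := direction_bound z1 lL1.
    by apply: filterS => w Hw _.
  by apply: aeW => w.
have ae_all : {ae P, forall w, forall f : {ffun 'I_d -> bool * 'I_N.+1},
    vnorm (@net_vector R d N f) <= 1 ->
    \forall t \near (0:R)^'+, vdot (@net_vector R d N f) (X t w) <= L1 * bfun h t}.
  exact: filter_forall.
apply: filterS ae_all => w Hw.
have Hw' : \forall t \near (0:R)^'+, forall f : {ffun 'I_d -> bool * 'I_N.+1},
    vnorm (@net_vector R d N f) <= 1 -> vdot (@net_vector R d N f) (X t w) <= L1 * bfun h t.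
  apply: filter_forall => f.
  have [z1|z1] := boolP (vnorm (@net_vector R d N f) <= 1); last by apply: nearW.
  by apply: filterS (Hw f z1) => t Ht _.
have ts0 : 0 < t_small :> R by exact: expR_gt0.
near=> t.
have t_gt0 : 0 < t by near: t; exact: nbhs_right_gt.
have tt0 : t <= t0 by near: t; exact: nbhs_right_le.
have tts : t <= t_small by near: t; exact: nbhs_right_le.
have b0 : 0 < bfun h t by apply: (bfun_gt0 hpos) => //; rewrite t_gt0.
have Ht : forall f : {ffun 'I_d -> bool * 'I_N.+1},
    vnorm (@net_vector R d N f) <= 1 -> vdot (@net_vector R d N f) (X t w) <= L1 * bfun h t.
  by near: t.
have [f [f1 Hf]] := net_vector_ex N0 (X t w).
have {}Hf := le_trans Hf (Ht f f1).
have s1 : L1 / L <= 1 - d%:R / N%:R.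
  rewrite lerBrDr -lerBrDl (le_trans dN)// mulrBl divff ?gt_eqF//.
have H1 : vnorm (X t w) * (L1 / L) <= L1 * bfun h t.
  by apply: le_trans Hf; rewrite ler_wpM2l// vnorm_ge0.
have : vnorm (X t w) * (L1 / L) <= L * bfun h t * (L1 / L).
  by rewrite (_ : L * _ * _ = L1 * bfun h t)//; field; rewrite gt_eqF.
by rewrite ler_pM2r// divr_gt0.
Unshelve. all: by end_near.
Qed.

Lemma limsup_le L w : (\forall t \near (0:R)^'+, vnorm (X t w) <= L * bfun h t) ->
  (limf_esup (fun t : R => (h t^-1 * vnorm (X t w) / Num.sqrt (t * ln (ln t^-1)))%:E)
        ((0:R)^'+) <= L%:E)%E.
Proof.
move=> Hw.
have H : \forall t \near (0:R)^'+,
    h t^-1 * vnorm (X t w) / Num.sqrt (t * ln (ln t^-1)) <= L.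
  have ts0 : 0 < t_small :> R by exact: expR_gt0.
  near=> t.
  have t_gt0 : 0 < t by near: t; exact: nbhs_right_gt.
  have tt0 : t <= t0 by near: t; exact: nbhs_right_le.
  have tts : t <= t_small by near: t; exact: nbhs_right_le.
  have h0 : 0 < h t^-1 by apply: hpos; rewrite t_gt0.
  have b0 : 0 < bfun h t by apply: (bfun_gt0 hpos) => //; rewrite t_gt0.
  have s0 : 0 < Num.sqrt (t * ln (ln t^-1)).
    by move: b0; rewrite /bfun pmulr_lgt0// invr_gt0.
  rewrite ler_pdivrMr// mulrC -ler_pdivlMr// -mulrA.
  by near: t.
(* The limit superior is an infimum, over neighbourhoods, of suprema; the set where the bound holds
   is itself one of these neighbourhoods. *)
apply: ereal_inf_le; exists
  (ereal_sup [set (h t^-1 * vnorm (X t w) / Num.sqrt (t * ln (ln t^-1)))%:E | t in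
    [set t | h t^-1 * vnorm (X t w) / Num.sqrt (t * ln (ln t^-1)) <= L]]).
  by exists [set t | h t^-1 * vnorm (X t w) / Num.sqrt (t * ln (ln t^-1)) <= L].
by apply: ge_ereal_sup => _ [t /= Ht <-]; rewrite lee_fin.
Unshelve. all: by end_near.
Qed.
End norm_limit.

Unset Implicit Arguments. Set Strict Implicit. Set Printing Implicit Defensive.

Theorem theorem2p1 (R : realType) (d : nat) (d0 : measure_display)
  (T : measurableType d0) (P : probability T R) (X : R -> T -> d.-tuple R)
  (gamma : d.-tuple R) (Pi : {measure set (d.-tuple R) -> \bar R})
  (h : R -> R) (t0 lambda : R) :
  levy_process P X gamma 0 Pi ->
  in_H1 h ->
  0 < t0 < expR (-1) ->
  (forall t, 0 < t <= t0 -> 0 < h t^-1) ->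
  (\int[lebesgue_measure]_(t in `]0%R, t0]%classic) Pibar Pi (bfun h t) < +oo)%E ->
  0 <= lambda ->
  (limf_esup (fun t : R => Vfun Pi (bfun h t) * ((h t^-1) ^+ 2)%:E) ((0:R)^'+)
     <= (lambda ^+ 2 / 2)%:E)%E ->
  {ae P, forall w : T,
     (limf_esup (fun t : R => (h t^-1 * vnorm (X t w) / Num.sqrt (t * ln (ln t^-1)))%:E)
        ((0:R)^'+) <= lambda%:E)%E}.
Proof.
move=> LX Hh /andP[t00 _] hpos Iint lam0 HV.
(* The null set of [norm_bound] depends on the level, so countably many levels decreasing to
   [lambda] are used, and a single null set serves every [eps]. *)
have ae_n n : {ae P, forall w, \forall t \near (0:R)^'+,
    vnorm (X t w) <= (lambda + n.+1%:R^-1) * bfun h t}.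
  by apply: (norm_bound LX Hh t00 hpos Iint lam0 HV); rewrite ltrDl invr_gt0.
have := ae_foralln ae_n; apply: filterS => w Hw.
apply/lee_addgt0Pr => eps eps0.
have epsV0 : 0 <= eps^-1 by rewrite invr_ge0 ltW.
have /andP[_ /ltW Hn] := truncn_itv epsV0.
apply: le_trans (limsup_le t00 hpos (Hw (Num.truncn eps^-1))) _.
rewrite -EFinD lee_fin lerD2l invf_ple ?posrE//.
Qed.
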